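(* Let $\pi$ be a set of primes with $2,3\in\pi$. Let $q$ be a power of an odd prime $p\notin\pi$, let $\varepsilon=(-1)^{(q-1)/2}$, and let $G\simeq\mathrm{SL}_2(q)\simeq\mathrm{SL}_2^\eta(q)\simeq\mathrm{Sp}_2(q)$ with $\eta\in\{+,-\}$. Then: (A) If $G\in E_\pi$ and $H$ is a $\pi$-Hall subgroup of $G$, then one of the following holds: (a) $\pi\cap\pi(G)\subseteq\pi(q-\varepsilon)$, and $\mathrm{P}H$ is a $\pi$-Hall subgroup in the dihedral subgroup $D_{q-\varepsilon}$ of order $q-\varepsilon$ of $\mathrm{P}G$. All $\pi$-Hall subgroups of this type are conjugate in $G$. (b) $\pi\cap\pi(G)=\{2,3\}$, $(q^2-1)_{\{2,3\}}=24$, $\mathrm{P}H\simeq\mathrm{Alt}_4$. All $\pi$-Hall subgroups of this type are conjugate in $G$. (c) $\pi\cap\pi(G)=\{2,3\}$, $(q^2-1)_{\{2,3\}}=48$, $\mathrm{P}H\simeq\mathrm{Sym}_4$. There exist exactly two classes of conjugate subgroups of this type, and $\mathrm{PGL}_2^\eta(q)$ interchanges these classes. (d) $\pi\cap\pi(G)=\{2,3,5\}$, $(q^2-1)_{\{2,3,5\}}=120$, $\mathrm{P}H\simeq\mathrm{Alt}_5$. There exist exactly two classes of conjugate subgroups of this type, and $\mathrm{PGL}_2^\eta(q)$ interchanges these classes. (B) Conversely, if $\pi$ and $(q^2-1)_\pi$ satisfy the (arithmetic) conditions of one of (a)–(d), then $G\in E_\pi$. (C) If $G\in E_\pi$, then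 $k_\pi(G)\in\{1,2,3\}$. (D) If $G\in E_\pi$ and $H$ is a $\pi$-Hall subgroup of $G$, then there exists a $\pi$-subgroup $K\le G$ which is not conjugate in $G$ to a subgroup of $H$; in particular $G\notin D_\pi$. (E) Every $\pi$-Hall subgroup of $\mathrm{P}G$ can be obtained as $\mathrm{P}H$ for some $\pi$-Hall subgroup $H$ of $G$. Conversely, if $\mathrm{P}H$ is a $\pi$-Hall subgroup of $\mathrm{P}G$ and $H$ is the complete preimage of $\mathrm{P}H$ in $G$, then $H$ is a $\pi$-Hall subgroup of $G$.
   Context: $\mathrm{SL}_2^+(q)=\mathrm{SL}_2(q)$, $\mathrm{SL}_2^-(q)=\mathrm{SU}_2(q)$, $\mathrm{PGL}_2^\pm(q)$ is the corresponding projective general linear/unitary group. For a subgroup $A$ of $G$, $\mathrm{P}A$ is its image modulo scalars (in $\mathrm{P}G=G/Z(G)\simeq\mathrm{PSL}_2(q)$). $\pi(n)$ is the set of prime divisors of $n$, $\pi(G)=\pi(|G|)$, and $n_\pi$ is the largest divisor $t$ of $n$ with $\pi(t)\subseteq\pi$. A $\pi$-group is a finite group $X$ with $\pi(X)\subseteq\pi$. A $\pi$-Hall subgroup of $G$ is a subgroup $H$ with $\pi(H)\subseteq\pi$ and $\pi(|G:H|)\cap\pi=\varnothing$. $G\in E_\pi$ means that $G$ has a $\pi$-Hall subgroup; $k_\pi(G)$ is the number of conjugacy classes of $\pi$-Hall subgroups; $G\in D_\pi$ means that $k_\pi(G)=1$ and every $\pi$-subgroup lies in a $\pi$-Hall subgroup.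 *)

(* Defs.v *)
From mathcomp Require Import all_boot all_order all_algebra.
From mathcomp Require Import all_fingroup all_solvable.

Set Implicit Arguments.
Unset Strict Implicit.
Unset Printing Implicit Defensive.

Import GRing.Theory.
Local Open Scope group_scope.

Variant sign := Plus | Minus.

(* GL_2^eta(q) and SL_2^eta(q) are made of matrices over the field with
   q ^ field_degree eta elements. *)
Definition field_degree (eta : sign) : nat :=
  match eta with Plus => 1%N | Minus => 2 end.

(* Entrywise x |-> x ^ q followed by transposition: the conjugate transpose
   when K has q ^ 2 elements. *)
Definition conj_trmx (K : finFieldType) (q : nat) (A : 'M[K]_2) : 'M[K]_2 :=
  ((map_mx (fun x : K => (x ^+ q)%R) A)^T)%R.

(* GL_2(q) for Plus, and for Minus the group GU_2(q) of the Hermitian form with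
   identity Gram matrix; all nondegenerate Hermitian forms on a plane over a
   finite field are equivalent.  These are subgroups only when K has
   q ^ field_degree eta elements, hence the type {set _}. *)
Definition GL2 (eta : sign) (q : nat) (K : finFieldType) : {set {'GL_2[K]}} :=
  match eta with
  | Plus => 'GL_2[K]
  | Minus =>
      [set A : {'GL_2[K]} | GLval A *m conj_trmx q (GLval A) == 1%:M]%R
  end.

Definition SL2 (eta : sign) (q : nat) (K : finFieldType) : {set {'GL_2[K]}} :=
  [set A in GL2 eta q K | (\det (GLval A) == 1)%R].

Definition PGL2 (eta : sign) (q : nat) (K : finFieldType) :
    {set coset_of 'Z(GL2 eta q K)} :=
  GL2 eta q K / 'Z(GL2 eta q K).

(* The image of a subgroup A of G under the element u of PGL_2^eta(q), where G
   is identified with SL_2^eta(q) along phi.  The central factor in the choice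
   of the representative of u does not affect the conjugate. *)
Definition PGL2_conj (eta : sign) (q : nat) (K : finFieldType)
    (gT : finGroupType) (G : {group gT}) (phi : {morphism G >-> {'GL_2[K]}})
    (u : coset_of 'Z(GL2 eta q K)) (A : {set gT}) : {set gT} :=
  phi @*^-1 ((phi @* A) :^ repr u).

Definition E_pi (pi : nat_pred) (gT : finGroupType) (G : {group gT}) : Prop :=
  exists H : {group gT}, pi.-Hall(G) H.

(* The G-conjugacy classes of the subgroups satisfying P. *)
Definition classes_of (gT : finGroupType) (G : {group gT})
    (P : pred {group gT}) : {set {set {set gT}}} :=
  [set (H : {set gT}) :^: G | H : {group gT} & P H].

Definition k_pi (pi : nat_pred) (gT : finGroupType) (G : {group gT}) : nat :=
  #|classes_of G (fun H => pi.-Hall(G) H)|.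

Definition D_pi (pi : nat_pred) (gT : finGroupType) (G : {group gT}) : Prop :=
  k_pi pi G = 1%N /\
  forall K : {group gT}, K \subset G -> pi.-group K ->
    exists2 H : {group gT}, pi.-Hall(G) H & K \subset H.

Definition all_conjugate (gT : finGroupType) (G : {group gT})
    (P : pred {group gT}) : Prop :=
  forall H1 H2 : {group gT}, P H1 -> P H2 ->
    exists2 x, x \in G & H2 :=: H1 :^ x.

Definition two_classes_swapped (eta : sign) (q : nat) (K : finFieldType)
    (gT : finGroupType) (G : {group gT}) (phi : {morphism G >-> {'GL_2[K]}})
    (P : pred {group gT}) : Prop :=
  exists C1 C2 : {set {set gT}},
    [/\ C1 != C2, classes_of G P = [set C1; C2] &
        exists u : coset_of 'Z(GL2 eta q K),
          [/\ u \in PGL2 eta q K,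
              [set PGL2_conj phi u A | A in C1] = C2 &
              [set PGL2_conj phi u A | A in C2] = C1]].

Definition eps (q : nat) : int := ((-1) ^+ (q.-1 %/ 2)%N)%R.

Definition q_sub_eps (q : nat) : nat := absz (q%:Z - eps q)%R.

Definition pi23 : nat_pred := pred2 2 3.
Definition pi235 : nat_pred := pred3 2 3 5.

Section Conditions.
Variables (pi : nat_pred) (q : nat) (gT : finGroupType) (G : {group gT}).

Definition arith_a : Prop :=
  {subset [predI pi & \pi(G)] <= \pi(q_sub_eps q)}.

Definition arith_b : Prop :=
  [predI pi & \pi(G)] =i pi23 /\ ((q ^ 2 - 1)`_pi23 = 24)%N.

Definition arith_c : Prop :=
  [predI pi & \pi(G)] =i pi23 /\ ((q ^ 2 - 1)`_pi23 = 48)%N.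

Definition arith_d : Prop :=
  [predI pi & \pi(G)] =i pi235 /\ ((q ^ 2 - 1)`_pi235 = 120)%N.

End Conditions.

Section Types.
Variables (pi : nat_pred) (q : nat) (gT : finGroupType) (G : {group gT}).

(* PH is H / 'Z(G).  The dihedral subgroups of order q - eps of PG form one
   conjugacy class, so D is determined up to conjugation in PG. *)
Definition type_a (H : {group gT}) : bool :=
  pi.-Hall(G) H &&
  [exists D : {group coset_of 'Z(G)},
     [&& D \subset G / 'Z(G), D \isog 'D_(q_sub_eps q)
       & pi.-Hall(D) (H / 'Z(G))]].

Definition type_b (H : {group gT}) : bool :=
  pi.-Hall(G) H && (H / 'Z(G) \isog 'Alt_('I_4)).

Definition type_c (H : {group gT}) : bool :=
  pi.-Hall(G) H && (H / 'Z(G) \isog 'Sym_('I_4)).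

Definition type_d (H : {group gT}) : bool :=
  pi.-Hall(G) H && (H / 'Z(G) \isog 'Alt_('I_5)).

End Types.

(* Main.v *)
(* Let S be SL_2 over the field F of q elements.  In a subgroup H of S that
   contains -1 and has order prime to p, the centralizers of the elements
   outside {1, -1} are abelian, have index at most 2 in their normalizers and
   meet pairwise in {1, -1}.  Counting them (Dickson) shows that H has an abelian
   subgroup of index at most 2, or has order 24, 48 or 120 and a quotient Alt_4,
   Sym_4 or Alt_5.  Noncentral elements of S of the same trace <> 2, -2 are
   conjugate, and a^2 + b^2 = -1 has a solution, which gives a quaternion group
   Q of order 8.  Types (b) and (c) are the normalizers N_S(Q) of such groups; in
   type (c) there are two classes because N_GL(Q) = F^* N_S(Q) contains only
   elements of square determinant.  In type (d) H is generated by N_S(Q) and one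
   element (i + t j + (1 - t) k) / 2 with t^2 = t + 1, and the two roots t give
   the two classes.  SU_2(q) is conjugate, up to scalars together with GU_2(q),
   to SL_2 over the fixed field of x |-> x^q. *)

Require Import Defs.
From HB Require Import structures.
From mathcomp Require Import all_boot all_order all_algebra.
From mathcomp Require Import all_fingroup all_solvable all_field.
From mathcomp Require Import zify ring.

Set Implicit Arguments.
Unset Strict Implicit.
Unset Printing Implicit Defensive.

Import GRing.Theory.
Local Open Scope group_scope.

(** * Dickson's counting argument *)

(** The types (b), (c) and (d) are given by the isomorphism type of the image modulo scalars,
    whereas the counting yields orders and centralizers, so both have to be derived from each other.
    The image is found from an action on four centralizers of order 6 or on five quaternion
    subgroups. Conversely, a Hall subgroup with such an image has no abelian subgroup of index at
    most 2: otherwise its image would have one too, and so would that of an explicit group with an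
    isomorphic image, in which two elements of order 3 do not commute. This pair is always w = (-1 +
    i + j + ij) / 2 and its conjugate by i. A Hall subgroup has order divisible by 24, so an abelian
    subgroup of index at most 2 contains a square root of -1. All such roots are conjugate, which
    leads to one dihedral group in type (a). As p is not in pi, 2 and 3 are invertible in F, and so
    is 5 in type (d). The two icosahedral classes are told apart by a trace 1/2: its square 1/4 is
    never the square of a trace in an icosahedral Hall subgroup, because 2, 3 and 5 are
    invertible. *)

Section ClassEquation.

Implicit Types n m N f : nat.

(* A conjugacy class of f centralizers of order m with normalizers of order N. *)
Definition class_datum n m N f :=
  [/\ n = f * N, N = m \/ N = 2 * m, ~~ odd m & 4 <= m]%N.

(** As N <= 2m and m >= 4, the ratio (m - 2) / N is at least 1/4. Each class thus takes a quarter of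
    the group, and at most three classes fit into n - 2. *)
Lemma class_datum_weight n m N f :
  class_datum n m N f -> 0 < n -> (n <= 4 * (f * (m - 2)))%N.
Proof. by case=> -> [] -> _ m4 _; nia. Qed.

(** If N = 2m, the equation reads f (m + 2) = 2, which is absurd; so N = m, f = 1 and n = m. *)
Lemma one_class n m N f :
  class_datum n m N f -> 0 < n -> (f * (m - 2) = n - 2)%N -> (n <= 2 * m)%N.
Proof. by case=> -> [] -> _ m4 n0 e; nia. Qed.

(** If N2 = m2 as well, both classes weigh at least n/2, which is too much. Otherwise, with m1 = 2
    c1 and m2 = 2 c2, the equation becomes 1/c1 + 1/(2 c2) = 1/2 + 2/n. Here c1 = 2 gives n = 2 m2,
    c1 = 3 gives c2 = 2 and n = 24, and for c1 >= 4 the left side is too small. *)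
Lemma two_classes_sym n m1 N1 f1 m2 N2 f2 :
  class_datum n m1 N1 f1 -> class_datum n m2 N2 f2 -> 0 < n ->
  (f1 * (m1 - 2) + f2 * (m2 - 2) = n - 2)%N -> N1 = m1 ->
  (n <= 2 * m2)%N \/
  [/\ n = 24, (m1, N1) = (6, 6) & (m2, N2) = (4, 8)].
Proof.
case=> n1 _ o1 M1 [n2 k2 o2 M2] n0 e E1; subst N1.
have [c1 Ec1] : exists c, m1 = (2 * c)%N by exists (m1./2); lia.
have [c2 Ec2] : exists c, m2 = (2 * c)%N by exists (m2./2); lia.
subst m1 m2; case: k2 => E2; subst N2.
  exfalso.
  have a1 : (4 * f1 <= n)%N by rewrite n1; nia.
  have a2 : (4 * f2 <= n)%N by rewrite n2; nia.
  have e1 : (f1 * (2 * c1 - 2) = n - 2 * f1)%N by rewrite n1; nia.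
  have e2 : (f2 * (2 * c2 - 2) = n - 2 * f2)%N by rewrite n2; nia.
  lia.
have [c1_2|c1_3|c1_4] : [\/ c1 = 2, c1 = 3 | 4 <= c1]%N.
- by case: c1 M1 o1 n1 e => [|[|[|[|c]]]] // *; first [by apply: Or31 | by apply: Or32 | by apply: Or33].
- by left; subst c1; nia.
- subst c1.
  have e1 : (3 * f1 = 2 * c2 * f2)%N by nia.
  have e2 : (f1 + 2 = 2 * f2)%N by nia.
  have c2_2 : c2 = 2.
    have : (c2 < 3)%N by nia.
    lia.
  by right; subst c2; split; [nia|..]; congr (_, _); lia.
- by exfalso; nia.
Qed.

Lemma two_classes n m1 N1 f1 m2 N2 f2 :
  class_datum n m1 N1 f1 -> class_datum n m2 N2 f2 -> 0 < n ->
  (f1 * (m1 - 2) + f2 * (m2 - 2) = n - 2)%N ->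
  [\/ n <= 2 * m1, n <= 2 * m2 |
      n = 24 /\ perm_eq [:: (m1, N1); (m2, N2)] [:: (4, 8); (6, 6)]]%N.
Proof.
move=> d1 d2 n0 e.
have [k1|k1] : N1 = m1 \/ N1 = (2 * m1)%N by case: d1.
  case: (two_classes_sym d1 d2 n0 e k1) => [|[-> -> ->]]; first exact: Or32.
  by apply: Or33.
have [k2|k2] : N2 = m2 \/ N2 = (2 * m2)%N by case: d2.
  rewrite addnC in e.
  case: (two_classes_sym d2 d1 n0 e k2) => [|[-> -> ->]]; first exact: Or31.
  by apply: Or33.
(* When N = 2m for both classes the equation forces f1 + f2 = 1, but both are positive. *)
exfalso; case: d1 => n1 _ _ M1; case: d2 => n2 _ _ M2; subst N1 N2.
have e1 : (2 * (f1 * (m1 - 2)) + 4 * f1 = n)%N by rewrite n1; nia.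
have e2 : (2 * (f2 * (m2 - 2)) + 4 * f2 = n)%N by rewrite n2; nia.
have [f10 f20] : (0 < f1 /\ 0 < f2)%N by nia.
lia.
Qed.

(** A class with N = m would weigh n/2 and leave less than n/2 for the two others. So N = 2m
    throughout, and with m = 2c the equation is 1/c1 + 1/c2 + 1/c3 = 1 + 4/n. Its solutions are
    those of the polyhedral groups: (2, 2, c) with n = 4c, (2, 3, 3), (2, 3, 4) and (2, 3, 5). *)
Lemma three_classes_sorted n m1 N1 f1 m2 N2 f2 m3 N3 f3 :
  class_datum n m1 N1 f1 -> class_datum n m2 N2 f2 -> class_datum n m3 N3 f3 ->
  0 < n -> (f1 * (m1 - 2) + f2 * (m2 - 2) + f3 * (m3 - 2) = n - 2)%N ->
  (m1 <= m2)%N -> (m2 <= m3)%N ->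
  (n <= 2 * m3)%N \/
  [\/ n = 24 /\ [:: (m1, N1); (m2, N2); (m3, N3)] = [:: (4, 8); (6, 12); (6, 12)],
      n = 48 /\ [:: (m1, N1); (m2, N2); (m3, N3)] = [:: (4, 8); (6, 12); (8, 16)] |
      n = 120 /\ [:: (m1, N1); (m2, N2); (m3, N3)] = [:: (4, 8); (6, 12); (10, 20)]].
Proof.
move=> d1 d2 d3 n0 e le12 le23.
have w1 := class_datum_weight d1 n0; have w2 := class_datum_weight d2 n0.
have w3 := class_datum_weight d3 n0.
have k1 : N1 = (2 * m1)%N by case: d1 => E [] // E' _ M; exfalso; nia.
have k2 : N2 = (2 * m2)%N by case: d2 => E [] // E' _ M; exfalso; nia.
have k3 : N3 = (2 * m3)%N by case: d3 => E [] // E' _ M; exfalso; nia.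
case: d1 => n1 _ o1 M1; case: d2 => n2 _ o2 M2; case: d3 => n3 _ o3 M3.
subst N1 N2 N3; clear w1 w2 w3.
have [c1 Ec1] : exists c, m1 = (2 * c)%N by exists (m1./2); lia.
have [c2 Ec2] : exists c, m2 = (2 * c)%N by exists (m2./2); lia.
have [c3 Ec3] : exists c, m3 = (2 * c)%N by exists (m3./2); lia.
subst m1 m2 m3.
have [h Eh] : exists h, n = (2 * h)%N by exists (2 * (c1 * f1))%N; nia.
have h1 : h = (2 * c1 * f1)%N by nia.
have h2 : h = (2 * c2 * f2)%N by nia.
have h3 : h = (2 * c3 * f3)%N by nia.
have E : (h + 2 = 2 * (f1 + f2 + f3))%N by nia.
have c1_2 : c1 = 2.
  have [|c] := leqP c1 2; first by lia.
  have a1 : (6 * f1 <= h)%N by rewrite h1 leq_mul2r; apply/orP; right; lia.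
  have a2 : (6 * f2 <= h)%N by rewrite h2 leq_mul2r; apply/orP; right; lia.
  have a3 : (6 * f3 <= h)%N by rewrite h3 leq_mul2r; apply/orP; right; lia.
  by exfalso; lia.
have {}E : (f1 + 1 = f2 + f3)%N by rewrite h1 c1_2 in E; lia.
have c2_3 : (c2 <= 3)%N.
  rewrite leqNgt; apply/negP=> c.
  have a2 : (8 * f2 <= h)%N by rewrite h2 leq_mul2r; apply/orP; right; lia.
  have a3 : (8 * f3 <= h)%N by rewrite h3 leq_mul2r; apply/orP; right; lia.
  by rewrite h1 c1_2 in a2 a3; lia.
have [c2_2|c2_eq] : c2 = 2 \/ c2 = 3 by lia.
  left; have f21 : f1 = f2 by rewrite h1 c1_2 c2_2 in h2; lia.
  have f31 : f3 = 1%N by lia.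
  by rewrite Eh h3 f31; lia.
right; rewrite c2_eq in h2 le23.
have [g [g1 g2]] : exists g, f1 = (3 * g)%N /\ f2 = (2 * g)%N.
  by exists (f2./2); rewrite h1 c1_2 in h2; lia.
have g3 : f3 = g.+1 by lia.
have Eg : ((6 - c3) * g.+1 = 6)%N.
  by rewrite g3 h1 c1_2 g1 in h3; nia.
have [c3_3|c3_4|c3_5] : [\/ c3 = 3, c3 = 4 | c3 = 5].
- have : (c3 < 6)%N by case: (ltnP c3 6) => // c; exfalso; nia.
  case: c3 {M3 o3 n3 h3 Eg e} le23 => [|[|[|[|[|[|]]]]]] //= _ _;
  first [by apply: Or31 | by apply: Or32 | by apply: Or33].
- by apply: Or31; subst; split; [lia | congr [:: _; _; _]; congr (_, _); lia].
- by apply: Or32; subst; split; [lia | congr [:: _; _; _]; congr (_, _); lia].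
- by apply: Or33; subst; split; [lia | congr [:: _; _; _]; congr (_, _); lia].
Qed.

Lemma three_classes n m1 N1 f1 m2 N2 f2 m3 N3 f3 :
  class_datum n m1 N1 f1 -> class_datum n m2 N2 f2 -> class_datum n m3 N3 f3 ->
  0 < n -> (f1 * (m1 - 2) + f2 * (m2 - 2) + f3 * (m3 - 2) = n - 2)%N ->
  let s := [:: (m1, N1); (m2, N2); (m3, N3)] in
  [\/ n <= 2 * m1, n <= 2 * m2 | n <= 2 * m3]%N \/
  [\/ n = 24 /\ perm_eq s [:: (4, 8); (6, 12); (6, 12)],
      n = 48 /\ perm_eq s [:: (4, 8); (6, 12); (8, 16)] |
      n = 120 /\ perm_eq s [:: (4, 8); (6, 12); (10, 20)]].
Proof.
move=> d1 d2 d3 n0 e s.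
have S a b c : a = s -> perm_eq s a by move->.
pose d := [:: (m1, N1, f1); (m2, N2, f2); (m3, N3, f3)].
pose t := sort (fun x y => x.1.1 <= y.1.1)%N d.
have pt : perm_eq d t by rewrite perm_sym perm_sort.
have st : sorted (fun x y => x.1.1 <= y.1.1)%N t.
  by apply: sort_sorted => x y; apply: leq_total.
have dt x : x \in t -> class_datum n x.1.1 x.1.2 x.2 /\
    ((n <= 2 * x.1.1)%N -> [\/ n <= 2 * m1, n <= 2 * m2 | n <= 2 * m3]%N).
  rewrite -(perm_mem pt) !inE => /or3P[] /eqP-> /=; split => //;
  by [apply: Or31 | apply: Or32 | apply: Or33].
have et : (\sum_(x <- t) x.2 * (x.1.1 - 2) = n - 2)%N.
  by rewrite -(perm_big _ pt) /= !big_cons big_nil /= addn0 addnA.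
have mt : perm_eq s [seq x.1 | x <- t].
  by rewrite (perm_map fst pt).
move: (perm_size pt); case: t st dt et mt {pt}
  => [|[[a1 b1] g1] [|[[a2 b2] g2] [|[[a3 b3] g3] []]]] //= /and3P[l12 l23 _] dt.
rewrite !big_cons big_nil addn0 addnA /= => et mt _.
have [D1 i1] := dt (a1, b1, g1) (mem_head _ _).
have [D2 i2] : _ /\ _ := dt (a2, b2, g2) ltac:(by rewrite !inE eqxx orbT).
have [D3 i3] : _ /\ _ := dt (a3, b3, g3) ltac:(by rewrite !inE eqxx !orbT).
case: (three_classes_sorted D1 D2 D3 n0 et l12 l23) => [/i3|]; first by left.
move=> o; right; case: o => -[-> E]; rewrite E in mt;
  by [apply: Or31 | apply: Or32 | apply: Or33].
Qed.

End ClassEquation.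

Section Centralizers.

Variables (gT : finGroupType) (Z : {set gT}).
Implicit Types (H : {group gT}) (x y : gT).

(* The centralizers of the elements outside Z, with the orders of their
   normalizers, are those of the list s, and two of the same order are
   conjugate. *)
Definition centralizer_type H (s : seq (nat * nat)) :=
  [/\ forall x, x \in H :\: Z -> (#|'C_H[x]|, #|'N_H('C_H[x])|) \in s,
      forall x y, x \in H :\: Z -> y \in H :\: Z -> #|'C_H[x]| = #|'C_H[y]| ->
        exists2 h, h \in H & 'C_H[y] = 'C_H[x] :^ h &
      forall m N, (m, N) \in s -> exists x, [/\ x \in H :\: Z,
        #|'C_H[x]| = m & #|'N_H('C_H[x])| = N]].

Definition almost_abelian H :=
  exists A : {group gT}, [/\ A \subset H, abelian A & #|H| <= 2 * #|A|]%N.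

Definition tetrahedral H :=
  #|H| = 24 /\ centralizer_type H [:: (4, 8); (6, 6)].
Definition octahedral H :=
  #|H| = 48 /\ centralizer_type H [:: (4, 8); (6, 12); (8, 16)].
Definition icosahedral H :=
  #|H| = 120 /\ centralizer_type H [:: (4, 8); (6, 12); (10, 20)].

(** All that the counting needs to know about a subgroup of SL_2 of order prime to p, with [Z] in
    the role of {1, -1}. *)
Definition dickson_hyp H :=
  [/\ Z \subset H, H \subset 'C(Z), #|Z| = 2,
      {in H :\: Z, forall x, abelian 'C_H[x]} &
      {in H :\: Z, forall x, #|'N_H('C_H[x])| <= 2 * #|'C_H[x]|}%N].

End Centralizers.

Section Dickson.

Variables (gT : finGroupType) (H Z : {group gT}).
Hypothesis hyp : dickson_hyp Z H.

Let sZH : Z \subset H. Proof. by case: hyp. Qed.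
Let cHZ : H \subset 'C(Z). Proof. by case: hyp. Qed.
Let oZ : #|Z| = 2. Proof. by case: hyp. Qed.
Let abC x : x \in H :\: Z -> abelian 'C_H[x]. Proof. by case: hyp => _ _ _ h _; apply: h. Qed.

Lemma center_sub_cent1 x : x \in H -> Z \subset 'C_H[x].
Proof. by move=> Hx; rewrite subsetI sZH sub_cent1 (subsetP cHZ). Qed.

Lemma mem_cent1 x : x \in H :\: Z -> x \in 'C_H[x].
Proof. by case/setDP=> Hx _; rewrite inE Hx cent1id. Qed.

(** Each of the two centralizers is abelian and contains both x and y, hence lies in the other. *)
Lemma cent1_eq x y : x \in H :\: Z -> y \in 'C_H[x] :\: Z -> 'C_H[y] = 'C_H[x].
Proof.
move=> Hx /setDP[Cy nZy]; have [Hy cxy] := setIP Cy.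
have Hy' : y \in H :\: Z by rewrite inE nZy.
apply/eqP; rewrite eqEsubset !subsetI !subsetIl /= !sub_cent1.
rewrite (subsetP (abC Hx)) // andbT (subsetP (abC Hy')) //.
by rewrite inE cent1C cxy andbT; case/setDP: Hx.
Qed.

Lemma cent1_conj x h : h \in H -> 'C_H[x] :^ h = 'C_H[x ^ h].
Proof. by move=> Hh; rewrite conjIg conjGid // cent1J. Qed.

Lemma setD_conj x h : x \in H :\: Z -> h \in H -> x ^ h \in H :\: Z.
Proof.
case/setDP=> Hx nZx Hh; rewrite in_setD; apply/andP; split; last exact: groupJ.
apply: contra nZx => Zxh.
have c : h * x ^ h = x ^ h * h by apply: (centP (subsetP cHZ _ Hh)).
by rewrite -(conjgK h x) conjgE invgK mulgA c mulgK.
Qed.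

Lemma class_datum_cent1 x : x \in H :\: Z ->
  class_datum #|H| #|'C_H[x]| #|'N_H('C_H[x])| #|'C_H[x] :^: H|.
Proof.
move=> Hx; have sZC : Z \subset 'C_H[x] by apply: center_sub_cent1; case/setDP: Hx.
have d2C : (2 %| #|'C_H[x]|)%N by have := cardSg sZC; rewrite oZ.
split.
- by rewrite card_conjugates mulnC Lagrange ?subsetIl.
- have : #|'C_H[x]| %| #|'N_H('C_H[x])|.
    by apply: cardSg; rewrite subsetI subsetIl normG.
  have : (#|'N_H('C_H[x])| <= 2 * #|'C_H[x]|)%N by case: hyp => _ _ _ _; apply.
  have := cardG_gt0 'C_H[x]; have := cardG_gt0 'N_H('C_H[x]).
  move=> n0 c0 l /dvdnP[k E]; rewrite E in l n0 *.
  have : (k <= 2)%N by move: l; rewrite leq_pmul2r.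
  by case: k {E l} n0 => [|[|[|]]] //= _ _; [left; rewrite mul1n | right].
- by lia.
- suff: (#|Z| < #|'C_H[x]|)%N by rewrite oZ; move: d2C; move: #|_| => m; lia.
  apply: proper_card; rewrite properE sZC; apply/subsetPn; exists x.
    exact: mem_cent1.
  by case/setDP: Hx.
Qed.

Let W := [set 'C_H[x] | x in H :\: Z].
Let O := [set C :^: H | C : {set gT} in W].

(** The sets C \ Z partition H \ Z, where C runs over the centralizers of elements outside Z: two of
    them that share an element outside Z coincide. The sum is then grouped by conjugacy classes. *)
Lemma cent1_class_equation :
  (\sum_(B in O) \sum_(C in B) (#|C| - 2) = #|H| - 2)%N.
Proof.
have oD : #|H :\: Z| = (#|H| - 2)%N by rewrite cardsD (setIidPr sZH) oZ.
rewrite -oD -sum1_card (partition_big (fun x => 'C_H[x]) (mem W)) /=; last first.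
  by move=> x Hx; apply: imset_f.
transitivity (\sum_(C in W) (#|C| - 2))%N.
  rewrite (partition_big (fun C => C :^: H) (mem O)) /=; last first.
    by move=> C WC; apply: imset_f.
  apply: eq_bigr => B /imsetP[D WD ->]; apply: eq_bigl => C.
  apply/idP/andP=> [/imsetP[h Hh ->]|[WC /eqP E]].
    case/imsetP: WD => x Hx ->; split.
      by rewrite cent1_conj //; apply/imsetP; exists (x ^ h); rewrite ?setD_conj.
    apply/eqP; apply/setP=> A; apply/imsetP/imsetP=> [[k Hk ->]|[k Hk ->]].
      by exists (h * k); rewrite ?groupM // conjsgM cent1_conj.
    by exists (h^-1 * k); rewrite ?groupM ?groupV // conjsgM conjsgK.
  by rewrite -E; apply/imsetP; exists 1; rewrite ?conjsg1 ?group1.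
apply: eq_bigr => C /imsetP[x Hx ->].
have sZC : Z \subset 'C_H[x] by apply: center_sub_cent1; case/setDP: Hx.
have <- : #|'C_H[x] :\: Z| = (#|'C_H[x]| - 2)%N by rewrite cardsD (setIidPr sZC) oZ.
rewrite -sum1_card; apply: eq_bigl => y.
apply/idP/andP=> [Cy | [Hy /eqP E]].
  by rewrite (cent1_eq Hx Cy) eqxx; case/setDP: Cy => /setIP[Hy _] nZ; rewrite inE nZ Hy.
by rewrite inE -E mem_cent1 // andbT; case/setDP: Hy.
Qed.

Lemma cent1_class_weight x : x \in H :\: Z ->
  (\sum_(C in 'C_H[x] :^: H) (#|C| - 2)
    = #|'C_H[x] :^: H| * (#|'C_H[x]| - 2))%N.
Proof.
move=> Hx; rewrite -sum_nat_const; apply: eq_bigr => C /imsetP[h _ ->].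
by rewrite cardJg.
Qed.

Lemma almost_abelian_cent1 x :
  x \in H :\: Z -> (#|H| <= 2 * #|'C_H[x]|)%N -> almost_abelian H.
Proof. by move=> Hx l; exists 'C_H[x]%G; rewrite subsetIl abC. Qed.

(** The orders in [s] are distinct, so a centralizer is determined up to conjugacy by its order. *)
Lemma centralizer_typeI (r : seq gT) (s : seq (nat * nat)) :
  {in r, forall x, x \in H :\: Z} ->
  enum O = [seq 'C_H[x] :^: H | x <- r] ->
  perm_eq [seq (#|'C_H[x]|, #|'N_H('C_H[x])|) | x <- r] s ->
  uniq (map fst s) -> centralizer_type Z H s.
Proof.
move=> rH eO ps us.
have ur : uniq [seq #|'C_H[x]| | x <- r].
  by move: us; rewrite -(perm_uniq (perm_map fst ps)) -map_comp.
have cl x : x \in H :\: Z -> exists2 y, y \in r & exists2 h, h \in H & 'C_H[x] = 'C_H[y] :^ h.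
  move=> Hx; have : 'C_H[x] :^: H \in enum O.
    by rewrite mem_enum; apply/imsetP; exists 'C_H[x] => //; apply/imsetP; exists x.
 
  rewrite eO => /mapP[y ry E]; exists y => //.
  have : 'C_H[x] \in 'C_H[y] :^: H by rewrite -E; apply/imsetP; exists 1; rewrite ?conjsg1 ?group1.
  by case/imsetP=> h Hh ->; exists h.
split=> [x Hx | x y Hx Hy E | m N].
- have [y ry [h Hh E]] := cl _ Hx; rewrite -(perm_mem ps); apply/mapP; exists y => //.
  by rewrite E normJ -{2}(conjGid Hh) -conjIg !cardJg.
- have [x1 r1 [h1 Hh1 E1]] := cl _ Hx; have [x2 r2 [h2 Hh2 E2]] := cl _ Hy.
  have E12 : x1 = x2.
    have := nth_uniq 0%N _ _ ur; rewrite size_map => nu.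
    have i1 : (index x1 r < size r)%N by rewrite index_mem.
    have i2 : (index x2 r < size r)%N by rewrite index_mem.
    have := nu _ _ i1 i2; rewrite !(nth_map 1) // !nth_index //.
    rewrite E1 E2 !cardJg in E.
    rewrite (E : #|'C_H[x1]| = #|'C_H[x2]|) eqxx => /esym/eqP e.
    by rewrite -(nth_index 1 r1) e nth_index.
  exists (h1^-1 * h2); first by rewrite groupM ?groupV.
  by rewrite E1 E2 -E12 -conjsgM mulKVg.
- by rewrite -(perm_mem ps) => /mapP[x rx [-> ->]]; exists x; rewrite rH.
Qed.

Lemma class_representatives : exists2 r : seq gT,
  {in r, forall x, x \in H :\: Z} & enum O = [seq 'C_H[x] :^: H | x <- r].
Proof.
have: {subset enum O <= O} by move=> B; rewrite mem_enum.
elim: (enum O) => [|B s IH] sO; first by exists [::].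
have [r r1 r2] := IH (fun C sC => sO C (mem_behead (s := B :: s) sC)).
have /imsetP[C /imsetP[x Hx ->] EB] := sO B (mem_head _ _).
exists (x :: r); last by rewrite /= EB r2.
by move=> y; rewrite inE => /predU1P[-> | /r1].
Qed.

(* Two non-conjugate centralizers of order 6 would contain two
   non-conjugate Sylow 3-subgroups. *)
Lemma no_two_classes_of_order6 x y : #|H| = 24 -> x \in H :\: Z -> y \in H :\: Z ->
  #|'C_H[x]| = 6 -> #|'C_H[y]| = 6 -> 'C_H[x] :^: H = 'C_H[y] :^: H.
Proof.
move=> oH Hx Hy ox oy.
have syl u : u \in H :\: Z -> #|'C_H[u]| = 6 -> exists P : {group gT},
    3.-Sylow(H) P /\ 'C_H[u] = 'C_H(P).
  move=> Hu ou; have [v Cv ov] : {v | v \in 'C_H[u] & #[v] = 3}.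
    by apply: Cauchy; rewrite ?ou.
  have Hv : v \in H by case/setIP: Cv.
  exists <[v]>%G; split.
    by rewrite pHallE /= cycle_subG Hv -orderE ov oH p_part.
  rewrite cent_cycle (cent1_eq Hu) // inE Cv andbT.
  by apply/negP=> /order_dvdG; rewrite ov oZ.
have [P [sP EP]] := syl _ Hx ox; have [Q [sQ EQ]] := syl _ Hy oy.
have [h Hh E] := Sylow_trans sP sQ.
have -> : 'C_H[y] = 'C_H[x] :^ h by rewrite EQ EP E centJ -{1}(conjGid Hh) -conjIg.
apply/setP=> A; apply/imsetP/imsetP=> [[k Hk ->]|[k Hk ->]].
  by exists (h^-1 * k); rewrite ?groupM ?groupV // -conjsgM mulKVg.
by exists (h * k); rewrite ?groupM // conjsgM.
Qed.

Theorem dickson :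
  almost_abelian H \/
  [\/ tetrahedral Z H, octahedral Z H | icosahedral Z H].
Proof.
have [r rH eO] := class_representatives.
have n0 := cardG_gt0 H.
have S : (\sum_(x <- r) #|'C_H[x] :^: H| * (#|'C_H[x]| - 2) = #|H| - 2)%N.
  rewrite -cent1_class_equation -big_enum eO big_map.
  by rewrite !big_seq; apply: eq_bigr => x /rH/cent1_class_weight.
have ur : uniq [seq 'C_H[x] :^: H | x <- r] by rewrite -eO enum_uniq.
have D x : x \in r -> class_datum #|H| #|'C_H[x]| #|'N_H('C_H[x])| #|'C_H[x] :^: H|.
  by move/rH/class_datum_cent1.
have r3 : (size r <= 3)%N.
  have l : (size r * #|H| <= 4 * (#|H| - 2))%N.
    rewrite -S big_distrr /= -sum1_size big_distrl /= !big_seq.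
    by apply: leq_sum => x /D d; rewrite mul1n; apply: class_datum_weight d n0.
  by nia.
have oZH : (2 <= #|H|)%N by rewrite -oZ subset_leq_card.
move: (S) (D) (rH) (eO); case: r ur r3 {S D rH eO} => [|x1 [|x2 [|x3 []]]] // ur _.
- rewrite big_nil => S _ _ _; left; exists Z; rewrite sZH oZ; split=> //; last by lia.
  by apply: subset_trans cHZ.
- rewrite big_cons big_nil addn0 => S D rH _; left.
  by apply: (almost_abelian_cent1 (rH x1 (mem_head _ _))); apply: one_class (D _ (mem_head _ _)) n0 S.
- rewrite !big_cons big_nil addn0 => S D rH eO.
  have m1 : x1 \in [:: x1; x2] by rewrite !inE eqxx.
  have m2 : x2 \in [:: x1; x2] by rewrite !inE eqxx orbT.
  case: (two_classes (D _ m1) (D _ m2) n0 S) => [l|l|[E p]].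
  + by left; apply: almost_abelian_cent1 l; apply: rH.
  + by left; apply: almost_abelian_cent1 l; apply: rH.
  + by right; apply: Or31; split=> //; apply: centralizer_typeI rH eO p _.
- rewrite !big_cons big_nil addn0 addnA => S D rH eO.
  have m1 : x1 \in [:: x1; x2; x3] by rewrite !inE eqxx.
  have m2 : x2 \in [:: x1; x2; x3] by rewrite !inE eqxx orbT.
  have m3 : x3 \in [:: x1; x2; x3] by rewrite !inE eqxx !orbT.
  case: (three_classes (D _ m1) (D _ m2) (D _ m3) n0 S) => [[l|l|l]|[[E p]|[E p]|[E p]]];
    try by left; apply: almost_abelian_cent1 l; apply: rH.
  (* The solution (4, 8), (6, 12), (6, 12) of order 24 is purely numerical: [t] collects the
     representatives of its two classes of order 6. *)
  + exfalso; have := perm_map fst p; rewrite /= => p6.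
    pose t := [seq x <- [:: x1; x2; x3] | #|'C_H[x]| == 6].
    have ot : size t = 2.
      rewrite size_filter -(count_map (fun x => #|'C_H[x]|) (pred1 6)) /=.
      by have /seq.permP/(_ (pred1 6)) := p6.
    have ut : uniq [seq 'C_H[x] :^: H | x <- t].
      exact: subseq_uniq (map_subseq _ (filter_subseq _ _)) ur.
    have tH x : x \in t -> x \in H :\: Z /\ #|'C_H[x]| = 6.
      by rewrite mem_filter => /andP[/eqP -> /rH].
    case: t ot ut tH => [|a [|b []]] // _ /= /andP[nab _] tH.
    have [Ha oa] := tH _ (mem_head _ _).
    have [Hb ob] : _ /\ _ := tH b ltac:(by rewrite !inE eqxx orbT).
    by rewrite inE (no_two_classes_of_order6 E Ha Hb oa ob) eqxx in nab.
  + by right; apply: Or32; split=> //; apply: centralizer_typeI rH eO p _.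
  + by right; apply: Or33; split=> //; apply: centralizer_typeI rH eO p _.
Qed.

End Dickson.

(** * The quotients of the three exceptional types *)

Lemma index2_mulg (gT : finGroupType) (G A : {group gT}) x y :
  A \subset G -> #|G : A| = 2 -> x \in G -> y \in G -> x \notin A -> y \notin A ->
  x * y \in A.
Proof.
move=> sAG iA Gx Gy nAx nAy.
have nAG : G \subset 'N(A) by apply: normal_norm; apply: index2_normal.
have oGA : #|G / A| = 2 by rewrite card_quotient.
have [Nx Ny] := (subsetP nAG _ Gx, subsetP nAG _ Gy).
have c1 u : u \in 'N(A) -> u \notin A -> coset A u != 1.
  by move=> Nu; apply: contra => /eqP/coset_idr; apply.
suff e : coset A x = (coset A y)^-1.
  by apply: coset_idr; [rewrite groupM | rewrite morphM //= e mulVg].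
apply/eqP; apply/negPn/negP=> ne.
have : [set 1; coset A x; (coset A y)^-1] \subset G / A.
  apply/subsetP=> u; rewrite !inE => /orP[/orP[]|] /eqP->.
  - exact: group1.
  - exact: mem_quotient.
  - by rewrite groupV mem_quotient.
move/subset_leq_card; rewrite oGA -setUA cardsU1 cards2 ne !inE.
by rewrite ![1 == _]eq_sym invg_eq1 (negPf (c1 _ Nx nAx)) (negPf (c1 _ Ny nAy)).
Qed.

(* A normal subgroup contains all transpositions or none. *)
Lemma half_Sym (T : finType) (A : {group {perm T}}) :
  (#|A| * 2 = #|T|`!)%N -> A :=: 'Alt_T.
Proof.
move=> oA; pose S : {group {perm T}} := 'Sym_T%G.
have sAS : A \subset S by apply/subsetP=> s _; rewrite inE.
have oS : #|S| = (#|T|`!)%N by rewrite card_Sym.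
have iA : #|S : A| = 2.
  by have := Lagrange sAS; rewrite oS -oA => /eqP; rewrite eqn_pmul2l // => /eqP.
have nAS : A <| S by apply: index2_normal.
have inS s : s \in S by rewrite inE.
have [/existsP[[x y] /= /andP[nxy Axy]]|] :=
    boolP [exists u : T * T, (u.1 != u.2) && (tperm u.1 u.2 \in A)].
  have tA u v : u != v -> tperm u v \in A.
    move=> nuv; have [w <- <-] : exists2 w : {perm T}, w x = u & w y = v.
      exists (tperm x u * tperm (tperm x u y) v); rewrite !permM ?tpermL //.
        rewrite tpermD //; last by rewrite eq_sym.
        by rewrite -{2}(tpermL x u) (inj_eq perm_inj) eq_sym.
    by rewrite -tpermJ memJ_norm // (subsetP (normal_norm nAS)).
  have : S \subset A.
    apply/subsetP=> s _; have [ts -> /allP dts] := prod_tpermP s.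
    rewrite big_seq; apply: (big_ind (fun u => u \in A)) => [|u v|t tts].
    - exact: group1.
    - exact: groupM.
    - by apply: tA; have := dts t tts.
  by move/subset_leq_card; rewrite oS -oA; have := cardG_gt0 A; lia.
(* Without transpositions in A, a product of transpositions lies in A exactly when it has an even
   number of factors, because A has index 2. *)
rewrite negb_exists => /forallP notA.
apply/setP=> s; rewrite Alt_even.
have [ts -> dts] := prod_tpermP s.
elim: ts dts => [|[u v] ts IH] /=; first by rewrite !big_nil group1 odd_perm1.
case/andP=> nuv /IH{}IH; rewrite big_cons odd_permM odd_tperm nuv /= ?addTb ?negbK.
have tA : tperm u v \notin A by have := notA (u, v); rewrite nuv.
case: odd_perm IH => IH; first by rewrite (index2_mulg sAS iA) ?IH.
by apply/negP=> AA; move: tA; rewrite -(groupMr _ IH) AA.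
Qed.

(** * Permutation representations by conjugation on a set of subsets *)

Section ConjugationAction.

Variables (gT : finGroupType) (H : {group gT}) (Om : {set {set gT}}).
Hypothesis actOm : forall (X : {set gT}) h, X \in Om -> h \in H -> X :^ h \in Om.

Lemma conj_perm_rep : exists f : {morphism H >-> {perm 'I_#|Om|}},
  forall h, h \in H -> (f h = 1 <-> forall X : {set gT}, X \in Om -> X :^ h = X).
Proof.
pose P h (s : {perm 'I_#|Om|}) := [forall i, enum_val (s i) == enum_val i :^ h].
(* The default 1 only serves outside H; for h in H the permutation exists because [Om] is stable. *)
pose f h := odflt 1 [pick s | P h s].
have fP h : h \in H -> forall i, enum_val (f h i) = enum_val i :^ h.
  move=> Hh; rewrite /f; case: pickP => [s /forallP sP i | no]; first exact/eqP.
  have X (i : 'I_#|Om|) : enum_val i :^ h \in Om by apply: actOm (enum_valP i) Hh.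
  have g_inj : injective (fun i => enum_rank_in (X i) (enum_val i :^ h)).
    move=> i j /(congr1 enum_val); rewrite !enum_rankK_in //.
    by move/(can_inj (conjsgK h))/enum_val_inj.
  have := no (perm g_inj); rewrite /P => /negP[].
  by apply/forallP=> i; rewrite permE enum_rankK_in.
have fM : {in H &, {morph f : g h / g * h}}.
  move=> g h Hg Hh; apply/permP=> i; apply: enum_val_inj.
  by rewrite permM !fP ?groupM // conjsgM.
exists (Morphism fM) => h Hh /=; split=> [f1 X XO | id].
  by rewrite -[X](enum_rankK_in XO XO) -fP // f1 perm1.
by apply/permP=> i; rewrite perm1; apply: enum_val_inj; rewrite fP // id // enum_valP.
Qed.

Variable Z : {group gT}.
Hypothesis kerZ : forall h, h \in H ->
  (h \in Z <-> forall X : {set gT}, X \in Om -> X :^ h = X).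
Hypothesis sZH : Z \subset H.

Lemma conj_perm_isog n : #|Om| = n -> exists2 A : {group {perm 'I_n}},
  (H / Z) \isog A & (#|A| * #|Z| = #|H|)%N.
Proof.
move=> <-; have [f fP] := conj_perm_rep.
have kf : 'ker f = Z.
  apply/setP=> h; apply/idP/idP => [kh | Zh].
    by have Hh := dom_ker kh; apply/kerZ => //; apply/fP => //; apply: mker.
  have Hh := subsetP sZH _ Zh.
  by apply/kerP => //; apply/fP => //; apply/kerZ.
exists (f @* H)%G; first by rewrite -kf; apply: first_isog.
by rewrite card_morphim setIid kf mulnC Lagrange.
Qed.

Lemma isog_Sym_conj n : #|Om| = n -> (#|H| = n`! * #|Z|)%N ->
  (H / Z) \isog 'Sym_('I_n).
Proof.
move=> oOm oH; have [A iA oA] := conj_perm_isog oOm.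
apply: isog_trans iA _; suff -> : A :=: 'Sym_('I_n) by apply: isog_refl.
apply/eqP; rewrite eqEcard card_Sym card_ord; apply/andP; split.
  by apply/subsetP=> s _; rewrite inE.
by rewrite -(leq_pmul2r (cardG_gt0 Z)) oA oH.
Qed.

Lemma isog_Alt_conj n : #|Om| = n -> (2 * #|H| = n`! * #|Z|)%N ->
  (H / Z) \isog 'Alt_('I_n).
Proof.
move=> oOm oH; have [A iA oA] := conj_perm_isog oOm.
apply: isog_trans iA _; suff -> : A :=: 'Alt_('I_n) by apply: isog_refl.
apply: half_Sym; rewrite card_ord; apply/eqP.
by rewrite -(eqn_pmul2r (cardG_gt0 Z)) -oH -oA -mulnA [(2 * #|Z|)%N]mulnC mulnA mulnC.
Qed.

End ConjugationAction.

Lemma class_conj_closed (gT : finGroupType) (H : {group gT}) (C X : {set gT}) h :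
  X \in C :^: H -> h \in H -> X :^ h \in C :^: H.
Proof. by case/imsetP=> g Hg -> Hh; rewrite -conjsgM imset_f ?groupM. Qed.

(** The normalizer acts on a pair x, y of noncommuting elements, which generates Q. There are at
    most 6 images of x, all outside the center, and for fixed x at most 4 of y, all outside the
    centralizer of x in Q. *)
Lemma card_normalizer_order8 (gT : finGroupType) (A Q : {group gT}) :
  #|Q| = 8 -> ~~ abelian Q -> (#|'N_A(Q)| <= 24 * #|'C_A(Q)|)%N.
Proof.
move=> oQ nab; set N := 'N_A(Q)%G.
have pQ : 2.-group Q by rewrite /pgroup oQ.
have Q1 : Q :!=: 1 by rewrite -cardG_gt1 oQ.
have dvd8 (B : {group gT}) : B \subset Q -> (#|B| %| 8)%N by move/cardSg; rewrite oQ.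
have z2 : (2 <= #|'Z(Q)|)%N.
  by rewrite cardG_gt1; apply: contra Q1 => /eqP/(trivg_center_pgroup pQ)->.
move: nab; rewrite /abelian => /subsetPn[x Qx nx].
have [y Qy ny] : exists2 y, y \in Q & y \notin 'C[x].
  by apply/subsetPn; rewrite sub_cent1.
have nZx : x \notin 'Z(Q) by rewrite inE Qx.
have c4 : (4 <= #|'C_Q[x]|)%N.
  have : (#|'Z(Q)| < #|'C_Q[x]|)%N.
    apply: proper_card; rewrite properE setIS /=; last first.
      by rewrite -cent_set1 centS // sub1set.
    by apply/subsetPn; exists x => //; rewrite inE Qx cent1id.
  have := dvd8 'C_Q[x]%G (subsetIl _ _); move: z2.
  move: #|_| => a; move: #|_| => b a2; have := @dvdn_leq b 8 isT.
  by case: b => [|[|[|[|b]]]] //; move=> _ _; lia.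
(* A proper subgroup has order at most 4 and would be abelian. *)
have WQ : <<[set x; y]>> = Q.
  apply/eqP; rewrite eqEcard gen_subG subUset !sub1set Qx Qy /= oQ leqNgt.
  have sWQ : <<[set x; y]>> \subset Q by rewrite gen_subG subUset !sub1set Qx.
  apply/negP=> l8; case/negP: ny.
  have abW : abelian <<[set x; y]>>.
    have pW := pgroupS sWQ pQ; apply: (p2group_abelian pW).
    have [k ok] := p_natP pW; rewrite ok pfactorK // -ltnS.
    by rewrite -(ltn_exp2l _ _ (_ : 1 < 2)%N) // -ok.
  by apply/cent1P; apply: (centsP abW); rewrite mem_gen // !inE eqxx ?orbT.
have oN : (#|N| = #|x ^: N| * #|y ^: 'C_N[x]| * #|'C_A(Q)|)%N.
  have -> : 'C_A(Q) = 'C_('C_N[x])[y].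
    have CQ : 'C(Q) = 'C[x] :&: 'C[y] by rewrite -WQ cent_gen centU !cent_set1.
    by rewrite -[in RHS]setIA -CQ -setIA (setIidPr (cent_sub Q)).
  rewrite -!index_cent1 -mulnA [X in (_ * X)%N]mulnC Lagrange ?subsetIl //.
  by rewrite mulnC Lagrange ?subsetIl.
rewrite oN leq_mul2r; apply/orP; right.
apply: (@leq_mul _ _ 6 4).
  apply: (@leq_trans #|Q :\: 'Z(Q)|).
    apply/subset_leq_card/subsetP=> _ /imsetP[g Ng ->].
    have NQg : g \in 'N(Q) by case/setIP: Ng.
    rewrite in_setD (memJ_norm _ NQg) Qx andbT.
    by rewrite -['Z(Q)](normsP (char_norms (center_char Q)) g NQg) memJ_conjg.
  by rewrite cardsD oQ (setIidPr (center_sub Q)); apply: (leq_sub2l 8 z2).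
apply: (@leq_trans #|Q :\: 'C_Q[x]|).
  apply/subset_leq_card/subsetP=> _ /imsetP[g /setIP[Ng cxg] ->].
  have NQg : g \in 'N(Q) by case/setIP: Ng.
  rewrite in_setD (memJ_norm _ NQg) Qy andbT in_setI (memJ_norm _ NQg) Qy /=.
  have -> : x = x ^ g by apply/esym/conjg_fixP/commgP; apply: cent1P; rewrite cent1C.
  by rewrite cent1J memJ_conjg.
by rewrite cardsD oQ (setIidPr (subsetIl _ _)); apply: (leq_sub2l 8 c4).
Qed.

(** * Structure of tetrahedral, octahedral and icosahedral groups *)

Section DicksonTypes.

Variables (gT : finGroupType) (H Z : {group gT}).
Hypothesis hyp : dickson_hyp Z H.

Let sZH : Z \subset H. Proof. by case: hyp. Qed.
Let cHZ : H \subset 'C(Z). Proof. by case: hyp. Qed.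
Let oZ : #|Z| = 2. Proof. by case: hyp. Qed.

Lemma norm_cent1_bound x : x \in H :\: Z -> (#|'N_H('C_H[x])| <= 2 * #|'C_H[x]|)%N.
Proof. by case: hyp => _ _ _ _; apply. Qed.

Lemma abelian_cent1 x : x \in H :\: Z -> abelian 'C_H[x].
Proof. by case: hyp => _ _ _ h _; apply: h. Qed.

Lemma notin_center_order x : #[x] != 1%N -> #[x] != 2 -> x \notin Z.
Proof.
move=> n1 n2; apply/negP=> /order_dvdG; rewrite oZ.
by case: #[x] n1 n2 => [|[|[|k]]] // _ _ /dvdn_leq => /(_ isT).
Qed.

(* The normalizer has index at most 2 over the centralizer. *)
Lemma odd_order_norm_cent1 x u : x \in H :\: Z -> u \in 'N_H('C_H[x]) ->
  odd #[u] -> u \in 'C_H[x].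
Proof.
move=> Hx Nu ou; set C := 'C_H[x]%G; set N := 'N_H(C)%G.
have sCN : C \subset N by rewrite subsetI subsetIl normG.
have iCN : (#|N : C| <= 2)%N.
  by rewrite -(leq_pmul2l (cardG_gt0 C)) Lagrange // mulnC norm_cent1_bound.
have nC : N \subset 'N(C) by apply: subsetIr.
have Cu := subsetP nC _ Nu.
apply: coset_idr => //; apply/eqP; rewrite -order_eq1.
have d1 : #[coset C u] %| #[u] by apply: morph_order.
have d2 : #[coset C u] %| #|N : C|.
  by rewrite -card_quotient // order_dvdG // mem_quotient.
have : (#[coset C u] <= 2)%N by apply: leq_trans (dvdn_leq _ d2) iCN.
have := order_gt0 (coset C u); case: #[_] d1 {d2} => [|[|[|]]] // d1 _ _.
by move/dvdn_odd: d1 => /(_ ou).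
Qed.

Lemma cent1_class_trivI x y u : x \in H :\: Z -> y \in H :\: Z ->
  u \in 'C_H[x] -> u \in 'C_H[y] -> u \notin Z -> 'C_H[x] = 'C_H[y].
Proof.
move=> Hx Hy xu yu nu.
by rewrite -(cent1_eq hyp Hx (y := u)) ?(cent1_eq hyp Hy (y := u)) // inE nu.
Qed.

(* An element of K outside Z produces elements of order 3 in K, one in each
   member of the class, which then normalize and so centralize each other. *)
Lemma cent1_order6_kernel x (K : {group gT}) : x \in H :\: Z ->
  #|'C_H[x]| = 6 -> (1 < #|'C_H[x] :^: H|)%N -> K <| H ->
  (forall X, X \in 'C_H[x] :^: H -> K \subset 'N(X)) -> K \subset Z.
Proof.
move=> Hx o6 cl nKH KN; have [sKH nKH'] := andP nKH.
have memcl g : g \in H -> 'C_H[x ^ g] \in 'C_H[x] :^: H.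
  by move=> Hg; rewrite -cent1_conj // imset_f.
apply/subsetPn=> -[h Kh nZh]; have Hh := subsetP sKH _ Kh.
have Hh' : h \in H :\: Z by rewrite inE nZh.
have [g Hg nhg] : exists2 g, g \in H & h \notin 'C_H[x ^ g].
  have /subsetPn[X clX nX] : ~~ ('C_H[x] :^: H \subset [set 'C_H[h]]).
    by apply: contraL cl => /subset_leq_card; rewrite cards1 -leqNgt.
  case/imsetP: clX nX => g Hg ->; rewrite inE cent1_conj // => nX; exists g => //.
  apply: contra nX => hC; apply/eqP/esym.
  by rewrite (cent1_eq hyp (x := x ^ g)) ?(setD_conj hyp) // inE nZh.
set C := 'C_H[x ^ g] in nhg *.
have Hxg : x ^ g \in H :\: Z by apply: setD_conj.
have oC : #|C| = 6 by rewrite /C -cent1_conj // cardJg.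
have [u Cu ou] : {u | u \in C & #[u] = 3} by apply: Cauchy; rewrite ?oC.
have Hu : u \in H by case/setIP: Cu.
have nZu : u \notin Z by apply: notin_center_order; rewrite ou.
have Cuh : u ^ h \in C by rewrite memJ_norm // (subsetP (KN _ (memcl _ Hg))).
(* The commutator of u and h lies in C because h normalizes C, and in K because K is normal. *)
pose c := u^-1 * u ^ h.
have Cc : c \in C by rewrite groupM ?groupV.
have Kc : c \in K.
  have -> : c = (h^-1) ^ u * h by rewrite /c !conjgE !mulgA.
  by rewrite groupM // memJ_norm ?groupV // (subsetP nKH').
have c1 : c != 1.
  apply: contra nhg; rewrite -eq_mulVg1 eq_sym => /eqP/conjg_fixP/commgP cuh.
  rewrite /C -(cent1_eq hyp Hxg (y := u)); last by rewrite in_setD nZu.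
  rewrite in_setI Hh.
  by apply/cent1P.
have c3 : c ^+ 3 = 1.
  have cc : commute u^-1 (u ^ h).
    by apply: (centsP (abelian_cent1 Hxg)); rewrite ?groupV.
  by rewrite expgMn // expgVn -conjXg -ou expg_order invg1 conj1g mulg1.
have oc : #[c] = 3.
  have := order_dvdn c 3; rewrite c3 eqxx => /dvdn_leq.
  have : #[c] != 1%N by rewrite order_eq1.
  have := order_dvdn c 3; rewrite c3 eqxx.
  by case: #[c] (order_gt0 c) => [|[|[|[|k]]]] // _ _ _ /(_ isT).
have nZc : c \notin Z by apply: notin_center_order; rewrite oc.
have [k Hk nk] : exists2 k, k \in H & C :^ k != C.
  have /subsetPn[X clX nX] : ~~ ('C_H[x] :^: H \subset [set C]).
    by apply: contraL cl => /subset_leq_card; rewrite cards1 -leqNgt.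
  case/imsetP: clX nX => k Hk ->; rewrite inE => nX; exists (g^-1 * k).
    by rewrite groupM ?groupV.
  have EC : C = 'C_H[x] :^ g by rewrite cent1_conj.
  by rewrite {1}EC -conjsgM mulKVg.
(* The element [c ^ k] of order 3 lies in K, so it normalizes C and hence lies in C. It also lies in
   the different centralizer [C :^ k], although two centralizers meet in Z only. *)
have Kck : c ^ k \in K by rewrite memJ_norm // (subsetP nKH').
have Cck : c ^ k \in C.
  apply: odd_order_norm_cent1; rewrite ?orderJ ?oc // inE (subsetP sKH) //.
  by rewrite (subsetP (KN _ (memcl _ Hg))).
case/eqP: nk; rewrite [in LHS]/C cent1_conj //.
apply: (cent1_class_trivI (u := c ^ k)) => //.
- by rewrite setD_conj.
- by rewrite -cent1_conj // memJ_conjg.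
- by apply: notin_center_order; rewrite orderJ oc.
Qed.

Lemma center_fix_cent1_class x h (X : {set gT}) : x \in H -> h \in Z ->
  X \in 'C_H[x] :^: H -> X :^ h = X.
Proof.
move=> Hx Zh /imsetP[g Hg ->]; have Hh := subsetP sZH _ Zh.
rewrite !cent1_conj //; suff -> : (x ^ g) ^ h = x ^ g by [].
apply/conjg_fixP/commgP/esym.
by apply/esym; apply: (centP (subsetP cHZ _ _) _ Zh); rewrite groupJ.
Qed.

(** An element that fixes every member of the class lies in the core of ['N_H('C_H[x])], a normal
    subgroup to which the premise on K applies. *)
Lemma cent1_class_kerP x h : x \in H :\: Z -> h \in H ->
  (forall K : {group gT}, K <| H ->
    (forall X, X \in 'C_H[x] :^: H -> K \subset 'N(X)) -> K \subset Z) ->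
  (h \in Z <-> forall X : {set gT}, X \in 'C_H[x] :^: H -> X :^ h = X).
Proof.
move=> Hx Hh kerK; split=> [Zh X | hX]; first by apply: center_fix_cent1_class => //; case/setDP: Hx.
pose K := gcore 'N_H('C_H[x]) H.
have KH : K <| H.
  by rewrite /normal gcore_norm (subset_trans (gcore_sub _ _)) ?subsetIl.
apply: (subsetP (kerK _ KH _)) => [X /imsetP[g Hg ->]|].
  rewrite normJ /=; apply: subset_trans (bigcap_inf g Hg) _.
  by rewrite conjSg subsetIr.
apply/bigcapP=> g Hg; rewrite mem_conjg inE groupJ ?groupV //=.
apply/normP.
by rewrite conjgE invgK !conjsgM (hX _ (imset_f _ Hg)) -conjsgM mulgV conjsg1.
Qed.

Lemma card_class_cent1 x N : #|'N_H('C_H[x])| = N -> (#|'C_H[x] :^: H| * N = #|H|)%N.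
Proof. by move=> <-; rewrite card_conjugates mulnC Lagrange ?subsetIl. Qed.

(** H permutes the 24 / 6 = 4 centralizers of order 6 with kernel Z, so the image has order 12 in
    Sym_4. In the octahedral case there are 48 / 12 = 4 of them and the image has order 24. *)
Lemma tetrahedral_quotient : tetrahedral Z H -> (H / Z) \isog 'Alt_('I_4).
Proof.
case=> oH [_ _ /(_ 6 6)]; rewrite !inE eqxx orbT => /(_ isT)[x [Hx o6 oN]].
have o4 : #|'C_H[x] :^: H| = 4.
  by have := card_class_cent1 oN; rewrite oH; move: #|_| => k; lia.
apply: (isog_Alt_conj (@class_conj_closed _ H 'C_H[x]) _ sZH o4); last by rewrite oH oZ.
move=> h Hh; apply: cent1_class_kerP => // K; apply: cent1_order6_kernel => //.
by rewrite o4.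
Qed.

Lemma octahedral_quotient : octahedral Z H -> (H / Z) \isog 'Sym_('I_4).
Proof.
case=> oH [_ _ /(_ 6 12)]; rewrite !inE eqxx orbT => /(_ isT)[x [Hx o6 oN]].
have o4 : #|'C_H[x] :^: H| = 4.
  by have := card_class_cent1 oN; rewrite oH; move: #|_| => k; lia.
apply: (isog_Sym_conj (@class_conj_closed _ H 'C_H[x]) _ sZH o4); last by rewrite oH oZ.
move=> h Hh; apply: cent1_class_kerP => // K; apply: cent1_order6_kernel => //.
by rewrite o4.
Qed.

(* If Q were its own normalizer, it could not fuse two of its non-commuting
   elements of order 4. *)
Lemma order8_fusion (Q : {group gT}) s : centralizer_type Z H s ->
  (forall m N, (m, N) \in s -> 4 %| m -> m = 4 /\ N = 8) ->
  Q \subset H -> #|Q| = 8 -> ~~ abelian Q -> Z \subset Q ->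
  (8 < #|'N_H(Q)| <= 24)%N.
Proof.
move=> [tyH conjH _] s4 sQH oQ nab sZQ.
have cQ u : u \in Q -> u \notin Z -> [/\ #|'C_H[u]| = 4, 'C_H[u] \subset Q & 'N_H('C_H[u]) = Q].
  move=> Qu nZu; have Hu : u \in H :\: Z by rewrite inE nZu (subsetP sQH).
  have sCQH : 'C_Q[u] \subset 'C_H[u] by rewrite setSI.
  have c4 : 4 %| #|'C_Q[u]|.
    have : #|'C_Q[u]| %| 8 by rewrite -oQ cardSg ?subsetIl.
    have : (2 < #|'C_Q[u]|)%N.
      rewrite -oZ; apply: proper_card; rewrite properE; apply/andP; split.
        rewrite subsetI sZQ sub_cent1; apply: (subsetP cHZ); exact: (subsetP sQH).
      by apply/subsetPn; exists u => //; rewrite inE Qu cent1id.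
    move: #|_| => a; have := @dvdn_leq a 8 isT.
    by do 9?case: a => [|a] //=; move=> /[swap] /[swap] ? l /l; lia.
  have [oC oN] := s4 _ _ (tyH _ Hu) (dvdn_trans c4 (cardSg sCQH)).
  have eC : 'C_Q[u] = 'C_H[u].
    apply/eqP; rewrite eqEcard sCQH oC; apply: dvdn_leq c4; exact: cardG_gt0.
  have sCQ : 'C_H[u] \subset Q by rewrite -eC subsetIl.
  split=> //; apply/esym/eqP; rewrite eqEcard oQ oN leqnn andbT subsetI sQH /=.
  apply: normal_norm; apply: index2_normal => //.
  by rewrite -divgS // oQ oC.
move: nab; rewrite /abelian => /subsetPn[x Qx nx].
have [y Qy ny] : exists2 y, y \in Q & y \notin 'C[x].
  by apply/subsetPn; rewrite sub_cent1.
have Zc u : u \in Z -> forall v, v \in Q -> v \in 'C[u].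
  move=> Zu v Qv; apply/cent1P.
  by have e := centP (subsetP cHZ _ (subsetP sQH _ Qv)) _ Zu; rewrite /commute e.
have nZy : y \notin Z by apply: contra ny => Zy; rewrite cent1C Zc.
have nZx : x \notin Z by apply: contra ny => /Zc; apply.
have [ox sx Nx] := cQ _ Qx nZx; have [oy sy Ny] := cQ _ Qy nZy.
have Hx : x \in H :\: Z by rewrite inE nZx (subsetP sQH).
have Hy : y \in H :\: Z by rewrite inE nZy (subsetP sQH).
(* Q is the normalizer of both centralizers, so h normalizes Q. But h is not in Q, since Q
   normalizes the centralizer of x and cannot move it to that of y. *)
have [h Hh E] : exists2 h, h \in H & 'C_H[y] = 'C_H[x] :^ h.
  by apply: conjH; rewrite ?ox ?oy.
have Qh : Q :^ h = Q.
  by rewrite -[in LHS]Nx conjIg (conjGid Hh) -normJ -E Ny.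
have sQN : Q \subset 'N_H(Q) by rewrite subsetI sQH normG.
apply/andP; split.
  rewrite -oQ; apply: proper_card; rewrite properE sQN /=; apply/subsetPn.
  exists h; first by rewrite inE Hh; apply/normP.
  apply/negP=> Qh'; have Nh : h \in 'N('C_H[x]).
    by move: Qh'; rewrite -Nx => /setIP[].
  case/negP: ny; have : y \in 'C_H[y] by rewrite inE cent1id (subsetP sQH).
  by rewrite E (normP Nh) => /setIP[].
(* At most 8 - 2 conjugates of x in Q, times a centralizer of order 4. *)
have : (#|'N_H(Q)| <= #|x ^: 'N_H(Q)| * #|'C_('N_H(Q))[x]|)%N.
  by rewrite -index_cent1 mulnC Lagrange ?subsetIl.
move/leq_trans; apply; apply: (@leq_mul _ _ 6 4).
  apply: (@leq_trans #|Q :\: Z|); last by rewrite cardsD (setIidPr sZQ) oQ oZ.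
  apply/subset_leq_card/subsetP=> _ /imsetP[g /setIP[Hg NQg] ->].
  rewrite in_setD (memJ_norm _ NQg) Qx andbT.
  by have /setDP[] := setD_conj hyp Hx Hg.
by rewrite -ox subset_leq_card // setSI ?subsetIl.
Qed.

(** The order of the normalizer of Q is a multiple of 8 strictly above 8 and at most 24, and 16
    divides neither 24 nor, in the icosahedral case, 120. *)
Lemma tetrahedral_normal (Q : {group gT}) : tetrahedral Z H ->
  Q \subset H -> #|Q| = 8 -> ~~ abelian Q -> Z \subset Q -> H \subset 'N(Q).
Proof.
move=> [oH ty] sQH oQ nab sZQ.
have /andP[l8 l24] : (8 < #|'N_H(Q)| <= 24)%N.
  apply: order8_fusion ty _ _ _ _ _ => // m N.
  by rewrite !inE => /orP[] /eqP[-> ->].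
suff e : 'N_H(Q) = H by rewrite -e subsetIr.
apply/eqP; rewrite eqEcard subsetIl oH /=.
have /dvdnP[k E] : 8 %| #|'N_H(Q)| by rewrite -oQ cardSg // subsetI sQH normG.
have := cardSg (subsetIl H 'N(Q)); rewrite oH /= E => d.
rewrite E in l8 l24; case: k E l8 l24 d => [|[|[|[|k]]]] //= _ l8 l24; lia.
Qed.

Lemma icosahedral_normalizer (Q : {group gT}) : icosahedral Z H ->
  Q \subset H -> #|Q| = 8 -> ~~ abelian Q -> Z \subset Q -> #|'N_H(Q)| = 24.
Proof.
move=> [oH ty] sQH oQ nab sZQ.
have /andP[l8 l24] : (8 < #|'N_H(Q)| <= 24)%N.
  apply: order8_fusion ty _ _ _ _ _ => // m N.
  by rewrite !inE => /or3P[] /eqP[-> ->].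
have /dvdnP[k E] : 8 %| #|'N_H(Q)| by rewrite -oQ cardSg // subsetI sQH normG.
have := cardSg (subsetIl H 'N(Q)); rewrite oH /= E => d.
rewrite E in l8 l24; case: k E l8 l24 d => [|[|[|[|k]]]] //= _ l8 l24; lia.
Qed.

(** H acts on the 120 / 24 = 5 conjugates of Q. If the kernel K had an element outside Z, it would
    contain the class of that element, with at least 120 / 10 = 12 members, and 1. Its order divides
    24, so K would be the normalizer of Q; then Q, a normal Sylow subgroup of K, would be
    characteristic in K and normal in H. *)
Lemma icosahedral_quotient (Q : {group gT}) : icosahedral Z H ->
  Q \subset H -> #|Q| = 8 -> ~~ abelian Q -> Z \subset Q ->
  (H / Z) \isog 'Alt_('I_5).
Proof.
move=> icoH sQH oQ nab sZQ.
have oN := icosahedral_normalizer icoH sQH oQ nab sZQ.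
have [oH ty] := icoH.
have o5 : #|Q :^: H| = 5 by rewrite card_conjugates -divgS ?subsetIl // oH oN.
apply: (isog_Alt_conj (@class_conj_closed _ H Q) _ sZH o5); last by rewrite oH oZ.
move=> h Hh; split=> [Zh X /imsetP[g Hg ->] | hX].
  apply/normP; rewrite normJ mem_conjg.
  have -> : h ^ g^-1 = h.
    by apply/conjg_fixP/commgP/esym; apply: (centP (subsetP cHZ _ _)); rewrite ?groupV.
  by rewrite (subsetP (normG Q)) // (subsetP sZQ).
pose K := gcore 'N_H(Q) H.
have sKN : K \subset 'N_H(Q) by apply: gcore_sub.
have sKH : K \subset H by apply: subset_trans sKN (subsetIl _ _).
have nKH : H \subset 'N(K) by apply: gcore_norm.
have Kh : h \in K.
  apply/bigcapP=> g Hg; rewrite mem_conjg inE groupJ ?groupV //=; apply/normP.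
  by rewrite conjgE invgK !conjsgM (hX _ (imset_f _ Hg)) -conjsgM mulgV conjsg1.
apply/negPn/negP=> nZh; have Hh' : h \in H :\: Z by rewrite inE nZh.
have oK : #|K| = 24.
  have d : #|K| %| 24 by rewrite -oN cardSg.
  have l : (12 < #|K|)%N.
    have : (#|h ^: H| < #|K|)%N.
      have -> : #|K| = #|K :\ 1|.+1 by rewrite (cardsD1 1 K) group1.
      rewrite ltnS subset_leq_card //; apply/subsetP=> _ /imsetP[g Hg ->].
      rewrite in_setD1 memJ_norm ?(subsetP nKH) // Kh andbT -[1](conj1g g).
      by rewrite (inj_eq (conjg_inj g)); apply: contra nZh => /eqP->.
    have [tyH _ _] := ty; apply: leq_ltn_trans.
    rewrite -index_cent1 -divgS ?subsetIl // oH.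
    by have := tyH _ Hh'; rewrite !inE => /or3P[] /eqP[/= -> _].
  move: d l; move: #|_| => a /dvdnP[[|[|k]] E] l //; first by rewrite mul1n in E.
  by have := leq_mul (isT : 2 <= k.+2)%N l; rewrite -E.
have eK : K = 'N_H(Q) by apply/eqP; rewrite eqEcard sKN oK oN.
have sQK : Q \subset K by rewrite eK subsetI sQH normG.
have sylQ : 2.-Sylow(K) Q by rewrite pHallE sQK oK oQ p_part.
have nQK : Q <| K by rewrite /normal sQK eK subsetIr.
have chQ : Q \char K by rewrite -(normal_Hall_pcore sylQ nQK) pcore_char.
have : 'N_H(Q) = H by apply/setIidPl; apply: char_norm_trans chQ nKH.
by move/(congr1 (fun A : {set gT} => #|A|)); rewrite oN oH.
Qed.

(** Q is the kernel of the action on the 48 / 16 = 3 centralizers of order 8, and its order is 8 or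
    16. It is not 16, as K would then contain two of these centralizers, which meet in Z and have a
    product of 32 elements. If K were abelian, it would be a centralizer of order 8, whose
    normalizer has order 16, although K is normal in H. *)
Lemma octahedral_normal_order8 : octahedral Z H ->
  exists Q : {group gT}, [/\ Q <| H, #|Q| = 8, ~~ abelian Q & Z \subset Q].
Proof.
case=> oH [tyH _ /(_ 8 16)]; rewrite !inE eqxx !orbT => /(_ isT)[x [Hx o8 oN]].
have o3 : #|'C_H[x] :^: H| = 3.
  by have := card_class_cent1 oN; rewrite oH; move: #|_| => k; lia.
have [f fP] := conj_perm_rep (@class_conj_closed _ H 'C_H[x]).
set K := 'ker f; have nK : K <| H by apply: ker_normal.
have [sKH nKH] := andP nK.
have KN g : g \in H -> K \subset 'N('C_H[x] :^ g).
  move=> Hg; apply/subsetP=> k Kk; apply/normP.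
  by have /fP[+ _] := subsetP sKH _ Kk; apply; [apply: mker | apply: imset_f].
have sKN : K \subset 'N_H('C_H[x]) by rewrite subsetI sKH -[X in 'N(X)]conjsg1 KN.
have oK : 8 %| #|K|.
  have : #|f @* H| %| 6.
    rewrite (_ : 6 = #|'Sym_('I_#|'C_H[x] :^: H|)|); last by rewrite card_Sym card_ord o3.
    by apply: cardSg; apply/subsetP=> s _; rewrite inE.
  rewrite card_morphim setIid -divgS ?subsetIl // oH => d.
  have /dvdnP[k E] := cardSg sKH; rewrite oH /= in E.
  move: d; rewrite E mulnK // => /dvdnP[l E6].
  have k0 : (0 < k)%N by case: k E E6 => [|k] // _; rewrite muln0.
  apply/dvdnP; exists l; apply/eqP.
  by rewrite -(eqn_pmul2l k0) -E mulnA [(k * l)%N]mulnC -E6.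
have d16 : #|K| %| 16 by rewrite -oN cardSg.
have sZK : Z \subset K.
  apply/subsetP=> h Zh; have Hh := subsetP sZH _ Zh.
  apply/kerP => //; apply/fP => // X; apply: center_fix_cent1_class => //.
  by case/setDP: Hx.
have ne : exists2 g, g \in H & 'C_H[x] :^ g != 'C_H[x].
  have /subsetPn[X clX nX] : ~~ ('C_H[x] :^: H \subset [set 'C_H[x]]).
    by apply/negP=> /subset_leq_card; rewrite cards1 o3.
  by case/imsetP: clX nX => g Hg ->; rewrite inE => nX; exists g.
have [g Hg ng] := ne; have ng' := ng; rewrite cent1_conj // in ng'.
have tI : 'C_H[x] :&: 'C_H[x ^ g] \subset Z.
  apply/subsetP=> u /setIP[u1 u2]; apply/negPn/negP=> nZu; case/eqP: ng'.
  by apply: cent1_class_trivI u2 u1 nZu; rewrite ?(setD_conj hyp).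
have oK8 : #|K| = 8.
  have : #|K| != 16.
    apply/negP=> /eqP oK16.
    have eK : K = 'N_H('C_H[x]) by apply/eqP; rewrite eqEcard sKN oK16 oN.
    have s1 : 'C_H[x] \subset K by rewrite eK subsetI subsetIl normG.
    have s2 : 'C_H[x ^ g] \subset K.
      by rewrite -cent1_conj // -(normsP nKH _ Hg) conjSg.
    have og : #|'C_H[x ^ g]| = 8 by rewrite -cent1_conj // cardJg.
    have := mul_cardG 'C_H[x] 'C_H[x ^ g]; rewrite /= o8 og.
    have l1 : (#|('C_H[x] * 'C_H[x ^ g])%g| <= 16)%N.
      by rewrite -oK16 subset_leq_card // mul_subG.
    have l2 : (#|'C_H[x] :&: 'C_H[x ^ g]| <= 2)%N by rewrite -oZ subset_leq_card.
    by have := leq_mul l1 l2 => l E; rewrite -E in l.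
  by move: oK d16; move: #|_| => a /dvdnP[k ->]; case: k => [|[|[|k]]] //; move=> /dvdn_leq/(_ isT); lia.
exists [group of K]; split=> //; apply/negP=> abK.
have [w Kw nZw] : exists2 w, w \in K & w \notin Z.
  by apply/subsetPn; apply/negP=> /subset_leq_card; rewrite oK8 oZ.
have Hw : w \in H :\: Z by rewrite inE nZw (subsetP sKH).
have sKC : K \subset 'C_H[w] by rewrite subsetI sKH sub_cent1 (subsetP abK).
have [oC oNw] : #|'C_H[w]| = 8 /\ #|'N_H('C_H[w])| = 16.
  have := cardSg sKC; rewrite /= oK8; have := tyH _ Hw.
  by rewrite !inE => /or3P[] /eqP[-> ->].
have eKC : K = 'C_H[w] by apply/eqP; rewrite eqEcard sKC oC oK8.
by move: oNw; rewrite -eKC (setIidPl nKH) oH.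
Qed.

End DicksonTypes.

(** * Two by two matrices *)

(** Derives an equation from a known one, combined or scaled beforehand, by leaving a polynomial
    identity to [ring] or [field]. *)
Lemma eq_of_sub (V : zmodType) (u v x y : V) :
  u = v -> (x - y = u - v)%R -> x = y.
Proof. by move=> ->; rewrite subrr => /eqP; rewrite subr_eq0 => /eqP. Qed.

Section SmallPowers.

Variable gT : finGroupType.
Implicit Type x : gT.

(** The bracketing displays even powers as squares, the form to which [involution_SL] applies. *)
Lemma expg4E x : x ^+ 4 = x * x * (x * x).
Proof. by rewrite !expgS expg0 mulg1 !mulgA. Qed.

Lemma expg5E x : x ^+ 5 = x * x * (x * (x * x)).
Proof. by rewrite !expgS expg0 mulg1 !mulgA. Qed.

Lemma expg6E x : x ^+ 6 = x * (x * x) * (x * (x * x)).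
Proof. by rewrite !expgS expg0 mulg1 !mulgA. Qed.

Lemma expg10E x : x ^+ 10 = (x * x * (x * (x * x))) * (x * x * (x * (x * x))).
Proof. by rewrite !expgS expg0 mulg1 !mulgA. Qed.

End SmallPowers.

(* Naming the group fixes the path along which its operations are inferred. *)
Definition GLT (F : finFieldType) : finGroupType := {'GL_2[F]}.

Section Matrices2.

Variable F : finFieldType.
Implicit Types (A B : GLT F) (a b c d : F).
Local Open Scope ring_scope.

Definition mx22 a b c d : 'M[F]_2 :=
  \matrix_(i, j) if i == 0 then (if j == 0 then a else b) else if j == 0 then c else d.

Lemma mx22E a b c d : (mx22 a b c d 0 0 = a) * (mx22 a b c d 0 1 = b)
  * (mx22 a b c d 1 0 = c) * (mx22 a b c d 1 1 = d).
Proof. by rewrite !mxE. Qed.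

Lemma mx2P (M N : 'M[F]_2) : M 0 0 = N 0 0 -> M 0 1 = N 0 1 ->
  M 1 0 = N 1 0 -> M 1 1 = N 1 1 -> M = N.
Proof.
move=> e00 e01 e10 e11; apply/matrixP.
have I (i : 'I_2) : i = 0 \/ i = 1.
  by case: i => [[|[|]]] // h; [left | right]; apply: val_inj.
by move=> i j; case: (I i) (I j) => -> [] ->.
Qed.

Lemma mulmx2E (M N : 'M[F]_2) i j : (M *m N) i j = M i 0 * N 0 j + M i 1 * N 1 j.
Proof. by rewrite mxE !big_ord_recl big_ord0 addr0; congr (_ * _ + _ * _); congr (_ _ _); apply: val_inj. Qed.

Lemma det_mx2 (M : 'M[F]_2) : \det M = M 0 0 * M 1 1 - M 0 1 * M 1 0.
Proof.
rewrite (expand_det_row _ 0) !big_ord_recl big_ord0 /cofactor !det_mx11 !mxE /=.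
have -> : lift (0 : 'I_2) 0 = 1 by apply: val_inj.
have -> : lift (1 : 'I_2) 0 = 0 by apply: val_inj.
by rewrite /= expr0 expr1 mul1r addr0 mulN1r mulrN.
Qed.

Lemma det_mx22 a b c d : \det (mx22 a b c d) = a * d - b * c.
Proof. by rewrite det_mx2 !mx22E. Qed.

Definition ent A (i j : 'I_2) : F := (GLval A : 'M[F]_2) i j.

Lemma entM A B i j : ent (A * B)%g i j = ent A i 0 * ent B 0 j + ent A i 1 * ent B 1 j.
Proof. by rewrite /ent GL_MxE mulmx2E. Qed.

Lemma glP A B : ent A 0 0 = ent B 0 0 -> ent A 0 1 = ent B 0 1 ->
  ent A 1 0 = ent B 1 0 -> ent A 1 1 = ent B 1 1 -> A = B.
Proof. by move=> *; apply: val_inj; apply: mx2P. Qed.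

Lemma ent1 : (ent 1%g 0 0 = 1) * (ent 1%g 0 1 = 0) * (ent 1%g 1 0 = 0) * (ent 1%g 1 1 = 1).
Proof. by rewrite /ent GL_1E !mxE. Qed.

Definition detg A : F := ent A 0 0 * ent A 1 1 - ent A 0 1 * ent A 1 0.
Definition trg A : F := ent A 0 0 + ent A 1 1.

Lemma detgE A : detg A = \det (GLval A).
Proof. by rewrite det_mx2. Qed.

Lemma detg_neq0 A : detg A != 0.
Proof. by rewrite detgE GL_det. Qed.

Lemma detgM A B : detg (A * B)%g = detg A * detg B.
Proof. rewrite /detg !entM; ring. Qed.

Lemma trgC A B : trg (A * B)%g = trg (B * A)%g.
Proof. rewrite /trg !entM; ring. Qed.

Lemma trgJ A B : trg (A ^ B)%g = trg A.
Proof. by rewrite conjgE trgC mulgK. Qed.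

Lemma detg1 : detg 1%g = 1.
Proof. by rewrite /detg !ent1; ring. Qed.

Lemma detgV A : detg A^-1%g = (detg A)^-1.
Proof.
by apply: (mulfI (detg_neq0 A)); rewrite -detgM mulgV detg1 mulfV ?detg_neq0.
Qed.

Lemma detgJ A B : detg (A ^ B)%g = detg A.
Proof. by rewrite conjgE !detgM detgV mulrCA mulVf ?detg_neq0 ?mulr1. Qed.

(** A singular matrix yields 1, which makes the function total; [glE] therefore asks for a nonzero
    determinant. *)
Definition gl a b c d : GLT F := locked (insubd (1%g : GLT F) (mx22 a b c d)).

Lemma glE a b c d : a * d - b * c != 0 ->
  (ent (gl a b c d) 0 0 = a) * (ent (gl a b c d) 0 1 = b)
  * (ent (gl a b c d) 1 0 = c) * (ent (gl a b c d) 1 1 = d).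
Proof.
move=> h; have v : GLval (gl a b c d) = mx22 a b c d.
  have u : mx22 a b c d \in unitmx by rewrite unitmxE det_mx22 unitfE.
  by rewrite /gl -lock [LHS]val_insubd (u : mx22 a b c d \is a GRing.unit).
by rewrite /ent v !mx22E.
Qed.

Lemma detg_gl a b c d : a * d - b * c != 0 -> detg (gl a b c d) = a * d - b * c.
Proof. by move=> h; rewrite /detg !glE. Qed.

Lemma entV A : (ent A^-1%g 0 0 = ent A 1 1 / detg A) * (ent A^-1%g 0 1 = - ent A 0 1 / detg A)
  * (ent A^-1%g 1 0 = - ent A 1 0 / detg A) * (ent A^-1%g 1 1 = ent A 0 0 / detg A).
Proof.
have n0 := detg_neq0 A.
have h : ent A 1 1 / detg A * (ent A 0 0 / detg A)
    - - ent A 0 1 / detg A * (- ent A 1 0 / detg A) != 0.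
  have e : ent A 0 0 * ent A 1 1 - ent A 0 1 * ent A 1 0 = detg A by [].
  rewrite (_ : _ - _ = (detg A)^-1) ?invr_eq0 //.
  transitivity ((ent A 0 0 * ent A 1 1 - ent A 0 1 * ent A 1 0) / detg A / detg A).
    by field.
  by rewrite e; field.
have -> : A^-1%g = gl (ent A 1 1 / detg A) (- ent A 0 1 / detg A)
    (- ent A 1 0 / detg A) (ent A 0 0 / detg A).
  apply: (mulgI A); rewrite mulgV.
  by apply: glP; rewrite !entM !(glE h) !ent1; move: n0; rewrite /detg => n0; field.
by rewrite !(glE h).
Qed.

(** The matrices commuting with a nonscalar A are the k A + l. The off-diagonal entries and the
    difference of the diagonal ones are coordinates modulo scalars. *)
Lemma commute_prop A B : commute A B ->
  ~~ [&& ent A 0 1 == 0, ent A 1 0 == 0 & ent A 0 0 == ent A 1 1] ->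
  exists2 k, ent B 0 1 = k * ent A 0 1 /\ ent B 1 0 = k * ent A 1 0 &
    ent B 1 1 - ent B 0 0 = k * (ent A 1 1 - ent A 0 0).
Proof.
move=> c nA; have e i j := congr1 (fun g => ent g i j) c.
have {e}[e00 e01 e10 _] := And4 (e 0 0) (e 0 1) (e 1 0) (e 1 1).
rewrite /= !entM in e00 e01 e10.
have r1 : ent A 0 1 * ent B 1 0 = ent B 0 1 * ent A 1 0.
  by apply: (addrI (ent A 0 0 * ent B 0 0)); rewrite e00; ring.
have r2 : ent A 0 1 * (ent B 1 1 - ent B 0 0) = ent B 0 1 * (ent A 1 1 - ent A 0 0).
  by apply: (eq_of_sub e01); ring.
have r3 : ent A 1 0 * (ent B 1 1 - ent B 0 0) = ent B 1 0 * (ent A 1 1 - ent A 0 0).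
  by apply: (eq_of_sub (esym e10)); ring.
have [a01|n01] := eqVneq (ent A 0 1) 0; last first.
  exists (ent B 0 1 / ent A 0 1); first split.
  - by rewrite divfK.
  - by apply: (mulfI n01); rewrite r1; field.
  - by apply: (mulfI n01); rewrite r2; field.
have [a10|n10] := eqVneq (ent A 1 0) 0; last first.
  exists (ent B 1 0 / ent A 1 0); first split.
  - by apply: (mulfI n10); rewrite mulrC -r1; field.
  - by rewrite divfK.
  - by apply: (mulfI n10); rewrite r3; field.
have n11 : ent A 1 1 - ent A 0 0 != 0.
  by move: nA; rewrite a01 a10 !eqxx /= subr_eq0 eq_sym.
exists ((ent B 1 1 - ent B 0 0) / (ent A 1 1 - ent A 0 0)); last by rewrite divfK.
rewrite a01 a10 !mulr0; split; apply: (mulIf n11); rewrite mul0r.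
  by rewrite -r2 a01 mul0r.
by rewrite -r3 a10 mul0r.
Qed.

Definition scalarg A := [&& ent A 0 1 == 0, ent A 1 0 == 0 & ent A 0 0 == ent A 1 1].

Lemma commute_nonscalar A B C : ~~ scalarg A -> commute A B -> commute A C -> commute B C.
Proof.
move=> nA /commute_prop/(_ nA)[k [B1 B2] B3] /commute_prop/(_ nA)[l [C1 C2] C3].
have B4 : ent B 1 1 = ent B 0 0 + k * (ent A 1 1 - ent A 0 0) by rewrite -B3; ring.
have C4 : ent C 1 1 = ent C 0 0 + l * (ent A 1 1 - ent A 0 0) by rewrite -C3; ring.
by apply: glP; rewrite !entM ?B1 ?B2 ?B4 ?C1 ?C2 ?C4; ring.
Qed.

Lemma scalarg_commute A B : scalarg A -> commute A B.
Proof.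
case/and3P=> /eqP a01 /eqP a10 /eqP e.
by apply: glP; rewrite !entM ?a01 ?a10 ?e; ring.
Qed.

End Matrices2.

(** * Traces, centralizers and order of SL_2 in odd characteristic *)

Section SpecialLinear.

Variable F : finFieldType.
Hypothesis nz2 : (2%:R != 0 :> F)%R.
Implicit Types (g h u : GLT F).
Local Open Scope ring_scope.

Lemma SLg_group_set : group_set [set g : GLT F | detg g == 1].
Proof.
apply/group_setP; rewrite inE detg1 eqxx; split=> // g h.
by rewrite !inE detgM => /eqP-> /eqP->; rewrite mulr1.
Qed.

Definition SLg : {group GLT F} := locked (Group SLg_group_set).

Lemma SLgP g : reflect (detg g = 1) (g \in SLg).
Proof. by rewrite /SLg -lock inE; apply: eqP. Qed.

Lemma SL2E q : SL2 Plus q F = SLg.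
Proof. by apply/setP=> g; rewrite /SLg -lock !inE detgE. Qed.

Lemma SLg_norm g : g \in 'N(SLg)%g.
Proof.
by apply/normP/setP=> h; rewrite mem_conjg; apply/SLgP/SLgP; rewrite detgJ.
Qed.

Lemma gl_SL a b c d : a * d - b * c = 1 -> gl a b c d \in SLg :> bool.
Proof. by move=> h; apply/SLgP; rewrite detg_gl h // oner_neq0. Qed.

Lemma glE1 a b c d : a * d - b * c = 1 ->
  (ent (gl a b c d) 0 0 = a :> F) * (ent (gl a b c d) 0 1 = b)
  * (ent (gl a b c d) 1 0 = c) * (ent (gl a b c d) 1 1 = d).
Proof. by move=> h; apply: glE; rewrite h oner_neq0. Qed.

Definition mone : GLT F := gl (-1) 0 0 (-1).

Lemma det_mone : (-1) * (-1) - 0 * 0 = 1 :> F.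
Proof. by ring. Qed.

Lemma entNg g : (ent (mone * g)%g 0 0 = - ent g 0 0) * (ent (mone * g)%g 0 1 = - ent g 0 1)
  * (ent (mone * g)%g 1 0 = - ent g 1 0) * (ent (mone * g)%g 1 1 = - ent g 1 1).
Proof. by rewrite !entM !(glE1 det_mone); do !split; ring. Qed.

Lemma mone_SL : mone \in SLg.
Proof. exact: gl_SL det_mone. Qed.

Lemma mone_scalar : scalarg mone.
Proof. by rewrite /scalarg !(glE1 det_mone) !eqxx. Qed.

Lemma mone_neq1 : mone != 1%g.
Proof.
apply/eqP=> /(congr1 (fun g => ent g 0 0)); rewrite (glE1 det_mone) ent1.
by move/eqP; rewrite eq_sym -addr_eq0 => e; case/negP: nz2.
Qed.

Lemma mone2 : (mone * mone = 1)%g.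
Proof. by apply: glP; rewrite entNg (glE1 det_mone) ent1; ring. Qed.

Lemma order_mone : #[mone]%g = 2%N.
Proof. by apply: nt_prime_order mone_neq1 => //; rewrite expgS expg1; apply: mone2. Qed.

Lemma mem_cycle_mone g : (g \in <[mone]>%g) = (g == 1%g) || (g == mone).
Proof.
apply/idP/orP=> [/cycleP[i ->]|[]/eqP->]; [|exact: group1|exact: cycle_id].
elim: i => [|i [/eqP e|/eqP e]]; first by left.
  by right; rewrite expgS e mulg1.
by left; rewrite expgS e mone2.
Qed.

Lemma scalar_SL g : g \in SLg -> scalarg g = (g \in <[mone]>%g).
Proof.
move=> Sg; rewrite mem_cycle_mone; apply/idP/orP=> [|[]/eqP->]; last exact: mone_scalar.
  move: Sg => /SLgP; rewrite /detg => dg /and3P[/eqP g01 /eqP g10 /eqP e].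
  move: dg; rewrite g01 g10 -e mulr0 subr0 => /eqP; rewrite -expr2 sqrf_eq1.
  case/orP=> /eqP a; [left|right]; apply/eqP; apply: glP;
    by rewrite ?ent1 ?(glE1 det_mone) -?e ?g01 ?g10 ?a.
by rewrite /scalarg !ent1 !eqxx.
Qed.

Lemma mone_central g : commute mone g.
Proof. exact: scalarg_commute mone_scalar. Qed.

(* Cayley-Hamilton *)
Lemma sqrg_ent g i j : g \in SLg ->
  ent (g * g)%g i j = trg g * ent g i j - ent (1%g : GLT F) i j.
Proof.
move/SLgP; rewrite /detg => d.
have I (k : 'I_2) : k = 0 \/ k = 1.
  by case: k => [[|[|]]] // l; [left | right]; apply: val_inj.
by case: (I i) (I j) => -> [] ->; rewrite entM ent1 /trg; first [ring | apply: (eq_of_sub (esym d)); ring].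
Qed.

Lemma trg0_sqr g : g \in SLg -> (trg g == 0) = ((g * g)%g == mone).
Proof.
move=> Sg; apply/eqP/eqP=> [t|e].
  by apply: glP; rewrite sqrg_ent // t mul0r ?ent1 ?(glE1 det_mone) ?subr0 ?sub0r.
have e01 := sqrg_ent 0 1 Sg; have e10 := sqrg_ent 1 0 Sg.
have e00 := sqrg_ent 0 0 Sg; have e11 := sqrg_ent 1 1 Sg.
rewrite e !(glE1 det_mone) !ent1 subr0 in e01 e10 e00 e11.
apply/eqP; apply: contraTT isT => nt.
have g01 : ent g 0 1 = 0 by apply: (mulfI nt); rewrite -e01 mulr0.
have g00 : ent g 0 0 = 0 by apply: (mulfI nt); apply: (eq_of_sub (esym e00)); ring.
have /SLgP := Sg; rewrite /detg g01 g00 !mul0r subrr => /esym/eqP.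
by rewrite oner_eq0.
Qed.

(** By Cayley-Hamilton tr(g) g = 2, and the trace is nonzero because trace 0 means g^2 = -1. So g is
    scalar, and -1 is the only involution. *)
Lemma involution_SL g : g \in SLg -> (g * g)%g = 1%g -> g \in <[mone]>%g.
Proof.
move=> Sg e; rewrite -scalar_SL //.
have e01 := sqrg_ent 0 1 Sg; have e10 := sqrg_ent 1 0 Sg.
have e00 := sqrg_ent 0 0 Sg; have e11 := sqrg_ent 1 1 Sg.
rewrite e !ent1 ?subr0 in e01 e10 e00 e11.
have nt : trg g != 0.
  rewrite trg0_sqr // e eq_sym; exact: mone_neq1.
apply/and3P; split; apply/eqP; apply: (mulfI nt).
- by rewrite -e01 mulr0.
- by rewrite -e10 mulr0.
- by apply: (addIr (-1)); rewrite -e00 -e11.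
Qed.

(** Write h = k g + l. The discriminant (d - a)^2 + 4 b c equals tr^2 - 4, so it is the same nonzero
    value for g and h, and it is multiplied by k^2. Hence k = 1 or k = -1, and the common trace
    settles l. *)
Lemma commute_same_trace g h : g \in SLg -> h \in SLg -> ~~ scalarg g ->
  trg g ^+ 2 != 4%:R -> commute g h -> trg h = trg g -> h = g \/ h = (g^-1)%g.
Proof.
move=> /SLgP dg /SLgP dh ng nt /commute_prop/(_ ng)[k [h01 h10] h11] th.
have n4 : 4%:R != 0 :> F by rewrite (natrM _ 2 2) mulf_neq0.
have t4 : trg g ^+ 2 - 4%:R != 0 by rewrite subr_eq0.
have : (k ^+ 2 - 1) * (trg g ^+ 2 - 4%:R) = 0.
  have e1 : (ent g 1 1 - ent g 0 0) ^+ 2 + 4%:R * (ent g 0 1 * ent g 1 0) = trg g ^+ 2 - 4%:R.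
    by apply: (eq_of_sub (esym (congr1 (fun t => 4%:R * t) dg))); rewrite /detg /trg; ring.
  have e2 : (ent h 1 1 - ent h 0 0) ^+ 2 + 4%:R * (ent h 0 1 * ent h 1 0) = trg g ^+ 2 - 4%:R.
    by rewrite -th; apply: (eq_of_sub (esym (congr1 (fun t => 4%:R * t) dh))); rewrite /detg /trg; ring.
  rewrite mulrBl mul1r -{2}e2 -e1 h01 h10 h11; ring.
move/eqP; rewrite mulf_eq0 (negPf t4) orbF subr_eq0 sqrf_eq1 => /orP[]/eqP ek.
  left; rewrite ek !mul1r in h01 h10 h11.
  apply: glP => //; apply: (mulfI nz2); move: th h11; rewrite /trg => th h11.
    by apply: (eq_of_sub th); rewrite -[RHS]subr0 -[X in _ = _ - X](subrr (ent h 1 1 - ent h 0 0)) {2}h11; ring.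
  by apply: (eq_of_sub th); rewrite -[RHS]subr0 -[X in _ = _ - X](subrr (ent h 1 1 - ent h 0 0)) {1}h11; ring.
right; rewrite ek !mulN1r in h01 h10 h11.
move: th h11; rewrite /trg => th h11.
apply: glP; rewrite !entV dg ?divr1 //; apply: (mulfI nz2).
  by apply: (eq_of_sub th); rewrite -[RHS]subr0 -[X in _ = _ - X](subrr (ent h 1 1 - ent h 0 0)) {2}h11; ring.
by apply: (eq_of_sub th); rewrite -[RHS]subr0 -[X in _ = _ - X](subrr (ent h 1 1 - ent h 0 0)) {1}h11; ring.
Qed.

(** The square h of g has trace 4 - 2 = 2, so (h - 1)^2 = 0 and h^n = n h - (n - 1), which is 1 for
    n = p. *)
Lemma unipotent_order p g : p \in [pchar F] -> g \in SLg -> trg g ^+ 2 = 4%:R ->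
  (g ^+ (p * 2) = 1)%g.
Proof.
move=> cp Sg t4; rewrite mulnC expgM [(g ^+ 2)%g]expgS expg1; set h := (g * g)%g.
have Sh : h \in SLg by rewrite groupM.
have th : trg h = 2%:R.
  rewrite /h /trg !sqrg_ent // !ent1.
  by apply: (eq_of_sub t4); rewrite /trg; ring.
clearbody h; have hX n : (forall i j, ent (h ^+ n)%g i j = n%:R * ent h i j - (n%:R - 1) * ent (1%g : GLT F) i j).
  elim: n => [|n IH] i j; first by rewrite expg0; ring.
  have := sqrg_ent i j Sh; rewrite th expgS !entM !IH => e.
  transitivity (n%:R * (ent h i 0 * ent h 0 j + ent h i 1 * ent h 1 j) -
    (n%:R - 1) * (ent h i 0 * ent (1%g : GLT F) 0 j + ent h i 1 * ent (1%g : GLT F) 1 j)).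
    by ring.
  by rewrite e -entM mulg1 -natr1; ring.
have p0 := pcharf0 cp.
by apply: glP; rewrite hX p0 ?ent1; ring.
Qed.

Lemma pprime_trace p g : p \in [pchar F] -> g \in SLg -> g \notin <[mone]>%g ->
  ~~ (p %| #[g]%g)%N -> trg g ^+ 2 != 4%:R.
Proof.
move=> cp Sg ng pg; apply: contra ng => /eqP t4.
apply: involution_SL => //; have := unipotent_order cp Sg t4.
have co : coprime #[g]%g p by rewrite coprime_sym prime_coprime ?(pcharf_prime cp).
move/eqP; rewrite -order_dvdn Gauss_dvdr // order_dvdn => /eqP.
by rewrite expgS expg1.
Qed.

Lemma dickson_hyp_SL p (H : {group (GLT F)}) : p \in [pchar F] ->
  H \subset SLg -> ~~ (p %| #|H|)%N -> mone \in H -> dickson_hyp <[mone]>%g H.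
Proof.
move=> cp sHS pH Hm.
have ns x : x \in H :\: <[mone]>%g -> [/\ x \in H, x \in SLg, ~~ scalarg x & trg x ^+ 2 != 4%:R].
  case/setDP=> Hx nx; have Sx := subsetP sHS _ Hx; rewrite scalar_SL // nx.
  split=> //; apply: pprime_trace cp Sx nx _.
  by apply: contra pH => /dvdn_trans; apply; apply: order_dvdG.
split=> [||| x /ns[Hx Sx nx tx] | x /ns[Hx Sx nx tx]].
- by rewrite cycle_subG.
- apply/centsP=> x Hx y; rewrite mem_cycle_mone => /orP[]/eqP->.
    exact: commute1.
  by apply/esym/mone_central.
- by rewrite -orderE order_mone.
- apply/centsP=> y /setIP[_ /cent1P cy] z /setIP[_ /cent1P cz].
  exact: (commute_nonscalar nx (commute_sym cy) (commute_sym cz)).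
set C := 'C_H[x]%g; set N := 'N_H(C)%g.
rewrite -(Lagrange (_ : 'C_N[x] \subset N)%g) ?subsetIl // mulnC index_cent1.
apply: leq_mul; last by rewrite subset_leq_card // setSI // subsetIl.
(* A normalizing element sends x to an element of C with the same trace, that is to x or its
   inverse. *)
apply: (@leq_trans #|[set x; x^-1%g]|); last by rewrite cards2; case: (_ != _).
apply/subset_leq_card/subsetP=> _ /imsetP[n /setIP[Hn Nn] ->]; rewrite !inE.
have Cx : (x \in C)%g by rewrite inE Hx cent1id.
have : (x ^ n \in C)%g by rewrite memJ_norm.
case/setIP=> Hxn /cent1P c.
have [->|->] := commute_same_trace Sx (subsetP sHS _ Hxn) nx tx (commute_sym c) (trgJ _ _);
  by rewrite eqxx ?orbT.
Qed.

Lemma card_SLg : #|SLg| = (#|F| * (#|F| ^ 2 - 1))%N.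
Proof.
pose f (g : GLT F) : {unit F} := insubd (1%g : {unit F}) (detg g).
have fE g : val (f g) = detg g by rewrite val_insubd unitfE detg_neq0.
have fM : {in [set: GLT F] &, {morph f : g h / (g * h)%g}}.
  by move=> g h _ _; apply: val_inj; rewrite fE detgM -!fE.
pose m := Morphism fM.
have kf : ('ker m = SLg)%g.
  apply/setP=> g; apply/idP/SLgP=> [/mker/(congr1 val)|d1]; first by rewrite /= fE.
  by apply/kerP; rewrite ?inE //; apply: val_inj; rewrite /= fE.
have im : (m @* [set: GLT F] = [set: {unit F}])%g.
  apply/setP=> u; rewrite inE; apply/morphimP.
  have nu : val u * 1 - 0 * 0 != 0 by rewrite mulr1 mul0r subr0 -unitfE (valP u).
  exists (gl (val u) 0 0 1); rewrite ?inE //; apply: val_inj.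
  by rewrite /= fE detg_gl // mulr1 mul0r subr0.
have := card_morphim m [set: GLT F]; rewrite im setIid card_finField_unit => oi.
have := Lagrange (subsetT ('ker m)%G); rewrite /= -oi kf card_GL_2 => E.
have q1 := finNzRing_gt1 F; have q0 : (0 < #|F|.-1)%N by case: #|F| q1 => [|[|]].
apply/eqP; rewrite -(eqn_pmul2r q0); apply/eqP; rewrite [LHS]E.
rewrite -[X in (_ - X)%N](exp1n 2) subn_sqr; case: #|F| q1 => [|[|q]] //= _.
by rewrite subn1 addn1 /=; ring.
Qed.

End SpecialLinear.

(** * Squares and binary quadratic forms over a finite field *)

Section SquaresFiniteField.

Variable F : finFieldType.
Hypothesis nz2 : (2%:R != 0 :> F)%R.
Local Open Scope ring_scope.

(** Squaring has fibres of at most two elements, and only one over 0. *)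
Lemma card_squares : (#|F|.+1 <= 2 * #|[set u ^+ 2 | u : F]|)%N.
Proof.
set A := [set _ | u in _].
have A0 : 0 \in A by apply/imsetP; exists 0; rewrite ?inE // expr0n.
have : #|F| = (\sum_(s in A) #|[set u : F | u ^+ 2 == s]|)%N.
  rewrite -sum1_card (partition_big (fun u : F => u ^+ 2) (mem A)) /=.
    by apply: eq_bigr => s _; rewrite -sum1_card; apply: eq_bigl => u; rewrite inE.
  by move=> u _; apply: imset_f.
rewrite (bigD1 0) //= => ->.
have -> : #|[set u : F | u ^+ 2 == 0]| = 1%N.
  by apply/eqP/cards1P; exists 0; apply/setP=> u; rewrite !inE sqrf_eq0.
have l : (\sum_(s in A | s != 0%R) #|[set u : F | u ^+ 2 == s]| <= \sum_(s in A | s != 0%R) 2)%N.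
  apply: leq_sum => s /andP[/imsetP[v _ ->] _].
  apply: (@leq_trans #|[set v; - v]|); last by rewrite cards2; case: (_ != _).
  by apply/subset_leq_card/subsetP=> u; rewrite !inE eqf_sqr.
have -> : (2 * #|A| = 2 + \sum_(s in A | s != 0%R) 2)%N.
  by rewrite mulnC -sum_nat_const (bigD1 0).
by rewrite add1n addSn ltnS add1n ltnS.
Qed.

(** The sets of all u^2 and of all c - e v^2 both have more than half of the elements of F, so they
    meet. *)
Lemma binary_form_onto (e c : F) : e != 0 -> exists u v, u ^+ 2 + e * v ^+ 2 = c.
Proof.
move=> ne; set A := [set u ^+ 2 | u : F]; set B := [set c - e * s | s in A].
have oB : #|B| = #|A| by apply: card_imset => s t /addrI/oppr_inj/(mulfI ne).
have /set0Pn[s] : A :&: B != set0.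
  apply/negP=> /eqP AB; have := cardsUI A B; rewrite AB cards0 addn0 oB addnn -mul2n.
  have := card_squares; rewrite -/A => l E; rewrite -E in l.
  by have := leq_trans l (max_card _); rewrite ltnn.
case/setIP=> /imsetP[u _ ->] /imsetP[_ /imsetP[v _ ->] E].
by exists u, v; rewrite E subrK.
Qed.

(** As 1 and -1 have the same square, the q - 1 elements other than 1 already produce all
    squares. *)
Lemma exists_nonsquare : exists d : F, d != 0 /\ forall e, d != e ^+ 2.
Proof.
have /subsetPn[d _ nd] : ~~ ([set: F] \subset [set u ^+ 2 | u in [set~ (1 : F)]]).
  apply/negP=> /subset_leq_card; rewrite cardsT => l.
  have := leq_trans l (leq_imset_card _ _); rewrite cardsC1.
  by have := finNzRing_gt1 F; case: #|F| => // n _; rewrite ltnn.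
have nsq e : d != e ^+ 2.
  apply: contra nd => /eqP->; apply/imsetP; have [->|ne] := eqVneq e 1.
    by exists (-1); rewrite ?sqrrN // !inE eq_sym -addr_eq0.
  by exists e; rewrite // !inE.
exists d; split=> //; have := nsq 0; by rewrite expr0n.
Qed.

End SquaresFiniteField.

Section SameTrace.

Variable F : finFieldType.
Hypothesis nz2 : (2%:R != 0 :> F)%R.
Implicit Types (g h u : GLT F).
Local Open Scope ring_scope.

Definition companion (t : F) : GLT F := gl 0 1 (-1) t.

Lemma det_companion (t : F) : 0 * t - 1 * (-1) = 1.
Proof. by ring. Qed.

(* The change of basis has columns p and - g p; its determinant is a
   nondegenerate binary quadratic form in p. *)
Lemma companion_conj g : g \in SLg F -> ~~ scalarg g -> trg g ^+ 2 != 4%:R ->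
  exists2 u, u \in SLg F & (g ^ u = companion (trg g))%g.
Proof.
move=> /SLgP dg ng nt.
set a := ent g 0 0; set b := ent g 0 1; set c := ent g 1 0; set d := ent g 1 1.
have n4 : 4%:R != 0 :> F by rewrite (natrM _ 2 2) mulf_neq0.
suff [p0 [p1 E]] : exists p0 p1 : F, b * p1 ^+ 2 + (a - d) * p0 * p1 - c * p0 ^+ 2 = 1.
  pose u := gl p0 (- (a * p0 + b * p1)) p1 (- (c * p0 + d * p1)).
  have du : p0 * - (c * p0 + d * p1) - - (a * p0 + b * p1) * p1 = 1 by rewrite -E; ring.
  exists u; first exact: gl_SL du.
  have e : (g * u = u * companion (trg g))%g.
    apply: glP; rewrite !entM !(glE1 du) !(glE1 (det_companion _)) -/a -/b -/c -/d;
      rewrite /trg -/a -/b -/c -/d; first [by ring | idtac];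
      move: dg; rewrite /detg -/a -/b -/c -/d => dg.
      by apply: (eq_of_sub (congr1 (fun t => t * p0) dg)); ring.
    by apply: (eq_of_sub (congr1 (fun t => t * p1) dg)); ring.
  by rewrite conjgE e mulKg.
have D0 : - ((a - d) ^+ 2 / 4%:R + b * c) != 0.
  have -> : - ((a - d) ^+ 2 / 4%:R + b * c) = - ((trg g ^+ 2 - 4%:R) / 4%:R).
    congr (- _); apply: (mulIf n4); rewrite divfK // mulrDl divfK //.
    by apply: (eq_of_sub (esym (congr1 (fun t => 4%:R * t) dg))); rewrite /trg /detg -/a -/b -/c -/d; ring.
  by rewrite oppr_eq0 mulf_neq0 ?invr_eq0 // subr_eq0.
(* Completing the square in b times the form gives X^2 + D p0^2 with D the element of [D0], and
   similarly with c. For b = c = 0 the form is (a - d) p0 p1. *)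
have [b0|nb] := eqVneq b 0; last first.
  have [X [p0 E]] := binary_form_onto b D0.
  exists p0, ((X - (a - d) * p0 / 2%:R) / b); apply: (mulfI nb).
  rewrite mulr1 -[RHS]E; field; rewrite nb nz2 n4 //.
have [c0|nc] := eqVneq c 0; last first.
  have [X [p1 E]] := binary_form_onto (- c) D0.
  exists ((X + (a - d) * p1 / 2%:R) / c), p1; apply: (mulfI nc); apply: oppr_inj.
  rewrite mulr1 -[RHS]E b0; field; rewrite nc nz2 n4 //.
have nad : a - d != 0.
  by move: ng; rewrite /scalarg -/a -/b -/c -/d b0 c0 !eqxx /= subr_eq0.
by exists 1, (a - d)^-1; rewrite b0 c0; field.
Qed.

Lemma same_trace_conj g h : g \in SLg F -> h \in SLg F -> ~~ scalarg g -> ~~ scalarg h ->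
  trg g ^+ 2 != 4%:R -> trg h = trg g -> exists2 u, u \in SLg F & (g ^ u = h)%g.
Proof.
move=> Sg Sh ng nh nt e; have [u Su Eu] := companion_conj Sg ng nt.
rewrite -e in nt; have [v Sv Ev] := companion_conj Sh nh nt.
exists (u * v^-1)%g; first by rewrite groupM // groupV.
by rewrite conjgM Eu -e -Ev conjgK.
Qed.

End SameTrace.

(** * The centralizer of i, a cyclic torus *)

Section Torus.

Variable F : finFieldType.
Hypothesis nz2 : (2%:R != 0 :> F)%R.
Implicit Types (g h u : GLT F).
Local Open Scope ring_scope.

Let T := 'C_(SLg F)[companion 0]%g.

Lemma trg_companion (t : F) : trg (companion t) = t.
Proof. by rewrite /trg !(glE1 (det_companion _)) add0r. Qed.

Lemma companion_SL (t : F) : companion t \in SLg F.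
Proof. exact: gl_SL (det_companion t). Qed.

Lemma scalar_companion (t : F) : ~~ scalarg (companion t).
Proof. by rewrite /scalarg !(glE1 (det_companion _)) oner_eq0. Qed.

(** These are the x + y i with x^2 + y^2 = 1, where i is [companion 0]. *)
Lemma mem_torus g : (g \in T) =
  [&& ent g 1 1 == ent g 0 0, ent g 1 0 == - ent g 0 1 & ent g 0 0 ^+ 2 + ent g 0 1 ^+ 2 == 1].
Proof.
apply/setIP/and3P=> [[/SLgP dg /cent1P c]|[/eqP e1 /eqP e2 /eqP e3]].
  have e i j := congr1 (fun u => ent u i j) c.
  have e01 := e 0 1; have e00 := e 0 0.
  rewrite /= !entM !(glE1 (det_companion _)) in e01 e00.
  have e1 : ent g 1 1 = ent g 0 0 by apply: (eq_of_sub (esym e01)); ring.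
  have e2 : ent g 1 0 = - ent g 0 1 by apply: (eq_of_sub (esym e00)); ring.
  by split; apply/eqP; rewrite // -dg /detg e1 e2; ring.
split; first by apply/SLgP; rewrite /detg e1 e2 -e3; ring.
by apply/cent1P; apply: glP; rewrite !entM !(glE1 (det_companion _)) ?e1 ?e2; ring.
Qed.

Lemma torus_ent00 g : g \in T -> g != mone F -> ent g 0 0 + 1 != 0.
Proof.
rewrite mem_torus => /and3P[/eqP e1 /eqP e2 /eqP e3]; apply: contra; rewrite addr_eq0 => /eqP e.
move: e3; rewrite e sqrrN expr1n => /eqP; rewrite -subr_eq0 addrC addKr sqrf_eq0 => /eqP e0.
by apply/eqP; apply: glP; rewrite !(glE1 (det_mone F)) ?e1 ?e2 ?e0 ?e ?oppr0.
Qed.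

(* Stereographic projection of the conic from the point of [mone]. *)
Lemma card_torus_param : #|T| = #|[set k : F | 1 + k ^+ 2 != 0]|.+1.
Proof.
have Tm : mone F \in T.
  by rewrite mem_torus !(glE1 (det_mone F)) oppr0 !eqxx /= expr0n addr0 sqrrN expr1n.
rewrite (cardsD1 (mone F)) Tm add1n; congr _.+1.
pose f g := ent g 0 1 / (ent g 0 0 + 1).
have fP g : g \in T :\ mone F -> let k := f g in
  [/\ 1 + k ^+ 2 != 0, ent g 0 0 = (1 - k ^+ 2) / (1 + k ^+ 2) & ent g 0 1 = 2%:R * k / (1 + k ^+ 2)].
  case/setD1P=> gm Tg k; have n1 := torus_ent00 Tg gm.
  move: Tg; rewrite mem_torus => /and3P[_ _ /eqP e3].
  have e3' : ent g 0 1 ^+ 2 = 1 - ent g 0 0 ^+ 2 by rewrite -e3; ring.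
  have ek : 1 + k ^+ 2 = 2%:R / (ent g 0 0 + 1).
    by rewrite /k /f expr_div_n e3'; field.
  rewrite ek; split; first by rewrite mulf_neq0 ?invr_eq0.
    by rewrite /k /f expr_div_n e3'; field; rewrite nz2 n1.
  by rewrite /k /f; field; rewrite nz2 n1.
rewrite -(@card_in_imset _ _ f); last first.
  move=> g h Tg Th e; have [_ g0 g1] := fP _ Tg; have [_ h0 h1] := fP _ Th.
  have : g \in T by case/setD1P: Tg.
  have : h \in T by case/setD1P: Th.
  rewrite !mem_torus => /and3P[/eqP eh1 /eqP eh2 _] /and3P[/eqP eg1 /eqP eg2 _].
  by apply: glP; rewrite ?eh1 ?eh2 ?eg1 ?eg2 ?g0 ?g1 ?h0 ?h1 e.
congr #|pred_of_set _|; apply/setP=> k; rewrite inE; apply/imsetP/idP=> [[g /fP[n0 _ _] ->] //|n0].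
have d : ((1 - k ^+ 2) / (1 + k ^+ 2)) * ((1 - k ^+ 2) / (1 + k ^+ 2))
   - (2%:R * k / (1 + k ^+ 2)) * (- (2%:R * k / (1 + k ^+ 2))) = 1 by field.
exists (gl ((1 - k ^+ 2) / (1 + k ^+ 2)) (2%:R * k / (1 + k ^+ 2))
   (- (2%:R * k / (1 + k ^+ 2))) ((1 - k ^+ 2) / (1 + k ^+ 2))); last first.
  rewrite /f !(glE1 d) (_ : _ + 1 = 2%:R / (1 + k ^+ 2)); last by field.
  by field; rewrite nz2 n0.
rewrite in_setD1; apply/andP; split; last first.
  by rewrite mem_torus !(glE1 d) !eqxx /=; apply/eqP; apply: (eq_of_sub d); ring.
apply/eqP=> /(congr1 (fun u => ent u 0 0)); rewrite (glE1 d) (glE1 (det_mone F)).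
move/(congr1 (fun v : F => v * (1 + k ^+ 2))); rewrite divfK // => e.
case/negP: nz2; apply/eqP.
by apply: (eq_of_sub e); ring.
Qed.

(** The parametrization gives q + 1 minus the number, 0 or 2, of square roots of -1. The order is a
    multiple of 4 because i has order 4, and q - eps is the one of q - 1 and q + 1 that is divisible
    by 4. *)
Lemma card_torus : odd #|F| -> #|T| = q_sub_eps #|F|.
Proof.
move=> oF; have d4 : (4 %| #|T|)%N.
  have Tx : companion 0 \in T by rewrite inE companion_SL cent1id.
  have x2 : (companion 0 * companion 0)%g = mone F.
    by apply/eqP; rewrite -trg0_sqr ?trg_companion ?companion_SL.
  have ox : #[companion (0 : F)]%g = 4%N.
    have o4 : (companion (0 : F) ^+ 4 = 1)%g.
      by rewrite expg4E x2 mone2.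
    have := order_dvdn (companion (0 : F)) 4; rewrite o4 eqxx => d.
    have := order_dvdn (companion (0 : F)) 2; rewrite expgS expg1 x2 (negPf (mone_neq1 nz2)).
    have := dvdn_leq (isT : 0 < 4)%N d; have := order_gt0 (companion (0 : F)).
    by move: d; move: #[_]%g => n; case: n => [|[|[|[|[|n]]]]].
  by rewrite -ox order_dvdG.
have: #|T| = #|F|.-1 \/ #|T| = #|F|.+1.
  rewrite card_torus_param; set B := [set k | _].
  have -> : #|B| = (#|F| - #|[set k : F | (k ^+ 2 == -1)%R]|)%N.
    have <- : ~: B = [set k | k ^+ 2 == -1].
      by apply/setP=> k; rewrite !inE negbK addrC addr_eq0.
    by rewrite -(cardsC B) addnK.
  have [-> | [k]] := set_0Vmem [set k : F | k ^+ 2 == -1].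
    by rewrite cards0 subn0; right.
  rewrite inE => /eqP ek; left.
  have -> : [set k : F | k ^+ 2 == -1] = [set k; - k].
    by apply/setP=> l; rewrite !inE -ek eqf_sqr.
  rewrite cards2 (_ : k != - k).
    by have := finNzRing_gt1 F; case: #|F| => [|[|n]] //= _; rewrite subn2.
  rewrite -addr_eq0 -mulr2n -mulr_natl mulf_neq0 //; apply/eqP=> k0.
  by move: ek; rewrite k0 expr0n /= => /eqP; rewrite eq_sym oppr_eq0 oner_eq0.
rewrite /q_sub_eps /eps; move: oF d4; move: #|T| #|F| => t q oq d4 E.
have [k [ek]] : exists k, (q = 4 * k + 1 \/ q = 4 * k + 3)%N /\ True.
  by exists (q %/ 4)%N; split => //; lia.
move=> _; case: ek => eq.
  have -> : (q.-1 %/ 2 = k * 2)%N by lia.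
  by rewrite exprM sqrr_sign; lia.
have -> : (q.-1 %/ 2 = (k * 2).+1)%N by lia.
by rewrite exprS exprM sqrr_sign; lia.
Qed.

(** With a square root l of -1 in an algebraic closure, x + y i is sent to x + y l, whose inverse is
    x - y l. This embeds T into the multiplicative group of a field. *)
Lemma torus_cyclic : cyclic T.
Proof.
have [L [io _]] := countable_algebraic_closure F.
have [l el] : exists l : L, l ^+ 2 = -1.
  have [l] := @solve_monicpoly L 2 (fun i => if i == 0%N then -1 else 0) isT.
  by rewrite !big_ord_recl big_ord0 /= mul0r !addr0 expr0 mulr1 => e; exists l.
pose f g := io (ent g 0 0) + io (ent g 0 1) * l.
apply: (@field_mul_group_cyclic _ [group of T] L f) => [g h Tg Th | g Tg].
  move: Tg Th; rewrite !mem_torus => /and3P[/eqP eh1 /eqP eh2 _] /and3P[/eqP eg1 /eqP eg2 _].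
  rewrite /f !entM ?eg1 ?eg2 !rmorphD !rmorphM rmorphN /=.
  have -> : io (ent g 0 1) * - io (ent h 0 1) = io (ent g 0 1) * io (ent h 0 1) * l ^+ 2.
    by rewrite el; ring.
  by ring.
have n2 : 2%:R != 0 :> L by rewrite -(rmorph_nat io) fmorph_eq0.
split=> [|->]; last by rewrite /f !ent1 rmorph1 rmorph0 mul0r addr0.
move: Tg; rewrite mem_torus => /and3P[/eqP e1 /eqP e2 /eqP e3] f1.
have f2 : io (ent g 0 0) - io (ent g 0 1) * l = 1.
  have e : (io (ent g 0 0) - io (ent g 0 1) * l) * f g = 1.
    rewrite /f -(rmorph1 io) -e3 rmorphD !rmorphXn /=.
    transitivity (io (ent g 0 0) ^+ 2 - io (ent g 0 1) ^+ 2 * l ^+ 2); first by ring.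
    by rewrite el; ring.
  by rewrite -e f1 mulr1.
have g00 : ent g 0 0 = 1.
  apply: (fmorph_inj io); rewrite rmorph1; apply: (mulfI n2).
  by apply: (eq_of_sub (congr2 +%R f1 f2)); rewrite /f; ring.
have g01 : ent g 0 1 = 0.
  by apply/eqP; rewrite -sqrf_eq0; apply/eqP; apply: (eq_of_sub e3); rewrite g00; ring.
by apply: glP; rewrite ?ent1 ?e1 ?e2 ?g00 ?g01 ?oppr0.
Qed.

End Torus.

(** * Traces of elements of small order *)

Section PowersInSL2.

Variable F : finFieldType.
Hypothesis nz2 : (2%:R != 0 :> F)%R.
Implicit Types g h u : GLT F.
Local Open Scope ring_scope.

Lemma SLgM g h : g \in SLg F -> h \in SLg F -> (g * h)%g \in SLg F.
Proof. by move=> /SLgP dg /SLgP dh; apply/SLgP; rewrite detgM dg dh mulr1. Qed.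

(** Iterating g^2 = t g - 1 writes each power of g as a combination of g and 1 with Chebyshev
    polynomials in t. If g is not scalar but the power is, the coefficient of g vanishes, which is
    the equation for the trace. *)
Lemma cube_ent g i j : g \in SLg F ->
  ent (g * (g * g))%g i j = (trg g ^+ 2 - 1) * ent g i j - trg g * ent (1%g : GLT F) i j.
Proof.
move=> Sg; rewrite entM !sqrg_ent //.
transitivity (trg g * ent (g * g)%g i j - ent (g * 1)%g i j); first by rewrite (entM g g) (entM g 1); ring.
by rewrite mulg1 sqrg_ent //; ring.
Qed.

Lemma fifth_ent g i j : g \in SLg F ->
  ent (g * g * (g * (g * g)))%g i j = (trg g ^+ 4 - 3%:R * trg g ^+ 2 + 1) * ent g i j
    - (trg g ^+ 3 - 2%:R * trg g) * ent (1%g : GLT F) i j.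
Proof.
move=> Sg; rewrite entM !cube_ent //.
transitivity ((trg g ^+ 2 - 1) * ent (g * g * g)%g i j - trg g * ent (g * g * 1)%g i j).
  by rewrite (entM (g * g)%g g) (entM (g * g)%g 1%g); ring.
by rewrite mulg1 -mulgA cube_ent // sqrg_ent //; ring.
Qed.

Lemma scalar_combination g u (c d : F) : ~~ scalarg g -> scalarg u ->
  (forall i j, ent u i j = c * ent g i j - d * ent (1%g : GLT F) i j) -> c = 0.
Proof.
move=> ng /and3P[/eqP u01 /eqP u10 /eqP ud] E; apply: contraNeq ng => nc.
apply/and3P; split; apply/eqP; apply: (mulfI nc).
- by have := E 0 1; rewrite u01 ent1 mulr0 subr0 => <-; rewrite mulr0.
- by have := E 1 0; rewrite u10 ent1 mulr0 subr0 => <-; rewrite mulr0.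
- apply: (addIr (- (d * 1))).
  by have := E 0 0; have := E 1 1; rewrite !ent1 ud => <- <-.
Qed.

Lemma combination_scalar g u (d : F) :
  (forall i j, ent u i j = 0 * ent g i j - d * ent (1%g : GLT F) i j) -> scalarg u.
Proof. by move=> E; rewrite /scalarg !E !ent1 !mul0r mulr0 subrr !eqxx. Qed.

Lemma trace_exp4 g : g \in SLg F -> ~~ scalarg g -> (g ^+ 4 = 1)%g -> trg g = 0.
Proof.
move=> Sg ng; rewrite expg4E => e.
have Sgg := SLgM Sg Sg.
have := involution_SL nz2 Sgg e; rewrite -scalar_SL // => sgg.
by apply: (@scalar_combination g (g * g)%g (trg g) 1 ng sgg) => i j; rewrite sqrg_ent // mul1r.
Qed.

Lemma trace_exp6 g : g \in SLg F -> ~~ scalarg g -> (g ^+ 6 = 1)%g -> trg g ^+ 2 = 1.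
Proof.
move=> Sg ng; rewrite expg6E => e.
have Sgg := SLgM Sg (SLgM Sg Sg).
have := involution_SL nz2 Sgg e; rewrite -scalar_SL // => sgg.
apply/eqP; rewrite -subr_eq0; apply/eqP.
by apply: (scalar_combination ng sgg) => i j; rewrite cube_ent.
Qed.

Lemma trace_exp10 g : g \in SLg F -> ~~ scalarg g -> (g ^+ 10 = 1)%g ->
  trg g ^+ 4 - 3%:R * trg g ^+ 2 + 1 = 0.
Proof.
move=> Sg ng; rewrite expg10E => e.
have Sgg := SLgM (SLgM Sg Sg) (SLgM Sg (SLgM Sg Sg)).
have := involution_SL nz2 Sgg e; rewrite -scalar_SL // => sgg.
by apply: (scalar_combination ng sgg) => i j; rewrite fifth_ent.
Qed.

Lemma exp10_trace g : g \in SLg F -> trg g ^+ 4 - 3%:R * trg g ^+ 2 + 1 = 0 ->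
  (g ^+ 10 = 1)%g.
Proof.
move=> Sg e; have Sgg := SLgM (SLgM Sg Sg) (SLgM Sg (SLgM Sg Sg)).
have sc : scalarg (g * g * (g * (g * g)))%g.
  by apply: (@combination_scalar g _ (trg g ^+ 3 - 2%:R * trg g)) => i j; rewrite fifth_ent // e.
move: sc; rewrite scalar_SL // mem_cycle_mone // expg10E.
by case/orP=> /eqP->; rewrite ?mulg1 // mone2.
Qed.

(* An element of order 5 has trace -t with t the golden ratio or its conjugate. *)
Lemma golden_ratio : (5 %| #|SLg F|)%N -> 5%:R != 0 :> F -> exists t : F, t ^+ 2 = t + 1.
Proof.
move=> d5 n5; have [g Sg og] := Cauchy (isT : prime 5) d5.
have ng : ~~ scalarg g.
  rewrite scalar_SL //; apply/negP=> /order_dvdG.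
  by rewrite og -orderE order_mone.
have e5 : (g * g * (g * (g * g)) = 1)%g by rewrite -expg5E -og expg_order.
have s1 : scalarg (1%g : GLT F) by rewrite /scalarg !ent1 !eqxx.
have e4 : trg g ^+ 4 - 3%:R * trg g ^+ 2 + 1 = 0.
  by apply: (scalar_combination ng s1) => i j; rewrite -{1}e5 fifth_ent.
have : (trg g ^+ 2 + trg g - 1) * (trg g ^+ 2 - trg g - 1) = 0 by rewrite -e4; ring.
move/eqP; rewrite mulf_eq0 => /orP[]/eqP e; [exists (- trg g) | exists (trg g)];
  by apply: (eq_of_sub e); ring.
Qed.

End PowersInSL2.

(** * Quaternions in SL_2 *)

Section Quaternions.

Variable F : finFieldType.
Hypothesis nz2 : (2%:R != 0 :> F)%R.
Hypothesis nz3 : (3%:R != 0 :> F)%R.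
Variables a b : F.
Hypothesis hab : (a ^+ 2 = -1 - b ^+ 2)%R.
Implicit Types g h u : GLT F.
Local Open Scope ring_scope.

Definition qi : GLT F := companion 0.
Definition qj : GLT F := gl a b b (- a).
(** The Hurwitz unit (-1 + i + j + ij) / 2 of order 3, which permutes i, j, ij cyclically. *)
Definition qw : GLT F := gl ((-1 + a + b) / 2%:R) ((1 + b - a) / 2%:R)
  ((-1 + b - a) / 2%:R) ((-1 - a - b) / 2%:R).
(** The quaternion 1 + i, of determinant 2; conjugation by it fixes i and sends j to -ij. *)
Definition qc : GLT F := gl 1 1 (-1) 1.

Lemma det_qj : a * (- a) - b * b = 1.
Proof. ring: hab. Qed.

Lemma det_qw : (-1 + a + b) / 2%:R * ((-1 - a - b) / 2%:R)
  - (1 + b - a) / 2%:R * ((-1 + b - a) / 2%:R) = 1.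
Proof.
apply: (eq_of_sub (congr1 (fun t => t / - 2%:R) hab)); field; rewrite ?oppr_eq0 ?nz2 //.
Qed.

Lemma det_qc_neq0 : 1 * 1 - 1 * (-1) != 0 :> F.
Proof. by rewrite mulr1 mulrN1 opprK. Qed.

Definition qE := (glE1 det_qj, glE1 det_qw, glE det_qc_neq0, glE1 (det_companion (0:F)), glE1 (det_mone F), ent1 F).

Lemma qiE : (ent qi 0 0 = 0) * (ent qi 0 1 = 1) * (ent qi 1 0 = -1) * (ent qi 1 1 = 0).
Proof. exact: glE1 (det_companion 0). Qed.

Lemma qi_SL : qi \in SLg F. Proof. exact: companion_SL. Qed.
Lemma qj_SL : qj \in SLg F. Proof. exact: gl_SL det_qj. Qed.
Lemma qw_SL : qw \in SLg F. Proof. exact: gl_SL det_qw. Qed.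

Lemma qi2 : (qi * qi = mone F)%g.
Proof. by apply: glP; rewrite !entM !qE; ring. Qed.

Lemma qj2 : (qj * qj = mone F)%g.
Proof. by apply: glP; rewrite !entM !qE; ring: hab. Qed.

Lemma qji : (qj * qi = mone F * (qi * qj))%g.
Proof. by apply: glP; rewrite !entM !qE; ring. Qed.

Lemma trg_qw : trg qw = -1.
Proof. by rewrite /trg !qE; field; rewrite ?oppr_eq0 ?nz2 //. Qed.

Lemma qw3 : (qw * (qw * qw) = 1)%g.
Proof.
have e i j : ent (qw * (qw * qw))%g i j = ent (1%g : GLT F) i j.
  by rewrite cube_ent ?qw_SL // trg_qw; ring.
by apply: glP; rewrite e.
Qed.

Lemma qw_neq1 : qw != 1%g.
Proof.
apply/eqP=> /(congr1 (@trg F)); rewrite trg_qw /trg !ent1 => e.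
case/negP: nz3; apply/eqP; apply: (eq_of_sub (esym e)); ring.
Qed.

Lemma qi_qw : (qi * qw = qw * qj)%g.
Proof.
by apply: glP; rewrite !entM !qE; field: hab; exact: nz2.
Qed.

Lemma qj_qw : (qj * qw = qw * (qi * qj))%g.
Proof.
by apply: glP; rewrite !entM !qE; field: hab; exact: nz2.
Qed.

Lemma qi_qc : (qi * qc = qc * qi)%g.
Proof. by apply: glP; rewrite !entM !qE; ring. Qed.

Lemma qj_qc : (qj * qc = qc * (mone F * (qi * qj)))%g.
Proof. by apply: glP; rewrite !entM !qE; ring. Qed.

Lemma qij_nocommute : ~ commute qi qj.
Proof.
move=> c; have := qji; rewrite -c => /(congr1 (fun u => u * (qi * qj)^-1)%g).
by rewrite mulgV mulgK => /esym/eqP; rewrite (negPf (mone_neq1 nz2)).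
Qed.

Lemma qij_centralizer u : commute u qi -> commute u qj -> scalarg u.
Proof.
move=> ci cj; apply/negPn/negP=> nu; apply: qij_nocommute.
exact: (commute_nonscalar nu ci cj).
Qed.

(** The trace form is nondegenerate and 1, i, j, ij is a basis of the matrix algebra. *)
Lemma trace_ext g h : trg g = trg h -> trg (g * qi)%g = trg (h * qi)%g ->
  trg (g * qj)%g = trg (h * qj)%g -> trg (g * (qi * qj))%g = trg (h * (qi * qj))%g -> g = h.
Proof.
rewrite /trg !entM !qE => e1 ei ej ek.
have eD : ent g 0 0 - ent g 1 1 = ent h 0 0 - ent h 1 1.
  have e := congr2 (fun x y => x * a + y * b) ej ek.
  apply: (eq_of_sub (esym e)).
  by ring: hab.
have eP : ent g 0 1 + ent g 1 0 = ent h 0 1 + ent h 1 0.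
  have e := congr2 (fun x y => x * b - y * a) ej ek.
  apply: (eq_of_sub (esym e)).
  by ring: hab.
apply: glP; apply: (mulfI nz2).
- by apply: (eq_of_sub (congr2 +%R e1 eD)); ring.
- by apply: (eq_of_sub (congr2 (fun x y => x - y) eP ei)); ring.
- by apply: (eq_of_sub (congr2 +%R eP ei)); ring.
- by apply: (eq_of_sub (congr2 (fun x y => x - y) e1 eD)); ring.
Qed.

(* The element (x i + y j + z ij) / 2. *)
Definition pv (x y z : F) : GLT F := gl ((y * a + z * b) / 2%:R)
  ((x + y * b - z * a) / 2%:R) ((- x + y * b - z * a) / 2%:R) (- (y * a + z * b) / 2%:R).

Lemma det_pv x y z : x ^+ 2 + y ^+ 2 + z ^+ 2 = 4%:R ->
  (y * a + z * b) / 2%:R * (- (y * a + z * b) / 2%:R)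
   - (x + y * b - z * a) / 2%:R * ((- x + y * b - z * a) / 2%:R) = 1.
Proof.
move=> e; have n4 : 4%:R != 0 :> F by rewrite (natrM _ 2 2) mulf_neq0.
apply: (mulIf n4); rewrite mul1r -[in RHS]e.
transitivity (x ^+ 2 - (y ^+ 2 + z ^+ 2) * (a ^+ 2 + b ^+ 2)); first by field; rewrite ?oppr_eq0 ?nz2 //.
by rewrite hab; ring.
Qed.

Lemma pv_SL x y z : x ^+ 2 + y ^+ 2 + z ^+ 2 = 4%:R -> pv x y z \in SLg F.
Proof. by move/det_pv; apply: gl_SL. Qed.

Lemma pv_traces x y z : x ^+ 2 + y ^+ 2 + z ^+ 2 = 4%:R ->
  [/\ trg (pv x y z) = 0, trg (pv x y z * qi)%g = - x, trg (pv x y z * qj)%g = - y &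
      trg (pv x y z * (qi * qj))%g = - z].
Proof.
move/det_pv=> e; rewrite /trg !entM !qE !(glE1 e).
split.
- by field; rewrite ?oppr_eq0 ?nz2 //.
- by field; rewrite ?oppr_eq0 ?nz2 //.
- apply: (eq_of_sub (congr1 (fun t => y * t) hab)); field; rewrite ?oppr_eq0 ?nz2 //.
- apply: (eq_of_sub (congr1 (fun t => z * t) hab)); field; rewrite ?oppr_eq0 ?nz2 //.
Qed.

Lemma pv_qi x y z : x ^+ 2 + y ^+ 2 + z ^+ 2 = 4%:R ->
  (pv x y z * qi = qi * pv x (- y) (- z))%g.
Proof.
move=> e; have e' : x ^+ 2 + (- y) ^+ 2 + (- z) ^+ 2 = 4%:R by rewrite !sqrrN.
by apply: glP; rewrite !entM !qE !(glE1 (det_pv e)) !(glE1 (det_pv e')); field; exact: nz2.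
Qed.

Lemma pv_qj x y z : x ^+ 2 + y ^+ 2 + z ^+ 2 = 4%:R ->
  (pv x y z * qj = qj * pv (- x) y (- z))%g.
Proof.
move=> e; have e' : (- x) ^+ 2 + y ^+ 2 + (- z) ^+ 2 = 4%:R by rewrite !sqrrN.
by apply: glP; rewrite !entM !qE !(glE1 (det_pv e)) !(glE1 (det_pv e')); field; exact: nz2.
Qed.

Lemma pv_mone x y z : x ^+ 2 + y ^+ 2 + z ^+ 2 = 4%:R ->
  (mone F * pv x y z = pv (- x) (- y) (- z))%g.
Proof.
move=> e; have e' : (- x) ^+ 2 + (- y) ^+ 2 + (- z) ^+ 2 = 4%:R by rewrite !sqrrN.
by apply: glP; rewrite entNg !(glE1 (det_pv e)) !(glE1 (det_pv e')); field; exact: nz2.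
Qed.

(** A traceless matrix is a pure quaternion. Since i, j and ij have square -1, its coordinates are
    minus the traces of its products with them, and determinant 1 means norm 4 after doubling. *)
Lemma traceless_pv g : g \in SLg F -> trg g = 0 ->
  let x := - trg (g * qi)%g in let y := - trg (g * qj)%g in
  let z := - trg (g * (qi * qj))%g in
  x ^+ 2 + y ^+ 2 + z ^+ 2 = 4%:R /\ g = pv x y z.
Proof.
move=> /SLgP dg tg x y z.
have e : x ^+ 2 + y ^+ 2 + z ^+ 2 = 4%:R.
  have n2 : ent g 1 1 = - ent g 0 0 by apply: (eq_of_sub tg); rewrite /trg; ring.
  move: dg; rewrite /detg n2 => dg.
  transitivity (4%:R * (ent g 0 0 * - ent g 0 0 - ent g 0 1 * ent g 1 0)); last by rewrite dg mulr1.
  by rewrite /x /y /z /trg !entM !qE n2; ring: hab.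
split=> //; have [p1 p2 p3 p4] := pv_traces e.
by apply: trace_ext; rewrite ?p1 ?p2 ?p3 ?p4 ?opprK.
Qed.

Lemma golden_sum (t : F) : t ^+ 2 = t + 1 -> 1 ^+ 2 + t ^+ 2 + (1 - t) ^+ 2 = 4%:R.
Proof. by move=> e; ring: e. Qed.

(* For t^2 = t + 1 it generates the binary icosahedral group together with the
   normalizer of the quaternion group. *)
Definition qs (t : F) : GLT F := pv 1 t (1 - t).

(** Up to the sign of the last coordinate the result is [qs (1 - t)]: conjugation by 1 + i exchanges
    the two roots. *)
Lemma qs_qc (t : F) : t ^+ 2 = t + 1 -> (qs t * qc = qc * pv 1%R (1 - t)%R (- t)%R)%g.
Proof.
move=> e; have es := golden_sum e.
have e' : 1 ^+ 2 + (1 - t) ^+ 2 + (- t) ^+ 2 = 4%:R by rewrite -es; ring.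
by apply: glP; rewrite !entM !qE !(glE1 (det_pv es)) !(glE1 (det_pv e')); field; exact: nz2.
Qed.

(** No element of an icosahedral Hall subgroup has this trace, so such a subgroup cannot contain the
    generators for both roots. *)
Lemma trg_qs_conj (t : F) : t ^+ 2 = t + 1 -> trg (qs t * qs (1 - t)%R)%g = 2%:R^-1.
Proof.
move=> e; have es := golden_sum e.
have e' : 1 ^+ 2 + (1 - t) ^+ 2 + (1 - (1 - t)) ^+ 2 = 4%:R by rewrite -es; ring.
rewrite /trg !entM !(glE1 (det_pv es)) !(glE1 (det_pv e')).
transitivity ((- 1 + t * (1 - t) * (a ^+ 2 + b ^+ 2) * 2%:R) / 2%:R); first by field; exact: nz2.
rewrite hab; field: e; exact: nz2.
Qed.

(** This is minus the conjugate i w i^-1, of order 6. By [qs_qu] it is inverted by [qs t], so [qs t]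
    normalizes the subgroup that it generates. *)
Definition qu : GLT F := (mone F * (qi * qw * (mone F * qi)))%g.

Lemma qs_qu (t : F) : t ^+ 2 = t + 1 -> (qu * qs t * qu = qs t)%g.
Proof.
move=> e; have es := golden_sum e.
rewrite /qu /qs -/mone; move: qiE (glE1 det_qw) (glE1 (det_pv es)) (entNg (F:=F)).
rewrite -/qw -/(pv 1 t (1 - t)); move: qi qw (pv _ _ _) (mone F) => x y z n.
move=> [[[x0 x1] x2] x3] [[[y0 y1] y2] y3] [[[z0 z1] z2] z3] en.
apply: glP; rewrite !(en, entM, x0, x1, x2, x3, y0, y1, y2, y3, z0, z1, z2, z3).
all: by field: hab e; exact: nz2.
Qed.

(** The relation s i s = -i s i brings s i s back into the double coset of s, as [double_coset_card]
    demands. *)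
Lemma qs_qi_qs (t : F) : t ^+ 2 = t + 1 -> (qs t * qi * qs t = mone F * (qi * qs t * qi))%g.
Proof.
move=> e; have es := golden_sum e.
rewrite /qs; move: qiE (glE1 (det_pv es)) (entNg (F:=F)).
rewrite -/(pv 1 t (1 - t)); move: qi (pv _ _ _) (mone F) => x z n.
move=> [[[x0 x1] x2] x3] [[[z0 z1] z2] z3] en.
apply: glP; rewrite !(en, entM, x0, x1, x2, x3, z0, z1, z2, z3).
all: by field: hab e; exact: nz2.
Qed.

Lemma trg_qs_qj (t : F) : t ^+ 2 = t + 1 -> trg (qs t * qj)%g = - t.
Proof. by move=> e; have [] := pv_traces (golden_sum e). Qed.

End Quaternions.

(** * Groups with an abelian subgroup of index at most 2 *)

Section AlmostAbelian.

(** Elements of odd order lie in every subgroup of index at most 2. Two noncommuting elements of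
    order 3 are the obstruction used throughout. *)
Lemma almost_abelian_commute (gT : finGroupType) (H : {group gT}) u v :
  almost_abelian H -> u \in H -> v \in H -> odd #[u] -> odd #[v] -> commute u v.
Proof.
case=> A [sAH abA lA] Hu Hv ou ov.
suff inA x : x \in H -> odd #[x] -> x \in A by apply: (centsP abA); apply: inA.
have [iA|iA] : #|H : A| = 1%N \/ #|H : A| = 2.
  have : (#|H : A| <= 2)%N by rewrite -(leq_pmul2l (cardG_gt0 A)) Lagrange // mulnC.
  by have := indexg_gt0 H A; case: #|H : A| => [|[|[|]]] //; [left | right].
  by move=> Hx _; have /eqP := iA; rewrite indexg_eq1 => /subsetP->.
have nAH : H \subset 'N(A) by apply: normal_norm; apply: index2_normal.
move=> Hx ox; apply: coset_idr; first exact: (subsetP nAH).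
apply/eqP; rewrite -order_eq1.
have d1 : #[coset A x] %| #[x] by apply: morph_order; apply: (subsetP nAH).
have d2 : #[coset A x] %| 2 by rewrite -iA -card_quotient // order_dvdG // mem_quotient.
move/dvdn_leq: (d2) => /(_ isT); have := order_gt0 (coset A x).
by case: #[_] d1 {d2} => [|[|[|]]] // d1 _ _; move/dvdn_odd: d1 => /(_ ox).
Qed.

Lemma almost_abelian_quotient (gT : finGroupType) (H Z : {group gT}) :
  Z \subset H -> H \subset 'N(Z) -> almost_abelian H -> almost_abelian (H / Z).
Proof.
move=> sZH nZH [A [sAH abA lA]]; exists (A / Z)%G; split.
- exact: quotientS.
- exact: quotient_abelian.
have nZA : A \subset 'N(Z) by apply: subset_trans nZH.
rewrite !card_quotient // -(leq_pmul2l (cardG_gt0 Z)) Lagrange //.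
apply: leq_trans lA _; rewrite -(LagrangeI A Z) [X in (_ <= X)%N]mulnCA leq_mul2l leq_mul2r.
by rewrite subset_leq_card ?orbT // subsetIr.
Qed.

Lemma almost_abelian_isog (gT rT : finGroupType) (H : {group gT}) (L : {group rT}) :
  H \isog L -> almost_abelian H -> almost_abelian L.
Proof.
case/isogP=> f injf e [A [sAH abA lA]]; exists (f @* A)%G; split.
- by rewrite -e morphimS.
- exact: morphim_abelian.
by rewrite -e !card_injm.
Qed.

(* In the quotient the two elements commute; if they did not commute already,
   conjugation would multiply one by an involution. *)
Lemma almost_abelian_quotient_isog (gT : finGroupType) (H L Z : {group gT}) u v :
  Z \subset H -> H \subset 'N(Z) -> L \subset 'C(Z) -> #|Z| = 2 ->
  H / Z \isog L / Z -> almost_abelian H ->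
  u \in L -> v \in L -> odd #[u] -> odd #[v] -> commute u v.
Proof.
move=> sZH nZH cLZ oZ iso aaH Lu Lv ou ov.
have aaL := almost_abelian_isog iso (almost_abelian_quotient sZH nZH aaH).
have nZL : L \subset 'N(Z) by apply: subset_trans cLZ (cent_sub Z).
have [Nu Nv] := (subsetP nZL _ Lu, subsetP nZL _ Lv).
have od x : x \in L -> odd #[x] -> odd #[coset Z x].
  by move=> Lx ox; apply: dvdn_odd ox; apply: morph_order; apply: (subsetP nZL).
have c : commute (coset Z u) (coset Z v).
  by apply: almost_abelian_commute aaL _ _ _ _; rewrite ?mem_quotient ?od.
have Zc : [~ u, v] \in Z.
  apply: coset_idr; first by rewrite groupR.
  by rewrite morphR //; apply/eqP/commgP.
have cZ x y : x \in L -> y \in Z -> commute x y.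
  by move=> Lx Zy; apply: (centP (subsetP cLZ _ Lx)).
have o1 : #[u ^ v] = #[u] by rewrite orderJ.
have e : u ^ v = u * [~ u, v] by rewrite commgEl mulKVg.
apply/commgP; rewrite -order_eq1.
have d2 : #[[~ u, v]] %| 2 by rewrite -oZ order_dvdG.
have : ([~ u, v] ^+ #[u] == 1).
  have := expg_order (u ^ v); rewrite o1 e expgMn; last exact: cZ.
  by rewrite expg_order mul1g => ->.
rewrite -order_dvdn => d1; move/dvdn_leq: (d2) => /(_ isT).
have := order_gt0 [~ u, v]; case: #[_] d1 {d2} => [|[|[|]]] // d1 _ _.
by move/dvdn_odd: d1 => /(_ ou).
Qed.

End AlmostAbelian.

(** * The quaternion group of order 8, given by relations *)

Section QuaternionGroup.

Variables (gT : finGroupType) (m i j : gT).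
Hypothesis om : #[m] = 2.
Hypotheses (i2 : i * i = m) (j2 : j * j = m) (ji : j * i = m * (i * j)).
Hypothesis cm : forall g, commute m g.

Definition Q8 : {group gT} := <<[set i; j]>>%G.

Let m2 : m * m = 1. Proof. by rewrite -expg2 -om expg_order. Qed.

Lemma Q8_mem : [/\ i \in Q8, j \in Q8 & m \in Q8].
Proof.
have Qi : i \in Q8 by rewrite mem_gen // !inE eqxx.
have Qj : j \in Q8 by rewrite mem_gen // !inE eqxx orbT.
by split; rewrite // -i2 groupM.
Qed.

Lemma Q8_noncommute : ~ commute i j.
Proof.
move=> c; have := ji; rewrite -c => /(congr1 (fun u => u * (i * j)^-1)).
by rewrite mulgV mulgK => e; move: om; rewrite -e order1.
Qed.

Lemma order_Q8_gen x : x * x = m -> #[x] = 4.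
Proof.
move=> x2; have o4 : x ^+ 4 = 1 by rewrite expg4E x2.
have x2n : x ^+ 2 != 1.
  by rewrite expg2 x2 -order_eq1 om.
have d4 : #[x] %| 4 by rewrite order_dvdn o4.
have n2 : ~~ (#[x] %| 2) by rewrite order_dvdn.
have l4 := dvdn_leq (isT : 0 < 4)%N d4; move: l4 (order_gt0 x) d4 n2.
by case: #[x] => [|[|[|[|[|]]]]].
Qed.

Lemma Q8_invJ : i ^ j = i^-1.
Proof.
have iV : i^-1 = m * i by apply: (mulgI i); rewrite mulgV cm mulgA i2 m2.
by rewrite iV conjgE; apply: (mulgI j); rewrite mulKVg mulgA -cm -mulgA ji !mulgA m2 mul1g.
Qed.

Lemma card_Q8 : #|Q8| = 8.
Proof.
have oi := order_Q8_gen i2; have oj := order_Q8_gen j2.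
have ni : j \in 'N(<[i]>).
  by apply/normP; rewrite -cycleJ Q8_invJ cycleV.
have EQ : Q8 :=: <[i]> * <[j]>.
  by rewrite -norm_joinEr ?cycle_subG // joing_idl joing_idr.
have := mul_cardG <[i]> <[j]>; rewrite -EQ -!orderE oi oj.
have I : <[i]> :&: <[j]> = <[m]>.
  apply/eqP; rewrite eq_sym eqEcard subsetI !cycle_subG -{1}i2 -{1}j2 !groupM ?cycle_id //=.
  rewrite -orderE om leqNgt; apply/negP=> l.
  have : #|<[i]> :&: <[j]>| %| 4 by rewrite -oi orderE cardSg ?subsetIl.
  move=> d; have o4 : #|<[i]> :&: <[j]>| = 4.
    by have := dvdn_leq (isT : 0 < 4)%N d; move: l d; case: #|_| => [|[|[|[|[|]]]]].
  have ij : j \in <[i]>.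
    rewrite -cycle_subG; apply/setIidPr/eqP.
    by rewrite eqEcard subsetIr o4 -orderE oj.
  apply: Q8_noncommute.
  by apply: (centsP (cycle_abelian i)); rewrite ?cycle_id.
rewrite I -orderE om; move: #|_| => n; lia.
Qed.

Lemma Q8_nonabelian : ~~ abelian Q8.
Proof.
apply/negP=> /centsP ab; apply: Q8_noncommute.
by have [Qi Qj _] := Q8_mem; apply: ab.
Qed.

Lemma Q8_norm w : i * w = w * j -> j * w = w * (i * j) -> w \in 'N(Q8).
Proof.
move=> iw jw; have [Qi Qj Qm] := Q8_mem.
have ei : i ^ w = j by rewrite conjgE iw mulKg.
have ej : j ^ w = i * j by rewrite conjgE jw mulKg.
apply/normP/eqP; rewrite eqEcard cardJg leqnn andbT -genJ gen_subG.
by apply/subsetP=> _ /imsetP[u + ->]; rewrite !inE => /orP[]/eqP->; rewrite ?ei ?ej ?groupM.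
Qed.

(* [w, i] lies in the 2-group Q8 and has odd order if w and w ^ i commute. *)
Lemma Q8_order3_noncommute w : i * w = w * j -> j * w = w * (i * j) ->
  odd #[w] -> ~ commute w (w ^ i).
Proof.
move=> iw jw ow c; have Nw := Q8_norm iw jw; have [Qi Qj Qm] := Q8_mem.
have Qc : [~ w, i] \in Q8.
  by rewrite commgEr groupM // memJ_norm ?groupV.
have e : [~ w, i] = w^-1 * w ^ i by rewrite commgEl.
have o1 : [~ w, i] ^+ #[w] = 1.
  rewrite e expgMn; last by apply: commuteV || apply/commute_sym/commuteV/commute_sym.
  by rewrite expgVn expg_order invg1 mul1g -(orderJ w i) expg_order.
have : [~ w, i] == 1.
  rewrite -order_eq1; have d1 : #[[~ w, i]] %| #[w] by rewrite order_dvdn o1.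
  have : coprime #[[~ w, i]] #[[~ w, i]].
    apply: coprime_dvdl d1 _; apply: coprime_dvdr (order_dvdG Qc) _.
    by rewrite card_Q8 (coprime_pexpr _ 2 (isT : 0 < 3)%N) coprime_sym prime_coprime // dvdn2 ow.
  by rewrite /coprime gcdnn.
move/commgP=> cwi; have : i = j by apply: (mulgI w); rewrite -iw cwi.
by move=> eij; apply: Q8_noncommute; rewrite eij.
Qed.

End QuaternionGroup.

Arguments Q8 : simpl never.

(** * Hall subgroups of SL_2 *)

Lemma muln_eq2 x y : 1 < x -> (x * y)%N = 2 -> y = 1%N.
Proof. by case: y => [|[|y]]; nia. Qed.

Section HallSubgroupsSL2.

Variables (F : finFieldType) (p : nat).
Hypothesis cp : p \in [pchar F]%R.
Hypothesis nz2 : (2%:R != 0 :> F)%R.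
Hypothesis nz3 : (3%:R != 0 :> F)%R.
Variables a b : F.
Hypothesis hab : (a ^+ 2 = -1 - b ^+ 2)%R.
Implicit Types (g h u : GLT F) (H : {group GLT F}).

Notation S := (SLg F).
Notation m := (mone F).
Notation i := (qi F).
Notation j := (qj a b).
Notation w := (qw a b).
Notation Q0 := (Q8 i j).

Let cm g : commute m g. Proof. exact: mone_central. Qed.

Lemma cent_mone (A : {set GLT F}) : A \subset 'C(<[m]>).
Proof.
by rewrite cent_cycle; apply/subsetP=> g _; apply/cent1P/commute_sym/cm.
Qed.

Lemma Q0_sub : Q0 \subset S.
Proof.
rewrite gen_subG; apply/subsetP=> g; rewrite !inE => /orP[]/eqP->.
  exact: qi_SL.
exact: qj_SL.
Qed.

Lemma card_Q0 : #|Q0| = 8.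
Proof. exact: card_Q8 (order_mone nz2) (qi2 F) (qj2 hab) (qji hab) cm. Qed.

Lemma Q0_nonabelian : ~~ abelian Q0.
Proof. exact: Q8_nonabelian (order_mone nz2) (qi2 F) (qji hab). Qed.

Lemma Q0_mem : [/\ i \in Q0, j \in Q0 & m \in Q0].
Proof. exact: Q8_mem (qi2 F). Qed.

Lemma center_SL : 'Z(S) = <[m]>.
Proof.
apply/setP=> g; apply/idP/idP=> [/centerP[Sg cg]|].
  rewrite -scalar_SL //; apply: (qij_centralizer nz2 hab).
    exact: cg (qi_SL F).
  exact: cg (qj_SL hab).
move=> Zg; apply/centerP; split; last first.
  by move=> h _; apply/commute_sym; apply: (centP (subsetP (cent_mone [set h]) h (set11 h)) g Zg).
by apply: (subsetP (_ : <[m]> \subset S)) => //; rewrite cycle_subG mone_SL.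
Qed.

Lemma order_w : #[w] = 3.
Proof.
apply: nt_prime_order => //; last exact: qw_neq1.
by rewrite (@expgS _ _ 2) expg2; apply: qw3.
Qed.

Notation NQ := ('N_S(Q0)%G).

Lemma w_NQ : w \in NQ.
Proof. by rewrite inE qw_SL // (Q8_norm (qi2 F) (qi_qw nz2 hab) (qj_qw nz2 hab)). Qed.

Lemma Q0_NQ : Q0 \subset NQ.
Proof. by rewrite subsetI Q0_sub normG. Qed.

Lemma cent_Q0 : 'C_S(Q0) \subset <[m]>.
Proof.
apply/subsetP=> g /setIP[Sg /centP cg]; have [Qi Qj _] := Q0_mem.
by rewrite -scalar_SL //; apply: (qij_centralizer nz2 hab); apply: cg.
Qed.

(** The order is a multiple of 8 and of 3, and it is at most 24 * 2 because only 1 and -1 centralize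
    the quaternion group in S. *)
Lemma card_NQ : #|NQ| = 24 \/ #|NQ| = 48.
Proof.
have l : (#|NQ| <= 48)%N.
  apply: leq_trans (card_normalizer_order8 S card_Q0 Q0_nonabelian) _.
  rewrite (@leq_mul 24 _ 24 2) // -(order_mone nz2) orderE.
  exact: subset_leq_card cent_Q0.
have d8 : 8 %| #|NQ| by rewrite -card_Q0 cardSg ?Q0_NQ.
have d3 : 3 %| #|NQ| by rewrite -order_w order_dvdG ?w_NQ.
have : 24 %| #|NQ| by rewrite (@Gauss_dvd 8 3) // d8.
have := cardG_gt0 NQ; move: l; move: #|_| => n l n0 /dvdnP[k E]; lia.
Qed.

Lemma almost_abelian_w H : almost_abelian H -> ~ (w \in H /\ w ^ i \in H).
Proof.
move=> aaH [Hw Hwi].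
apply: (Q8_order3_noncommute (order_mone nz2) (qi2 F) (qj2 hab) (qji hab) cm
  (qi_qw nz2 hab) (qj_qw nz2 hab)); first by rewrite order_w.
by apply: almost_abelian_commute aaH _ _ _ _; rewrite ?orderJ ?order_w.
Qed.

Lemma wi_NQ : w ^ i \in NQ.
Proof. by have [Qi _ _] := Q0_mem; rewrite groupJ ?w_NQ // (subsetP Q0_NQ). Qed.

Lemma card_SL_24 : 24 %| #|S|.
Proof.
have d : #|NQ| %| #|S| by rewrite cardSg ?subsetIl.
by apply: dvdn_trans d; case: card_NQ => ->.
Qed.

Section Hall.

Variable pi : nat_pred.
Hypotheses (pi2 : 2 \in pi) (pi3 : 3 \in pi) (p_pi : p \notin pi).

Lemma pi_group_p' H : pi.-group H -> ~~ (p %| #|H|).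
Proof.
move=> piH; apply: contra p_pi => d; have pp := pcharf_prime cp.
by apply: (pnatPpi piH); rewrite mem_primes pp cardG_gt0.
Qed.

Lemma mem_even_mone H : H \subset S -> 2 %| #|H| -> m \in H.
Proof.
move=> sHS d2; have [g Hg og] := Cauchy (isT : prime 2) d2.
have : g \in <[m]>.
  by apply: (involution_SL nz2 (subsetP sHS _ Hg)); rewrite -expg2 -og expg_order.
rewrite mem_cycle_mone // => /orP[]/eqP e; last by rewrite -e.
by move: og; rewrite e order1.
Qed.

Lemma dickson_hyp_pi H : H \subset S -> pi.-group H -> 2 %| #|H| ->
  dickson_hyp <[m]> H.
Proof.
move=> sHS piH d2; apply: (dickson_hyp_SL nz2 cp) => //; first exact: pi_group_p'.
exact: mem_even_mone.
Qed.

Lemma Hall_card_24 H : pi.-Hall(S) H -> 24 %| #|H|.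
Proof.
case/pHallP=> _ ->; rewrite -(part_pnat_id (_ : pi.-nat 24)).
  by apply: partn_dvd card_SL_24; apply: cardG_gt0.
apply/pnatP=> // r rp; rewrite (_ : 24 = 2 ^ 3 * 3)%N // Euclid_dvdM // Euclid_dvdX // andbT.
by rewrite !dvdn_prime2 // => /orP[]/eqP->.
Qed.

Lemma Hall_dickson H : pi.-Hall(S) H -> dickson_hyp <[m]> H.
Proof.
move=> hH; have [sHS piH _] := and3P hH; apply: dickson_hyp_pi => //.
by apply: dvdn_trans (Hall_card_24 hH).
Qed.

Lemma Hall_cases H : pi.-Hall(S) H -> almost_abelian H \/
  [\/ tetrahedral <[m]> H, octahedral <[m]> H | icosahedral <[m]> H].
Proof. by move=> hH; apply: dickson (Hall_dickson hH). Qed.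

End Hall.

Notation T := ('C_S[i]%G).
Notation D0 := ('N_S(<[i]>)%G).

(** Since j anticommutes with i, it turns x + y i into x - y i, the inverse when x^2 + y^2 = 1. *)
Lemma T_inv g : g \in T -> g ^ j = g^-1.
Proof.
move=> Tg; have := Tg; rewrite mem_torus => /and3P[/eqP e1 /eqP e2 _].
have /SLgP dg : g \in S by case/setIP: Tg.
apply: (mulgI j); rewrite conjgE mulKVg.
by apply: glP; rewrite !entM !entV dg !(glE1 (det_qj hab)) ?e1 ?e2 ?divr1; ring.
Qed.

Lemma i_T : i \in T.
Proof. by rewrite inE qi_SL cent1id. Qed.

Lemma order_i : #[i] = 4.
Proof. exact: order_Q8_gen (order_mone nz2) _ (qi2 F). Qed.

Lemma j_D0 : j \in D0.
Proof.
rewrite inE qj_SL //; apply/normP.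
by rewrite -cycleJ T_inv ?i_T // cycleV.
Qed.

Lemma D0_conj_i g : g \in D0 -> i ^ g = i \/ i ^ g = i^-1.
Proof.
case/setIP=> Sg /normP ng.
have ig : i ^ g \in <[i]>.
  by have : i ^ g \in <[i]> :^ g; [rewrite memJ_conjg cycle_id | rewrite ng].
have oig : (i ^ g) * (i ^ g) = m by rewrite -conjMg qi2 conjgE cm mulKg.
have m1 : m <> 1 by apply/eqP; apply: mone_neq1.
have i4 : i * (i * (i * i)) = 1 by rewrite mulgA qi2 mone2.
move: ig; rewrite cycle_traject order_i /= !mulg1 !inE => /or4P[]/eqP e.
- by case: m1; rewrite -oig e mulg1.
- by left.
- by case: m1; rewrite -oig e qi2 mone2.
- by right; apply: (mulgI i); rewrite mulgV e.
Qed.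

Lemma T_sub_D0 : T \subset D0.
Proof.
apply/subsetP=> g /setIP[Sg cg]; rewrite inE Sg; apply/normP; rewrite -cycleJ; congr <[_]>.
by apply/conjg_fixP/commgP; apply: commute_sym; apply/cent1P.
Qed.

Lemma D0_index : #|D0 : T| = 2.
Proof.
have -> : T :=: 'C_D0[i].
  apply/eqP; rewrite eqEsubset subsetI T_sub_D0 subsetIr /=.
  by rewrite setSI // subsetIl.
rewrite index_cent1; apply/eqP/cards2P; exists i, i^-1; split.
  apply/eqP=> e; have : i * i == 1 by rewrite {2}e mulgV.
  by rewrite qi2 (negPf (mone_neq1 nz2)).
apply/setP=> u; rewrite !inE; apply/imsetP/orP=> [[g /D0_conj_i[]-> ->]|[]/eqP->].
- by left.
- by right.
- by exists 1; rewrite ?group1 // conjg1.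
- by exists j; rewrite ?j_D0 // T_inv ?i_T.
Qed.

Lemma card_D0 : #|D0| = (2 * #|T|)%N.
Proof. by rewrite -(Lagrange T_sub_D0) D0_index mulnC. Qed.

Lemma D0_solvable : solvable D0.
Proof.
have nTD : T <| D0 by apply: index2_normal T_sub_D0 D0_index.
rewrite (series_sol nTD) abelian_sol ?cyclic_abelian ?torus_cyclic //.
apply: abelian_sol; apply: cyclic_abelian; apply: prime_cyclic.
by rewrite card_quotient ?normal_norm // D0_index.
Qed.

Lemma mone_T : m \in T.
Proof. by rewrite -qi2 groupM // i_T. Qed.

Lemma card_T4 : 4 %| #|T|.
Proof. by rewrite -order_i order_dvdG // i_T. Qed.

(** T is cyclic of index 2 and inverted by j, and j^2 = -1 disappears in the quotient. The images of
    a generator of T and of j thus satisfy the dihedral presentation, and the orders agree. *)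
Lemma D0_dihedral : D0 / <[m]> \isog 'D_#|T|.
Proof.
have /dvdnP[k ok] := card_T4.
have k0 : (0 < k)%N by have := cardG_gt0 T; rewrite ok; case: (k).
have eT : #|T| = (k * 2).*2 by rewrite ok -muln2 -mulnA.
have nD : D0 \subset 'N(<[m]>) by apply: subset_trans (cent_mone _) (cent_sub _).
have mD : <[m]> \subset D0 by rewrite cycle_subG (subsetP T_sub_D0) // mone_T.
have [g eg] := cyclicP (torus_cyclic nz2 : cyclic T).
have Tg : g \in T by rewrite eg cycle_id.
have q1 : (1 < k * 2)%N by lia.
rewrite eT; apply/(isoGrpP _ (Grp_dihedral q1)); split.
  rewrite card_dihedral // -eT card_quotient // -divgS // card_D0 -orderE (order_mone nz2).
  by rewrite mulKn.
have ND h : h \in D0 -> h \in 'N(<[m]>) by apply: (subsetP nD).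
have Dg : g \in D0 by apply: (subsetP T_sub_D0).
apply/existsP; exists (coset <[m]> g, coset <[m]> j) => /=.
have og : #[g] = (k * 2 * 2)%N by rewrite orderE -eg eT -muln2.
rewrite -!morphX ?ND ?j_D0 // -morphJ ?ND ?j_D0 // T_inv // morphV ?ND // !xpair_eqE eqxx andbT.
apply/and3P; split; last first.
- by apply/eqP/coset_id; rewrite expg2 qj2 // cycle_id.
- apply/eqP/coset_id; apply: (involution_SL nz2); first by apply: groupX; case/setIP: Tg.
  by rewrite -expgD addnn -muln2 -og expg_order.
have nTD : T <| D0 by apply: index2_normal T_sub_D0 D0_index.
have -> : <[coset <[m]> g]> <*> <[coset <[m]> j]> = (T <*> <[j]>) / <[m]>.
  rewrite quotientY ?cycle_subG ?ND ?j_D0 //; last by apply: subset_trans T_sub_D0 nD.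
  by rewrite -!quotient_cycle ?ND ?j_D0 //; congr (_ / _ <*> _); rewrite -eg.
suff -> : T <*> <[j]> = D0 by apply: eqxx.
apply/eqP; rewrite eqEsubset join_subG T_sub_D0 cycle_subG j_D0 /=.
have sTJ : T \subset T <*> <[j]> by apply: joing_subl.
have sJD : T <*> <[j]> \subset D0 by rewrite join_subG T_sub_D0 cycle_subG j_D0.
have nj : j \notin T.
  apply/negP=> /setIP[_ /cent1P cj]; apply: (qij_nocommute nz2 hab).
  exact: commute_sym cj.
have : (#|D0 : T <*> <[j]>| <= 1)%N.
  rewrite leqNgt; apply/negP=> l2.
  have := D0_index; rewrite -(Lagrange_index sJD sTJ) => e.
  have : #|T <*> <[j]> : T| = 1%N.
    exact: muln_eq2 l2 e.
  move/eqP; rewrite indexg_eq1 join_subG cycle_subG => /andP[_].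
  by rewrite (negPf nj).
have := indexg_gt0 D0 (T <*> <[j]>) => l0 l1.
by have := indexg_eq1 D0 (T <*> <[j]>); rewrite eqn_leq l1 l0 => /esym.
Qed.

End HallSubgroupsSL2.

(** The preimage in H of the rotations is abelian, being cyclic modulo the central subgroup Z. *)
Lemma dihedral_almost_abelian (gT rT : finGroupType) (H Z : {group gT}) (D : {group coset_of Z}) k :
  Z \subset H -> H \subset 'C(Z) -> H / Z \subset D -> D \isog 'D_(k.*2) -> 1 < k ->
  almost_abelian H.
Proof.
move=> sZH cZH sHD isoD k1.
have /(isoGrpP _ (Grp_dihedral k1))[_ /existsP[[x y] /=]] := isoD.
rewrite !xpair_eqE => /and4P[/eqP eD _ /eqP y2 /eqP xy].
have ny : y \in 'N(<[x]>) by apply/normP; rewrite -cycleJ xy cycleV.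
have lD : (#|D| <= 2 * #|<[x]>|)%N.
  rewrite -eD norm_joinEr ?cycle_subG // mulnC.
  apply: leq_trans (dvdn_leq _ (dvdn_cardMg _ _)) _ => /=; first by rewrite muln_gt0 !cardG_gt0.
  by rewrite leq_mul2l -orderE dvdn_leq ?orbT // order_dvdn y2.
have nZH : H \subset 'N(Z) by apply: subset_trans cZH (cent_sub _).
pose A := (H :&: coset Z @*^-1 <[x]>)%G.
have AZ : A / Z = H / Z :&: <[x]>.
  by rewrite /A /= quotientGI // cosetpreK.
have sZA : Z \subset A by rewrite subsetI sZH sub_cosetpre.
exists A; split; first exact: subsetIl.
  apply: (@cyclic_factor_abelian _ Z).
    rewrite subsetI sZA centsC; apply: subset_trans cZH; exact: subsetIl.
  by rewrite AZ; apply: cyclicS (cycle_cyclic x); apply: subsetIr.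
have nZA : A \subset 'N(Z) by apply: subset_trans nZH; apply: subsetIl.
have oA : #|A| = (#|Z| * #|A / Z|)%N by rewrite card_quotient // Lagrange.
have oH : #|H| = (#|Z| * #|H / Z|)%N by rewrite card_quotient // Lagrange.
rewrite oA oH mulnCA leq_mul2l; apply/orP; right.
rewrite -(leq_pmul2r (order_gt0 x)) orderE mul_cardG AZ.
rewrite -mulnA mulnCA mulnC leq_mul2l.
have sx : <[x]> \subset D by rewrite -eD joing_subl.
by apply/orP; right; apply: leq_trans lD; apply: subset_leq_card; apply: mul_subG.
Qed.

(** * Hall subgroups of type (a) *)

Section TypeA.

Variables (F : finFieldType) (p : nat).
Hypothesis cp : p \in [pchar F]%R.
Hypothesis nz2 : (2%:R != 0 :> F)%R.
Hypothesis nz3 : (3%:R != 0 :> F)%R.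
Variables a b : F.
Hypothesis hab : (a ^+ 2 = -1 - b ^+ 2)%R.
Variable pi : nat_pred.
Hypotheses (pi2 : 2 \in pi) (pi3 : 3 \in pi) (p_pi : p \notin pi).
Implicit Types (g h u : GLT F) (H : {group GLT F}).

Notation S := (SLg F).
Notation m := (mone F).
Notation i := (qi F).
Notation T := ('C_S[i]%G).
Notation D0 := ('N_S(<[i]>)%G).

Lemma sqr_mone_conj g : g \in S -> g * g = m -> exists2 u, u \in S & g ^ u = i.
Proof.
move=> Sg g2; have tg : trg g = 0%R by apply/eqP; rewrite trg0_sqr // g2.
have ng : ~~ scalarg g.
  rewrite scalar_SL // mem_cycle_mone //; apply/negP=> /orP[]/eqP e; move: g2; rewrite e.
    by rewrite mulg1 => /esym/eqP; rewrite (negPf (mone_neq1 nz2)).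
  by rewrite mone2 => /esym/eqP; rewrite (negPf (mone_neq1 nz2)).
apply: same_trace_conj => //; first exact: qi_SL.
- exact: scalar_companion.
- by rewrite tg expr0n /= eq_sym (natrM _ 2 2) mulf_neq0.
by rewrite tg /qi trg_companion.
Qed.

(** A subgroup of order 4 has an element g outside {1, -1}. Here g^4 = 1, so g^2 is 1 or -1, and g^2
    = 1 would put g into {1, -1}. *)
Lemma exists_sqrt_mone H : H \subset S -> 4 %| #|H| -> exists2 g, g \in H & g * g = m.
Proof.
move=> sHS d4; have [P sylP] := Sylow_exists 2 H.
have [sPH pP _] := and3P sylP.
have lP : (2 <= logn 2 #|P|)%N.
  by rewrite (card_Hall sylP) p_part pfactorK // -(pfactor_dvdn _ _ (cardG_gt0 H)).
have [B [sBP _ oB]] := normal_pgroup pP (normal_refl P) lP.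
have sBH := subset_trans sBP sPH; have sBS := subset_trans sBH sHS.
have [g Bg ng] : exists2 g, g \in B & g \notin <[m]>.
  apply/subsetPn; apply/negP=> /subset_leq_card.
  by rewrite oB -orderE (order_mone nz2).
have Sg := subsetP sBS _ Bg; exists g; first exact: (subsetP sBH).
have g4 : (g * g) * (g * g) = 1.
  by rewrite -expg4E; apply/eqP; rewrite -order_dvdn -[4]/(2 ^ 2)%N -oB order_dvdG.
have := involution_SL nz2 (SLgM Sg Sg) g4; rewrite mem_cycle_mone // => /orP[]/eqP // e.
by case/negP: ng; apply: (involution_SL nz2).
Qed.

(** As 4 divides the order of A, some conjugate of A contains i. It then lies in the cyclic group T,
    so the subgroup generated by i is characteristic in it and is normalized by the conjugate of
    H. *)
Lemma almost_abelian_sub_D0 H : H \subset S -> 24 %| #|H| -> almost_abelian H ->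
  exists2 u, u \in S & H :^ u \subset D0.
Proof.
move=> sHS d24 [A [sAH abA lA]].
have iA : (#|H : A| <= 2)%N by rewrite -(leq_pmul2l (cardG_gt0 A)) Lagrange // mulnC.
have [nAH d4] : H \subset 'N(A) /\ 4 %| #|A|.
  have := Lagrange sAH; have := indexg_gt0 H A; move: iA.
  case e: #|H : A| => [|[|[|]]] // _ _ oH; rewrite -oH in d24.
    move/eqP: e; rewrite indexg_eq1 => sHA; split; first exact: subset_trans sHA (normG _).
    by rewrite muln1 in d24; apply: dvdn_trans d24.
  split; first by apply: normal_norm; apply: index2_normal.
  by have : 12 * 2 %| #|A| * 2 by []; rewrite dvdn_pmul2r // => d; apply: dvdn_trans d.
have [g Ag g2] := exists_sqrt_mone (subset_trans sAH sHS) d4.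
have Sg : g \in S by rewrite (subsetP sHS) // (subsetP sAH).
have [u Su gu] := sqr_mone_conj Sg g2; exists u => //.
have Aui : i \in A :^ u by rewrite -gu memJ_conjg.
have sAT : A :^ u \subset T.
  rewrite subsetI -(conjGid Su) conjSg (subset_trans sAH sHS) sub_cent1.
  by apply: (subsetP (_ : abelian (A :^ u))) => //; rewrite abelianJ.
have cycA : cyclic (A :^ u) := cyclicS sAT (torus_cyclic nz2).
have ch : <[i]> \char (A :^ u)%G by rewrite sub_cyclic_char // cycle_subG.
rewrite subsetI -{1}(conjGid Su) conjSg sHS /=.
apply: subset_trans (char_norms ch); by rewrite normJ conjSg.
Qed.

Hypothesis oddF : odd #|F|.

Lemma Hall_sub_D0 H u : pi.-Hall(S) H -> u \in S -> H :^ u \subset D0 -> pi.-Hall(D0) (H :^ u).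
Proof.
move=> hH Su sHD; apply: (pHall_subl sHD (subsetIl _ _)).
by rewrite pHallJ.
Qed.

Lemma almost_abelian_type_a H : pi.-Hall(S) H -> almost_abelian H -> type_a pi #|F| S H.
Proof.
move=> hH aaH; rewrite /type_a hH /=; have [sHS _ _] := and3P hH.
have [u Su sHD] := almost_abelian_sub_D0 sHS (Hall_card_24 cp nz2 nz3 hab pi2 pi3 hH) aaH.
have Zn g : g \in S -> g \in 'N('Z(S)) by apply: (subsetP (normal_norm (center_normal S))).
have sD : D0 \subset 'N('Z(S)).
  apply: subset_trans (normal_norm (center_normal S)); exact: subsetIl.
apply/existsP; exists ((D0 :^ u^-1) / 'Z(S))%G; apply/and3P; split.
- by apply: quotientS; rewrite -(conjGid (groupVr Su)) conjSg subsetIl.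
- rewrite /= quotientJ ?Zn ?groupV //.
  apply: isog_trans (_ : _ \isog (D0 / 'Z(S))%G) _; first by rewrite isog_sym conj_isog.
  rewrite /= -(card_torus nz2 oddF) (center_SL nz2 hab).
  exact: (D0_dihedral cp nz2 nz3 hab).
apply: quotient_pHall.
  by apply: subset_trans sHS _; apply: normal_norm (center_normal S).
by have := pHallJ2 pi D0 (H :^ u)%G u^-1; rewrite Hall_sub_D0 //= conjsgK.
Qed.

Lemma type_a_almost_abelian H : type_a pi #|F| S H -> almost_abelian H.
Proof.
case/andP=> hH /existsP[D /and3P[sDG isoD hHD]].
have [sHS _ _] := and3P hH.
have [k ek] : exists k, q_sub_eps #|F| = k.*2 /\ (1 < k)%N.
  rewrite -(card_torus nz2 oddF); have /dvdnP[k ek] := card_T4 nz2.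
  exists (k * 2)%N; rewrite ek -muln2 -mulnA; split=> //.
  by have := cardG_gt0 T; rewrite ek; case: (k) => // n _; rewrite mulSn.
case: ek => ek k1; rewrite ek in isoD.
have dh := Hall_dickson cp nz2 nz3 hab pi2 pi3 p_pi hH; case: dh => sZH cZH _ _ _.
rewrite -(center_SL nz2 hab) in sZH cZH.
apply: (@dihedral_almost_abelian _ (GLT F) H 'Z(S)%G D k) => //.
by case/and3P: hHD.
Qed.

(** Conjugates of both subgroups are Hall subgroups of [D0], which is solvable, so the theorem of
    Hall applies there. *)
Lemma type_a_conjugate : all_conjugate S (type_a pi #|F| S).
Proof.
move=> H1 H2 t1 t2.
have [h1 h2] : pi.-Hall(S) H1 /\ pi.-Hall(S) H2 by case/andP: t1 => ->; case/andP: t2 => ->.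
have red H : pi.-Hall(S) H -> type_a pi #|F| S H -> exists2 u, u \in S & pi.-Hall(D0) (H :^ u).
  move=> hH /type_a_almost_abelian aaH; have [sHS _ _] := and3P hH.
  have [u Su sHD] := almost_abelian_sub_D0 sHS (Hall_card_24 cp nz2 nz3 hab pi2 pi3 hH) aaH.
  by exists u => //; apply: Hall_sub_D0.
have [u Su hu] := red _ h1 t1; have [v Sv hv] := red _ h2 t2.
have [x Dx E] := Hall_trans (D0_solvable nz2 hab) hv hu.
have Sx : x \in S by case/setIP: Dx.
exists (u * x * v^-1); first by rewrite !groupM ?groupV.
by rewrite !conjsgM -E /= conjsgK.
Qed.

End TypeA.

(** * Conjugacy classes of subgroups and their fusion *)

Section ConjugacyClasses.

Variables (gT : finGroupType) (G : {group gT}).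
Implicit Types (A X : {set gT}).

Lemma class_self A : A \in A :^: G.
Proof. by apply/imsetP; exists 1; rewrite ?conjsg1 ?group1. Qed.

Lemma class_conj A g : g \in G -> (A :^ g) :^: G = A :^: G.
Proof.
move=> Gg; apply/setP=> X; apply/imsetP/imsetP=> [[k Gk ->]|[k Gk ->]].
  by exists (g * k); rewrite ?groupM // conjsgM.
by exists (g^-1 * k); rewrite ?groupM ?groupV // conjsgM conjsgK.
Qed.

Lemma conjugates_eqP A X : reflect (exists2 g, g \in G & X = A :^ g) (A :^: G == X :^: G).
Proof.
apply: (iffP eqP) => [e|[g Gg ->]]; last by rewrite class_conj.
by have := class_self X; rewrite -e => /imsetP[g Gg ->]; exists g.
Qed.

Lemma class_norm A b : b \in 'N(G) -> [set X :^ b | X in A :^: G] = (A :^ b) :^: G.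
Proof.
move=> Nb; apply/setP=> X; apply/imsetP/imsetP=> [[_ /imsetP[g Gg ->] ->]|[g Gg ->]].
  by exists (g ^ b); rewrite ?memJ_norm // -!conjsgM -conjgC.
exists (A :^ (g ^ b^-1)); first by apply/imsetP; exists (g ^ b^-1); rewrite ?memJ_norm ?groupV.
by rewrite -!conjsgM conjgCV.
Qed.

(** The counterpart of [two_classes_swapped] in which the exchange is a conjugation inside the
    ambient group, later GL_2 over F. *)
Definition swapped_classes (P : pred {group gT}) :=
  exists C1 C2 : {set {set gT}}, [/\ C1 != C2, classes_of G P = [set C1; C2] &
    exists b, [set X :^ b | X in C1] = C2 /\ [set X :^ b | X in C2] = C1].

Lemma swapped_classesI (P : pred {group gT}) (X1 X2 : {group gT}) b :
  P X1 -> P X2 -> b \in 'N(G) ->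
  (forall H, P H -> exists2 u, u \in G & X1 :=: H :^ u \/ X2 :=: H :^ u) ->
  (forall g, g \in G -> X2 :!=: X1 :^ g) ->
  X2 :=: X1 :^ b -> (exists2 g, g \in G & X2 :^ b = X1 :^ g) -> swapped_classes P.
Proof.
move=> P1 P2 Nb cl nc e12 [g Gg e21].
exists (X1 :^: G), (X2 :^: G); split.
- by apply/conjugates_eqP=> -[h Gh /eqP]; rewrite (negPf (nc _ Gh)).
- apply/setP=> C; rewrite !inE; apply/imsetP/orP=> [[H]|].
    rewrite inE => /cl[u Gu [e|e] ->]; [left|right]; apply/conjugates_eqP;
      by exists u.
  by case=> /eqP->; [exists X1 | exists X2]; rewrite ?inE.
exists b; rewrite !class_norm // -e12; split=> //.
by rewrite e21 class_conj.
Qed.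

End ConjugacyClasses.

(** Two such subgroups would generate a normal Sylow 2-subgroup of order 16. It would contain every
    centralizer of order 8, but two of these meet in Z and have a product of 32 elements. *)
Lemma octahedral_normal8_unique (gT : finGroupType) (H Z Q1 Q2 : {group gT}) :
  dickson_hyp Z H -> octahedral Z H -> Q1 <| H -> Q2 <| H ->
  #|Q1| = 8 -> #|Q2| = 8 -> Q1 :=: Q2.
Proof.
move=> hyp [oH [_ _ ex]] nQ1 nQ2 o1 o2; apply/eqP; apply/negPn/negP=> neq.
have [_ _ oZ _ _] := hyp.
pose R := (Q1 <*> Q2)%G; have nR : R <| H by apply: normalY.
have p1 : 2.-group Q1 by rewrite /pgroup o1.
have p2 : 2.-group Q2 by rewrite /pgroup o2.
have n12 : Q2 \subset 'N(Q1) by apply: subset_trans (normal_sub nQ2) (normal_norm nQ1).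
have pR : 2.-group R by rewrite /R /= norm_joinEr // pgroupM p1.
have lR : (8 < #|R|)%N.
  rewrite -o1; apply: proper_card; rewrite properE joing_subl /=.
  apply: contra neq => sR; rewrite eq_sym eqEcard o1 o2 leqnn andbT.
  by apply: subset_trans (joing_subr _ _) sR.
have dR : #|R| %| 16.
  rewrite (_ : 16 = (#|H|`_2)%N); last by rewrite oH p_part.
  by rewrite -(part_pnat_id pR) partn_dvd // cardSg ?normal_sub.
have oR : #|R| = 16.
  have [k ok] := p_natP pR; move: lR dR.
  rewrite ok -[16]/(2 ^ 4)%N -[8]/(2 ^ 3)%N dvdn_Pexp2l // ltn_exp2l // => k3 k4.
  by congr (_ ^ _)%N; lia.
have hR : 2.-Hall(H) R by rewrite pHallE normal_sub // oR oH p_part.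
have := ex 8 16; rewrite !inE eqxx !orbT => /(_ isT)[x [Hx o8 oN]].
have o3 := card_class_cent1 oN; rewrite oH in o3.
have [g Hg ng] : exists2 g, g \in H & 'C_H[x] :^ g != 'C_H[x].
  have /subsetPn[X clX nX] : ~~ ('C_H[x] :^: H \subset [set 'C_H[x]]).
    apply/negP=> /subset_leq_card; rewrite cards1; move: o3; move: #|_| => k; lia.
  by case/imsetP: clX nX => g Hg ->; rewrite inE => nX; exists g.
rewrite cent1_conj // in ng.
have tI : 'C_H[x] :&: 'C_H[x ^ g] \subset Z.
  apply/subsetP=> u /setIP[u1 u2]; apply/negPn/negP=> nZu; case/eqP: ng.
  by apply: (cent1_class_trivI hyp _ _ u2 u1 nZu); rewrite ?(setD_conj hyp).
have og : #|'C_H[x ^ g]| = 8 by rewrite -cent1_conj // cardJg.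
have s1 : 'C_H[x] \subset R.
  by rewrite (sub_normal_Hall hR nR) ?subsetIl // /pgroup o8.
have s2 : 'C_H[x ^ g] \subset R.
  by rewrite (sub_normal_Hall hR nR) ?subsetIl // /pgroup og.
have := mul_cardG 'C_H[x] 'C_H[x ^ g]; rewrite /= o8 og.
have l1 : (#|('C_H[x] * 'C_H[x ^ g])%g| <= 16)%N.
  by rewrite -oR subset_leq_card // mul_subG.
have l2 : (#|'C_H[x] :&: 'C_H[x ^ g]| <= 2)%N by rewrite -oZ subset_leq_card.
by have := leq_mul l1 l2 => l E; rewrite -E in l.
Qed.

(* A noncyclic 2-group with one involution is generalized quaternion; of its
   three maximal subgroups one is cyclic. *)
Lemma order16_two_nonabelian (gT : finGroupType) (R X1 X2 X3 : {group gT}) (m : gT) :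
  #|R| = 16 -> (forall x, x \in R -> x * x = 1 -> x = 1 \/ x = m) ->
  X1 \subset R -> X2 \subset R -> X3 \subset R ->
  #|X1| = 8 -> #|X2| = 8 -> #|X3| = 8 ->
  ~~ abelian X1 -> ~~ abelian X2 -> ~~ abelian X3 -> X1 :!=: X2 ->
  X3 :=: X1 \/ X3 :=: X2.
Proof.
move=> oR inv s1 s2 s3 o1 o2 o3 n1 n2 n3 n12.
have pR : 2.-group R by rewrite /pgroup oR.
have R1 : R :!=: 1 by rewrite -cardG_gt1 oR.
have cR : ~~ cyclic R.
  by apply: contra n1 => /cyclic_abelian; apply: abelianS.
have oO : #|'Ohm_1(R)| = 2.
  have d2 : 2 %| #|R| by rewrite oR.
  have [z Rz oz] := Cauchy (isT : prime 2) d2.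
  rewrite -oz orderE; congr #|pred_of_set _|; rewrite (OhmE 1 pR).
  have ez : z = m.
    have z2 : z * z = 1 by rewrite -expg2 -oz expg_order.
    by have [e|//] := inv _ Rz z2; rewrite e order1 in oz.
  apply/eqP; rewrite eqEsubset cycle_subG mem_gen ?andbT; last first.
    by rewrite !inE Rz expn1 -oz expg_order eqxx.
  rewrite gen_subG; apply/subsetP=> u; rewrite !inE expn1 expg2 => /andP[Ru /eqP u2].
  by have [->|->] := inv _ Ru u2; rewrite ?group1 // ez cycle_id.
have /prime_Ohm1P := oO => /(_ pR R1); rewrite (negPf cR) /= => /eqP/quaternion_classP[n lt2n isoR].
have en : n = 4.
  have := card_isog isoR; rewrite oR card_quaternion // => e.
  by apply/eqP; rewrite -(@eqn_exp2l 2) // -e.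
have [[x y] genR _] := generators_quaternion lt2n isoR.
have [_ _ _ [_ mx] _] := quaternion_structure lt2n genR isoR.
have maxX (X : {group gT}) : X \subset R -> #|X| = 8 -> ~~ abelian X ->
    X :=: <<y ^: R>> \/ X :=: <<(x * y) ^: R>>.
  move=> sX oX nX; have : maximal X R.
    by apply: p_index_maximal => //; rewrite -divgS // oR oX.
  rewrite mx /= => /or3P[]/eqP e; [|by left|by right].
  by case/negP: nX; rewrite e cycle_abelian.
have [e1|e1] := maxX _ s1 o1 n1; have [e2|e2] := maxX _ s2 o2 n2;
  have [e3|e3] := maxX _ s3 o3 n3; rewrite ?e1 ?e2 ?e3; try (by left); try (by right);
  by move: n12; rewrite e1 e2 eqxx.
Qed.

(** * Hall subgroups of type (b), with preparations for type (c) *)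

Section TypesBC.

Variables (F : finFieldType) (p : nat).
Hypothesis cp : p \in [pchar F]%R.
Hypothesis nz2 : (2%:R != 0 :> F)%R.
Hypothesis nz3 : (3%:R != 0 :> F)%R.
Variables a b : F.
Hypothesis hab : (a ^+ 2 = -1 - b ^+ 2)%R.
Variable pi : nat_pred.
Hypotheses (pi2 : 2 \in pi) (pi3 : 3 \in pi) (p_pi : p \notin pi).
Implicit Types (g h u : GLT F) (H Q X : {group GLT F}).

Notation S := (SLg F).
Notation m := (mone F).
Notation i := (qi F).
Notation w := (qw a b).
Notation Q0 := (Q8 i (qj a b)).
Notation NQ := ('N_S(Q0)%G).

Let oQ0 : #|Q0| = 8. Proof. exact: card_Q0. Qed.
Let abQ0 : ~~ abelian Q0. Proof. exact: Q0_nonabelian. Qed.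
Let sQ0S : Q0 \subset S. Proof. exact: Q0_sub. Qed.
Let om : #[m] = 2. Proof. exact: order_mone. Qed.
Let zS : 'Z(S) = <[m]>. Proof. exact: center_SL nz2 _ _ hab. Qed.

Lemma center_sub_even H : H \subset S -> 2 %| #|H| -> <[m]> \subset H.
Proof. by move=> sHS d2; rewrite cycle_subG mem_even_mone. Qed.

Lemma Hall_part2 H : pi.-Hall(S) H -> (#|S|`_2 = #|H|`_2)%N.
Proof.
case/pHallP=> _ ->; rewrite partn_part // => r; rewrite inE => /eqP ->; exact: pi2.
Qed.

Lemma NQ_24 : (#|S|`_2 = 8)%N -> #|NQ| = 24.
Proof.
move=> o8; have [//|e] := card_NQ cp nz2 nz3 hab.
have : (48`_2 %| #|S|`_2)%N by rewrite -e partn_dvd // cardSg // subsetIl.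
by rewrite o8 p_part.
Qed.

(** The quaternion group has index 2 in a Sylow subgroup of order 16, which therefore normalizes it,
    and 16 does not divide 24. *)
Lemma NQ_48 : (#|S|`_2 = 16)%N -> #|NQ| = 48.
Proof.
move=> o16; have [e|//] := card_NQ cp nz2 nz3 hab.
have p0 : 2.-group Q0 by rewrite /pgroup oQ0.
have [R sylR sQR] := Sylow_superset sQ0S p0.
have [sRS _ _] := and3P sylR.
have oR : #|R| = 16 by rewrite (card_Hall sylR).
have nR : R \subset NQ.
  rewrite subsetI sRS; apply: normal_norm; apply: index2_normal => //.
  by rewrite -divgS // oR oQ0.
by have := cardSg nR; rewrite oR e.
Qed.

Lemma pi_group_24_48 X : #|X| = 24 \/ #|X| = 48 -> pi.-group X.
Proof.
move=> oX; apply/pgroupP=> r pr; case: oX => ->.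
  rewrite (_ : 24 = 2 ^ 3 * 3)%N // Euclid_dvdM // Euclid_dvdX // andbT.
  by rewrite !dvdn_prime2 // => /orP[]/eqP->.
rewrite (_ : 48 = 2 ^ 4 * 3)%N // Euclid_dvdM // Euclid_dvdX // andbT.
by rewrite !dvdn_prime2 // => /orP[]/eqP->.
Qed.

Lemma Hall_of_card X : X \subset S -> #|X| = (#|S|`_pi)%N -> pi.-Hall(S) X.
Proof. by move=> sXS oX; apply/pHallP. Qed.

(** Of H only the quotient is known. A group X with the same quotient that contains the noncommuting
    elements w and [w ^ i] takes over the contradiction. *)
Lemma Hall_not_almost_abelian H X rT (L : {group rT}) : pi.-Hall(S) H ->
  w \in X -> w ^ i \in X -> H / 'Z(S) \isog L -> X / 'Z(S) \isog L ->
  ~ almost_abelian H.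
Proof.
move=> hH Xw Xwi iH iX aaH; have [sHS _ _] := and3P hH.
have [sZH cHZ oZ _ _] := Hall_dickson cp nz2 nz3 hab pi2 pi3 p_pi hH.
rewrite -zS in sZH cHZ oZ.
apply: (Q8_order3_noncommute om (qi2 F) (qj2 hab) (qji hab) (@mone_central F)
  (qi_qw nz2 hab) (qj_qw nz2 hab)); first by rewrite (order_w nz2 nz3 hab).
apply: (@almost_abelian_quotient_isog _ H X 'Z(S)%G) => //.
- by apply: subset_trans cHZ (cent_sub _).
- by rewrite /= zS cent_mone.
- by apply: isog_trans iH _; rewrite isog_sym.
- by rewrite (order_w nz2 nz3 hab).
- by rewrite orderJ (order_w nz2 nz3 hab).
Qed.

Lemma card_quotient_center H : pi.-Hall(S) H -> #|H| = (2 * #|H / 'Z(S)|)%N.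
Proof.
move=> hH; have [sZH cHZ oZ _ _] := Hall_dickson cp nz2 nz3 hab pi2 pi3 p_pi hH.
rewrite -zS in sZH cHZ oZ; rewrite card_quotient; last exact: subset_trans cHZ (cent_sub _).
by rewrite -[in RHS]oZ Lagrange.
Qed.

Lemma NQ_not_almost_abelian : ~ almost_abelian NQ.
Proof.
move=> aa; apply: (almost_abelian_w nz2 nz3 hab aa); split.
  exact: w_NQ nz2 _ _ hab.
exact: wi_NQ nz2 _ _ hab.
Qed.

Lemma NQ_Hall24 : (#|S|`_pi = 24)%N -> [/\ #|NQ| = 24, pi.-Hall(S) NQ & tetrahedral <[m]> NQ].
Proof.
move=> o24; have o2 : (#|S|`_2 = 8)%N.
  have : ((#|S|`_pi)`_2 = #|S|`_2)%N.
    by rewrite partn_part // => r; rewrite inE => /eqP ->; exact: pi2.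
  by rewrite o24 p_part => <-.
have oN := NQ_24 o2; have hN : pi.-Hall(S) NQ by apply: Hall_of_card; rewrite ?subsetIl // oN o24.
split=> //; have [aa|] := Hall_cases cp nz2 nz3 hab pi2 pi3 p_pi hN.
  by case: NQ_not_almost_abelian.
by case=> // -[e _]; move: oN; rewrite e.
Qed.

Lemma card_Hall24 H : pi.-Hall(S) H -> #|H| = 24 -> (#|S|`_pi = 24)%N.
Proof. by case/pHallP=> _ ->. Qed.

Lemma tetrahedral_type_b H : pi.-Hall(S) H -> tetrahedral <[m]> H -> type_b pi S H.
Proof.
move=> hH tH; rewrite /type_b hH /= zS.
exact: tetrahedral_quotient (Hall_dickson cp nz2 nz3 hab pi2 pi3 p_pi hH) tH.
Qed.

Lemma type_b_tetra H : type_b pi S H -> tetrahedral <[m]> H.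
Proof.
case/andP=> hH iH; have oH : #|H| = 24.
  have lt4 : (1 < #|'I_4|)%N by rewrite card_ord.
  by rewrite card_quotient_center // (card_isog iH) card_Alt // card_ord.
have [oN hN tN] := NQ_Hall24 (card_Hall24 hH oH).
have /andP[_ iN] := tetrahedral_type_b hN tN.
have [aa|] := Hall_cases cp nz2 nz3 hab pi2 pi3 p_pi hH.
  case: (Hall_not_almost_abelian hH _ _ iH iN aa); [exact: w_NQ nz2 _ _ hab | exact: wi_NQ nz2 _ _ hab].
by case=> // -[e _]; move: oH; rewrite e.
Qed.

Lemma sylow2_order8_conj H : pi.-Hall(S) H -> (#|H|`_2 = 8)%N ->
  exists2 u, u \in S & Q0 \subset H :^ u.
Proof.
move=> hH o8; have [sHS _ _] := and3P hH.
have [P sylP] := Sylow_exists 2 H; have [sPH pP _] := and3P sylP.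
have oS : (#|S|`_2 = 8)%N by rewrite (Hall_part2 hH).
have sylP' : 2.-Sylow(S) P.
  by rewrite pHallE (subset_trans sPH sHS) (card_Hall sylP) oS o8.
have sylQ : 2.-Sylow(S) Q0 by rewrite pHallE sQ0S oQ0 oS.
have [u Su e] := Sylow_trans sylP' sylQ; exists u => //.
by rewrite e conjSg.
Qed.

(** The quaternion group is a Sylow 2-subgroup of S here, so a conjugate of H contains it. That
    conjugate normalizes it and has the order of [NQ]. *)
Lemma type_b_conj_NQ H : type_b pi S H -> exists2 u, u \in S & NQ :=: H :^ u.
Proof.
move=> bH; have tH := type_b_tetra bH; have /andP[hH _] := bH; have [oH _] := tH.
have [oN _ _] := NQ_Hall24 (card_Hall24 hH oH).
have o8 : (#|H|`_2 = 8)%N by rewrite oH p_part.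
have [u Su sQ] := sylow2_order8_conj hH o8; exists u => //.
have bHu : type_b pi S (H :^ u)%G.
  rewrite /type_b pHallJ // hH /=; case/andP: bH => _ iH.
  have Nu : u \in 'N('Z(S)) by apply: (subsetP (normal_norm (center_normal S))).
  rewrite quotientJ //; apply: isog_trans iH; by rewrite isog_sym conj_isog.
have tHu := type_b_tetra bHu; have /andP[hHu _] := bHu.
apply/esym/eqP; rewrite eqEcard cardJg oH oN leqnn andbT subsetI.
have [sHuS _ _] := and3P hHu; rewrite sHuS /=.
apply: (tetrahedral_normal (Hall_dickson cp nz2 nz3 hab pi2 pi3 p_pi hHu)) => //.
by apply: center_sub_even; rewrite ?oQ0.
Qed.

Lemma type_b_conjugate : all_conjugate S (type_b pi S).
Proof.
move=> H1 H2 /type_b_conj_NQ[u Su e1] /type_b_conj_NQ[v Sv e2].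
exists (u * v^-1); first by rewrite groupM ?groupV.
by rewrite conjsgM -e1 e2 conjsgK.
Qed.

End TypesBC.

(** * Hall subgroups of type (c) *)

Section TypeC.

Variables (F : finFieldType) (p : nat).
Hypothesis cp : p \in [pchar F]%R.
Hypothesis nz2 : (2%:R != 0 :> F)%R.
Hypothesis nz3 : (3%:R != 0 :> F)%R.
Variables a b : F.
Hypothesis hab : (a ^+ 2 = -1 - b ^+ 2)%R.
Variable pi : nat_pred.
Hypotheses (pi2 : 2 \in pi) (pi3 : 3 \in pi) (p_pi : p \notin pi).
Implicit Types (g h u : GLT F) (H Q X : {group GLT F}).

Notation S := (SLg F).
Notation m := (mone F).
Notation i := (qi F).
Notation Q0 := (Q8 i (qj a b)).
Notation NQ := ('N_S(Q0)%G).

Let oQ0 : #|Q0| = 8. Proof. exact: card_Q0. Qed.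
Let abQ0 : ~~ abelian Q0. Proof. exact: Q0_nonabelian. Qed.
Let sQ0S : Q0 \subset S. Proof. exact: Q0_sub. Qed.
Let om : #[m] = 2. Proof. exact: order_mone. Qed.
Let zS : 'Z(S) = <[m]>. Proof. exact: center_SL nz2 _ _ hab. Qed.
Let dickH H : pi.-Hall(S) H -> dickson_hyp <[m]> H.
Proof. exact: (Hall_dickson cp nz2 nz3 hab). Qed.

Lemma cent_nonabelian Q : Q \subset S -> ~~ abelian Q -> 'C_S(Q) \subset <[m]>.
Proof.
move=> sQS nab; apply/subsetP=> u /setIP[Su /centP cu].
rewrite -scalar_SL //; apply/negPn/negP=> nu; case/negP: nab.
by apply/centsP=> x Qx y Qy; apply: commute_nonscalar nu _ _; apply: cu.
Qed.

Lemma card_norm_nonabelian8 Q : Q \subset S -> #|Q| = 8 -> ~~ abelian Q ->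
  (#|'N_S(Q)| <= 48)%N.
Proof.
move=> sQS oQ nab; apply: leq_trans (card_normalizer_order8 S oQ nab) _.
rewrite (@leq_mul 24 _ 24 2) // -om orderE.
exact: subset_leq_card (cent_nonabelian sQS nab).
Qed.

(** In GL_2 the normalizer has at most 24 times as many elements as the centralizer Y, which
    consists of scalars. The product of Y and [NQ], which meet in {1, -1}, already has that many; so
    each n is a scalar times an element of determinant 1. *)
Lemma norm_Q0_det n : #|NQ| = 48 -> n \in 'N(Q0) -> exists e, detg n = (e ^+ 2)%R.
Proof.
move=> o48 Nn; pose Y := 'C(Q0)%G.
have l := card_normalizer_order8 [set: GLT F]%G oQ0 abQ0; rewrite !setTI in l.
have sYN : Y * NQ \subset 'N(Q0) by rewrite mul_subG ?cent_sub ?subsetIr.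
have eN : Y * NQ = 'N(Q0).
  apply/eqP; rewrite eqEcard sYN; apply: leq_trans l _.
  have sI : Y :&: NQ \subset <[m]>.
    by apply: subset_trans (cent_nonabelian sQ0S abQ0); rewrite setIC setSI ?subsetIl.
  have lI := subset_leq_card sI; rewrite -orderE om in lI.
  have := mul_cardG Y NQ; rewrite o48 => E.
  have := leq_mul (leqnn #|Y * NQ|) lI; rewrite -E; move: #|_| #|_| => x y; lia.
move: Nn; rewrite -eN => /mulsgP[y g Yy /setIP[/SLgP dg _] ->].
exists (ent y 0 0)%R; rewrite detgM dg mulr1.
have [Qi Qj _] := Q0_mem a b; have cy := centP Yy.
have /and3P[/eqP y01 /eqP y10 /eqP yd] : scalarg y.
  by apply: (qij_centralizer nz2 hab); apply: cy.
by rewrite /detg y01 y10 -yd mulr0 subr0.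
Qed.

Lemma NQ_Hall48 : (#|S|`_pi = 48)%N -> [/\ #|NQ| = 48, pi.-Hall(S) NQ & octahedral <[m]> NQ].
Proof.
move=> o48; have o2 : (#|S|`_2 = 16)%N.
  have : ((#|S|`_pi)`_2 = #|S|`_2)%N.
    by rewrite partn_part // => r; rewrite inE => /eqP ->; exact: pi2.
  by rewrite o48 p_part => <-.
have oN := NQ_48 cp nz2 nz3 hab o2.
have hN : pi.-Hall(S) NQ by apply/pHallP; rewrite subsetIl oN o48.
split=> //; have [aa|] := Hall_cases cp nz2 nz3 hab pi2 pi3 p_pi hN.
  by case: (NQ_not_almost_abelian nz2 nz3 hab).
by case=> // -[e _]; move: oN; rewrite e.
Qed.

Lemma octahedral_type_c H : pi.-Hall(S) H -> octahedral <[m]> H -> type_c pi S H.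
Proof.
by move=> hH tH; rewrite /type_c hH /= zS; apply: octahedral_quotient (dickH hH) tH.
Qed.

Lemma type_c_octahedral H : type_c pi S H -> octahedral <[m]> H.
Proof.
case/andP=> hH iH; have oH : #|H| = 48.
  rewrite (card_quotient_center cp nz2 nz3 hab pi2 pi3 p_pi hH) (card_isog iH).
  by rewrite card_Sym card_ord.
have o48 : (#|S|`_pi = 48)%N by case/pHallP: hH => _ <-.
have [oN hN tN] := NQ_Hall48 o48.
have /andP[_ iN] := octahedral_type_c hN tN.
have [aa|] := Hall_cases cp nz2 nz3 hab pi2 pi3 p_pi hH.
  case: (Hall_not_almost_abelian cp nz2 nz3 hab pi2 pi3 p_pi hH _ _ iH iN aa).
    exact: w_NQ nz2 _ _ hab.
  exact: wi_NQ nz2 _ _ hab.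
by case=> // -[e _]; move: oH; rewrite e.
Qed.

Lemma type_c_norm H : type_c pi S H -> exists Q : {group GLT F},
  [/\ Q \subset S, #|Q| = 8, ~~ abelian Q & H :=: 'N_S(Q)].
Proof.
move=> cH; have oH := type_c_octahedral cH; have /andP[hH _] := cH.
have [sHS _ _] := and3P hH.
have [Q [nQ oQ nab sZQ]] := octahedral_normal_order8 (dickH hH) oH.
have sQS := subset_trans (normal_sub nQ) sHS.
exists Q; split=> //; apply/eqP; rewrite eqEcard subsetI sHS normal_norm //=.
by case: oH => -> _; apply: card_norm_nonabelian8.
Qed.

Lemma type_c_conj H g : type_c pi S H -> type_c pi S (H :^ g)%G.
Proof.
case/andP=> hH iH; have Ng := SLg_norm g.
rewrite /type_c pHallJnorm // hH /=.
have Nz : g \in 'N('Z(S)) by apply: (subsetP (char_norms (center_char S))).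
by rewrite quotientJ //; apply: isog_trans iH; rewrite isog_sym conj_isog.
Qed.

Lemma type_c_swapped : (#|S|`_pi = 48)%N -> swapped_classes S (type_c pi S).
Proof.
move=> o48; have [oN hN tN] := NQ_Hall48 o48.
have cN := octahedral_type_c hN tN.
have [d [d0 nsq]] := exists_nonsquare nz2.
have D : (d * 1 - 0 * 0 != 0)%R by rewrite mulr1 mul0r subr0.
(* No product of [b0] with an element of S normalizes the quaternion group, because its determinant
   d is not a square. *)
pose b0 : GLT F := gl d 0%R 0%R 1%R.
have db0 : detg b0 = d by rewrite detg_gl // mulr1 mul0r subr0.
have nN u : u \in S -> b0 * u \notin 'N(Q0).
  move=> /SLgP du; apply/negP=> /(norm_Q0_det oN)[e].
  by rewrite detgM du mulr1 db0 => /eqP; rewrite (negPf (nsq e)).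
have normS (X : {group GLT F}) g : 'N_S(X) :^ g = 'N_S(X :^ g).
  by rewrite conjIg normJ; have /normP -> := SLg_norm g.
have nQb u v : u \in S -> v \in S -> (Q0 :^ b0) :^ u != Q0 :^ v.
  move=> Su Sv; have Suv : u * v^-1 \in S by rewrite groupM ?groupV.
  apply: contra (nN _ Suv) => /eqP e; apply/normP.
  by rewrite mulgA !conjsgM e conjsgK.
apply: (@swapped_classesI _ _ _ NQ (NQ :^ b0)%G b0) => //.
- exact: type_c_conj.
- exact: SLg_norm.
(* H is the normalizer of a nonabelian Q of order 8. After conjugation into a Sylow subgroup of
   order 16, Q is one of its only two nonabelian subgroups of order 8, conjugates of [Q0] and of
   [Q0 :^ b0]. *)
- move=> H cH; have [Q [sQS oQ nab eH]] := type_c_norm cH.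
  have [R sylR] := Sylow_exists 2 S; have [sRS _ _] := and3P sylR.
  have oR : #|R| = 16.
    have : ((#|S|`_pi)`_2 = #|S|`_2)%N.
      by rewrite partn_part // => r; rewrite inE => /eqP ->; exact: pi2.
    by rewrite (card_Hall sylR) o48 => <-; rewrite p_part.
  have inR X : X \subset S -> #|X| = 8 -> exists2 u, u \in S & X :^ u \subset R.
    move=> sXS oX; have pX : 2.-group X by rewrite /pgroup oX.
    have [u Su sX] := Sylow_subJ sylR sXS pX; exists u^-1; first by rewrite groupV.
    by rewrite -(conjsgK u R) conjSg.
  have sQbS : Q0 :^ b0 \subset S.
    by have /normP <- := SLg_norm b0; rewrite conjSg.
  have [u1 Su1 s1] := inR _ sQS oQ; have [u2 Su2 s2] := inR _ sQ0S oQ0.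
  have [u3 Su3 s3] := inR (Q0 :^ b0)%G sQbS (etrans (cardJg _ _) oQ0).
  have inv x : x \in R -> x * x = 1 -> x = 1 \/ x = m.
    move=> Rx /(involution_SL nz2 (subsetP sRS _ Rx)).
    by rewrite mem_cycle_mone // => /orP[]/eqP; [left|right].
  have n23 : (Q0 :^ u2)%G :!=: ((Q0 :^ b0) :^ u3)%G by rewrite eq_sym nQb.
  have [e|e] := order16_two_nonabelian oR inv s2 s3 s1 (etrans (cardJg _ _) oQ0)
    (etrans (cardJg _ _) (etrans (cardJg _ _) oQ0)) (etrans (cardJg _ _) oQ)
    (etrans (congr1 negb (abelianJ _ _)) abQ0)
    (etrans (congr1 negb (etrans (abelianJ _ _) (abelianJ _ _))) abQ0)
    (etrans (congr1 negb (abelianJ _ _)) nab) n23; rewrite /= in e.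
    exists (u1 * u2^-1); first by rewrite groupM ?groupV.
    by left; rewrite eH conjsgM normS e -normS conjsgK.
  exists (u1 * u3^-1); first by rewrite groupM ?groupV.
  by right; rewrite eH conjsgM normS e -normS conjsgK /= normS.
(* If the normalizers were conjugate by g, then [Q0 :^ b0] and [Q0 :^ g] would be normal of order 8
   in the same octahedral group, hence equal. *)
- move=> g Sg; apply/negP=> /eqP e; case/negP: (nQb 1 g (group1 _) Sg); rewrite conjsg1.
  have cX : type_c pi S (NQ :^ g)%G by apply: type_c_conj.
  have /andP[hX _] := cX.
  apply/eqP; apply: (octahedral_normal8_unique (dickH hX) (type_c_octahedral cX)
    (Q1 := (Q0 :^ b0)%G) (Q2 := (Q0 :^ g)%G)); rewrite ?cardJg //=.
    by rewrite -e normalJ normalSG.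
  by rewrite normalJ normalSG.
have Ds : (d * d^-1 - 0 * 0 = 1)%R by rewrite divff // mul0r subr0.
have Dy : (d * d - 0 * 0 != 0)%R by rewrite mul0r subr0 mulf_neq0.
exists (gl d 0%R 0%R (d^-1)%R); first exact: gl_SL Ds.
(* The square of [b0] is a scalar times an element of S, so [b0] also leads back from the second
   class to the first. *)
have ey : b0 * b0 = gl d 0%R 0%R d * gl d 0%R 0%R (d^-1)%R.
  by apply: glP; rewrite !entM !(glE D) !(glE Dy) !(glE1 Ds); field.
have sy : scalarg (gl d 0%R 0%R d) by rewrite /scalarg !(glE Dy) !eqxx.
rewrite /= -conjsgM ey conjsgM; congr (_ :^ _).
by apply/normP; apply: (subsetP (cent_sub _)); apply/centP=> g _; apply: scalarg_commute.
Qed.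

End TypeC.

(** * Icosahedral Hall subgroups *)

Lemma gen_sub_closed (gT : finGroupType) (A M : {set gT}) :
  1 \in M -> (forall g c, g \in M -> c \in A -> g * c \in M) -> <<A>> \subset M.
Proof.
move=> M1 MA; apply/subsetP=> _ /gen_prodgP[n [c Ac ->]].
elim: n c Ac => [|n IH] c Ac; first by rewrite big_ord0.
by rewrite big_ord_recr /=; apply: MA => //; apply: IH => k; apply: Ac.
Qed.

(* T and the double coset of s form a group once s x s lies in the double coset. *)
Lemma double_coset_card (gT : finGroupType) (T U : {group gT}) (s x : gT) :
  U \subset T -> s * s \in T -> s \in 'N(U) ->
  (forall g, g \in T -> g \in U \/ exists u v, [/\ u \in U, v \in U & g = u * x * v]) ->
  (exists g h, [/\ g \in T, h \in T & s * x * s = g * s * h]) ->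
  (#|<<s |: T>>| * #|U| <= #|T| * #|U| + #|T| * #|T|)%N.
Proof.
move=> sUT Tss Ns dT [g0 [h0 [Tg0 Th0 E]]].
pose D := [set g * s * h | g in T, h in T].
have DP g h : g \in T -> h \in T -> g * s * h \in D by move=> Tg Th; apply/imset2P; exists g h.
have Us u : u \in U -> s * u = u ^ s^-1 * s /\ u ^ s^-1 \in U.
  move=> Uu; split; first by rewrite -conjgCV.
  by rewrite memJ_norm ?groupV.
have sM : <<s |: T>> \subset T :|: D.
  apply: gen_sub_closed => [|g c]; first by rewrite inE group1.
  rewrite !inE => /orP[Tg|/imset2P[g1 h1 Tg1 Th1 ->]] /predU1P[->|Tc].
  - by rewrite -[g * s]mulg1 DP ?orbT.
  - by rewrite groupM.
  (* For the middle factor in U, s moves past it and s^2 lies in T. For a middle factor u x v, s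
     moves past u and v, and s x s is rewritten by [E]. *)
  - have [Uh|[u [v [Uu Uv eh]]]] := dT _ Th1.
      have [e Uh'] := Us _ Uh; rewrite -!mulgA (mulgA s) e.
      apply/orP; left; apply: groupM => //; rewrite -mulgA; apply: groupM => //.
      exact: (subsetP sUT).
    apply/orP; right; have [eu Uu'] := Us _ Uu.
    have ev : v * s = s * v ^ s by rewrite conjgC.
    have Uv' : v ^ s \in U by rewrite memJ_norm.
    have -> : g1 * s * h1 * s = (g1 * u ^ s^-1 * g0) * s * (h0 * v ^ s).
      have Ex y : s * (x * (s * y)) = g0 * (s * (h0 * y)) by rewrite !mulgA E.
      by rewrite eh -!mulgA ev (mulgA s u) eu -!mulgA Ex.
    have [Tu Tv] := (subsetP sUT _ Uu', subsetP sUT _ Uv').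
    by apply: DP; rewrite ?(groupM _ Tv) ?(groupM _ Tg0) ?(groupM _ Tu).
  - by apply/orP; right; rewrite -mulgA DP ?groupM.
(* The double coset is a translate of a product of two subgroups of order |T| whose intersection
   contains U, so it has at most |T|^2 / |U| elements. *)
have sD : D \subset (T * (T :^ s^-1)) :* s.
  apply/subsetP=> _ /imset2P[g h Tg Th ->].
  rewrite mem_rcoset -!mulgA; apply/mulsgP; exists g (h ^ s^-1) => //; first by rewrite memJ_conjg.
  by rewrite conjgE invgK.
have lD : (#|D| * #|U| <= #|T| * #|T|)%N.
  have := mul_cardG T (T :^ s^-1); rewrite cardJg => ->.
  apply: leq_mul; first by apply: leq_trans (subset_leq_card sD) _; rewrite card_rcoset.
  by rewrite subset_leq_card // subsetI sUT -{1}(normP (groupVr Ns)) conjSg.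
apply: leq_trans (leq_mul (subset_leq_card sM) (leqnn _)) _.
apply: (@leq_trans ((#|T| + #|D|) * #|U|)%N).
  by rewrite leq_mul2r leq_card_setU orbT.
by rewrite mulnDl leq_add2l.
Qed.

(** U and U x U are disjoint, and U x U has at least |U|^2 / |Z| elements; by the bound on |T|
    nothing else is left. *)
Lemma double_coset_cover (gT : finGroupType) (T U Z : {group gT}) x :
  U \subset T -> x \in T -> x \notin U -> U :&: U :^ x^-1 \subset Z ->
  (#|T| * #|Z| <= #|U| * #|Z| + #|U| * #|U|)%N ->
  forall g, g \in T -> g \in U \/ exists u v, [/\ u \in U, v \in U & g = u * x * v].
Proof.
move=> sUT Tx nUx sI lT.
pose D := (U * (U :^ x^-1)) :* x.
have UD : [disjoint U & D].
  apply/pred0P=> g /=; apply/negbTE/andP=> -[Ug].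
  case/rcosetP=> _ /mulsgP[u _ Uu /imsetP[v Uv ->] ->] eg.
  case/negP: nUx; rewrite -(groupMl _ Uu) -(groupMr _ Uv).
  by move: Ug; rewrite eg conjgE invgK -!mulgA mulVg mulg1 mulgA.
have sT : U :|: D \subset T.
  rewrite subUset sUT /=.
  apply/subsetP=> _ /rcosetP[_ /mulsgP[u _ Uu /imsetP[v Uv ->] ->] ->].
  by rewrite !groupM // ?groupJ ?groupV // (subsetP sUT).
have eT : U :|: D = T.
  apply/eqP; rewrite eqEcard sT -(leq_pmul2r (cardG_gt0 Z)).
  apply: leq_trans lT _; rewrite cardsU (eqP (_ : #|U :&: D| == 0)); last first.
    by rewrite cards_eq0 -setI_eq0 in UD *.
  rewrite subn0 mulnDl leq_add2l card_rcoset.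
  have := mul_cardG U (U :^ x^-1); rewrite cardJg => ->.
  by rewrite leq_mul2l subset_leq_card ?orbT.
move=> g; rewrite -eT => /setUP[|/rcosetP[_ /mulsgP[u _ Uu /imsetP[v Uv ->] ->] ->]].
  by left.
right.
by exists u, v; split=> //; rewrite conjgE invgK -!mulgA mulVg mulg1.
Qed.

Lemma commuteJ (gT : finGroupType) (z x y : gT) : commute x y -> commute (x ^ z) (y ^ z).
Proof. by rewrite /commute -!conjMg => ->. Qed.

Lemma inverted_conjV (gT : finGroupType) (u s : gT) : u * s * u = s -> u ^ s^-1 = u^-1.
Proof. by move=> e; apply: (mulgI u); rewrite conjgE invgK mulgV !mulgA e mulgV. Qed.

Lemma conjgV_eq (gT : finGroupType) (x y z : gT) : x^-1 = z -> y ^ x^-1 = x * y * z.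
Proof. by move=> <-; rewrite conjgE invgK mulgA. Qed.

Lemma card_120 n : (n * 6 <= 24 * 6 + 24 * 24)%N -> 0 < n -> 24 * 5 %| n -> n = 120.
Proof. by move=> l n0 /dvdnP[k]; lia. Qed.

(** * Construction of a subgroup of order 120 *)

Section TypeD.

Variable F : finFieldType.
Hypothesis nz2 : (2%:R != 0 :> F)%R.
Hypothesis nz3 : (3%:R != 0 :> F)%R.
Hypothesis nz5 : (5%:R != 0 :> F)%R.
Variables a b : F.
Hypothesis hab : (a ^+ 2 = -1 - b ^+ 2)%R.
Implicit Types (g h u : GLT F) (H Q X : {group GLT F}) (t : F).

Notation S := (SLg F).
Notation m := (mone F).
Notation i := (qi F).
Notation j := (qj a b).
Notation w := (qw a b).
Notation Q0 := (Q8 i j).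
Notation NQ := ('N_S(Q0)%G).
Notation s := (qs a b).
Notation us := (qu a b).

Let om : #[m] = 2. Proof. exact: order_mone. Qed.
Let cm g : commute m g. Proof. exact: mone_central. Qed.
Let m2 : m * m = 1. Proof. exact: mone2. Qed.

Lemma golden_conj t : (t ^+ 2 = t + 1)%R -> ((1 - t) ^+ 2 = (1 - t) + 1)%R.
Proof. by move=> e; ring: e. Qed.

Lemma qs_SL t : (t ^+ 2 = t + 1)%R -> s t \in S.
Proof. by move=> e; apply: pv_SL => //; apply: golden_sum. Qed.

Lemma qs2 t : (t ^+ 2 = t + 1)%R -> s t * s t = m.
Proof.
move=> e; apply/eqP; rewrite -trg0_sqr ?qs_SL //; apply/eqP.
by have [] := pv_traces nz2 hab (golden_sum e).
Qed.

Definition icosa t : {group GLT F} := <<s t |: NQ>>%G.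

Lemma NQ_icosa t : NQ \subset icosa t.
Proof. by apply: sub_gen; apply: subsetUr. Qed.

Lemma qs_icosa t : s t \in icosa t.
Proof. by apply: mem_gen; apply: setU11. Qed.

Lemma i_inv : i^-1 = m * i.
Proof. by apply: (mulgI i); rewrite mulgV cm mulgA qi2 m2. Qed.

Lemma qu_conj : us = m * w ^ i^-1.
Proof. by rewrite /qu (conjgV_eq w i_inv). Qed.

Lemma order_qu : #[us] = 6.
Proof.
rewrite qu_conj orderM ?orderJ ?om ?(order_w nz2 nz3 hab) //.
Qed.

Lemma qu_NQ : us \in NQ.
Proof.
have [Qi _ Qm] := Q0_mem a b; have sQN := subsetP (Q0_NQ hab).
rewrite qu_conj; apply: groupM; first exact: sQN.
by apply: (groupJ (w_NQ nz2 hab)); rewrite groupV sQN.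
Qed.

Lemma qu_noncommute : ~ commute us (us ^ i^-1).
Proof.
move=> c; apply: (Q8_order3_noncommute om (qi2 F) (qj2 hab) (qji hab) cm
  (qi_qw nz2 hab) (qj_qw nz2 hab)); first by rewrite (order_w nz2 nz3 hab).
have mi g : m * (m * g) = g by rewrite mulgA m2 mul1g.
have ew : w ^ i^-1 = m * us by rewrite qu_conj mi.
have : commute (w ^ i^-1) ((w ^ i^-1) ^ i^-1).
  rewrite ew conjMg (_ : m ^ i^-1 = m); last by rewrite conjgE cm mulKg.
  apply: commuteM; first exact: commute_sym (cm _).
  by apply: commute_sym; apply: commuteM; [exact: commute_sym (cm _) | apply: commute_sym].
(* Conjugation by i^2 turns the commuting pair into [w ^ i] and w. *)
move/(commuteJ (i * i)).
rewrite -!conjgM !mulgA mulVg mul1g mulgKV mulVg conjg1 => c'.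
exact: commute_sym.
Qed.

Lemma NQ_cover : #|NQ| = 24 -> forall g, g \in NQ -> g \in <[us]> \/
  exists u v, [/\ u \in <[us]>, v \in <[us]> & g = u * i * v].
Proof.
move=> oN; apply: (@double_coset_cover _ NQ <[us]>%G <[m]>%G i).
- by rewrite cycle_subG qu_NQ.
- by have [Qi _ _] := Q0_mem a b; rewrite (subsetP (Q0_NQ hab)).
- apply/negP=> Ui; apply: qu_noncommute; rewrite (_ : us ^ i^-1 = us) //.
  apply/conjg_fixP/commgP; apply: (centsP (cycle_abelian us)); rewrite ?cycle_id //.
  by rewrite groupV.
- apply/subsetP=> g /setIP[Ug]; rewrite /= -cycleJ => Ugi; apply/negPn/negP=> nZ.
  have Sg : g \in S.
    by apply: (subsetP (_ : <[us]> \subset S)) => //; rewrite cycle_subG; case/setIP: qu_NQ.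
  rewrite -scalar_SL // in nZ; apply: qu_noncommute; apply: (commute_nonscalar nZ).
    by apply: (centsP (cycle_abelian us)); rewrite ?cycle_id.
  by apply: (centsP (cycle_abelian (us ^ i^-1))); rewrite ?cycle_id.
(* The count is exact: 24 * 2 = 6 * 2 + 6 * 6. *)
by rewrite oN -!orderE order_qu om.
Qed.

(** The product s j has trace -t, which forces its tenth power to be 1. If 5 did not divide its
    order, it would be 1 or -1, so t^2 = 4; then t = 3 and 9 = 4, against 5 being nonzero. *)
Lemma icosa_dvd5 t : (t ^+ 2 = t + 1)%R -> 5 %| #|icosa t|.
Proof.
move=> e; have [Qi Qj Qm] := Q0_mem a b.
have Sj : j \in S by apply: qj_SL.
have Sg : s t * j \in S by apply: SLgM; rewrite ?qs_SL.
have tg : trg (s t * j) = (- t)%R by apply: trg_qs_qj.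
have g10 : (s t * j) ^+ 10 = 1.
  by apply: (exp10_trace Sg); rewrite tg; ring: e.
have Kg : s t * j \in icosa t.
  apply: groupM; [exact: qs_icosa | apply: (subsetP (NQ_icosa t))].
  exact: (subsetP (Q0_NQ hab)).
apply: dvdn_trans (order_dvdG Kg); apply/negPn/negP=> n5.
have : #[s t * j] %| 2.
  have : #[s t * j] %| 2 * 5 by rewrite order_dvdn g10.
  by rewrite Gauss_dvdl // coprime_sym prime_coprime.
rewrite order_dvdn expg2 => /eqP /(involution_SL nz2 Sg).
have t4 : (t ^+ 2 != 4%:R)%R.
  apply/eqP=> t4; case/negP: nz5; apply/eqP.
  have t3 : t = 3%:R%R by apply: (addIr 1%R); rewrite -e t4; ring.
  by move: t4; rewrite t3 => t4; apply: (eq_of_sub t4); ring.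
rewrite mem_cycle_mone // => /orP[]/eqP eg; move: tg t4; rewrite eg /trg ?ent1 ?(glE1 (det_mone F)) => tt.
  by rewrite -sqrrN -tt => /eqP; case; ring.
by rewrite -sqrrN -tt => /eqP; case; ring.
Qed.

(** The double coset count bounds the order by 24 + 24 * 24 / 6 = 120, and both 24 and 5 divide
    it. *)
Lemma card_icosa t : (t ^+ 2 = t + 1)%R -> #|NQ| = 24 -> #|icosa t| = 120.
Proof.
move=> e oN; have [Qi Qj Qm] := Q0_mem a b; have sQN := subsetP (Q0_NQ hab).
have l : (#|icosa t| * #|<[us]>| <= #|NQ| * #|<[us]>| + #|NQ| * #|NQ|)%N.
  apply: (@double_coset_card _ NQ <[us]>%G (s t) i).
  - by rewrite cycle_subG qu_NQ.
  - by rewrite qs2 // sQN.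
  - rewrite -groupV; apply/normP; rewrite -cycleJ.
    suff -> : us ^ (s t)^-1 = us^-1 by rewrite cycleV.
    by apply: inverted_conjV; apply: qs_qu.
  - exact: NQ_cover.
  exists (m * i), i; split; rewrite ?groupM ?sQN //.
  by rewrite qs_qi_qs // !mulgA.
rewrite oN -orderE order_qu in l.
have d24 : 24 %| #|icosa t|.
  by rewrite -oN cardSg // sub_gen // subsetUr.
have : 24 * 5 %| #|icosa t| by rewrite Gauss_dvd // d24 icosa_dvd5.
exact: card_120 l (cardG_gt0 _).
Qed.

End TypeD.

Lemma conjg_eq (gT : finGroupType) (x y z : gT) : x * y = y * z -> x ^ y = z.
Proof. by move=> e; rewrite conjgE e mulKg. Qed.

Section IcosahedralHall.

Variables (F : finFieldType) (p : nat).
Hypothesis cp : p \in [pchar F]%R.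
Hypothesis nz2 : (2%:R != 0 :> F)%R.
Hypothesis nz3 : (3%:R != 0 :> F)%R.
Hypothesis nz5 : (5%:R != 0 :> F)%R.
Variables a b : F.
Hypothesis hab : (a ^+ 2 = -1 - b ^+ 2)%R.
Variable pi : nat_pred.
Hypotheses (pi2 : 2 \in pi) (pi3 : 3 \in pi) (p_pi : p \notin pi).
Implicit Types (g h u : GLT F) (H Q X : {group GLT F}) (t x y z : F).

Notation S := (SLg F).
Notation m := (mone F).
Notation i := (qi F).
Notation j := (qj a b).
Notation Q0 := (Q8 i j).
Notation NQ := ('N_S(Q0)%G).
Notation s := (qs a b).
Notation pv := (pv a b).
Notation icosa := (icosa a b).

Let oQ0 : #|Q0| = 8. Proof. exact: card_Q0. Qed.
Let abQ0 : ~~ abelian Q0. Proof. exact: Q0_nonabelian. Qed.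
Let om : #[m] = 2. Proof. exact: order_mone. Qed.
Let zS : 'Z(S) = <[m]>. Proof. exact: center_SL nz2 _ _ hab. Qed.
Let dickH H : pi.-Hall(S) H -> dickson_hyp <[m]> H.
Proof. exact: (Hall_dickson cp nz2 nz3 hab). Qed.
Let cm g : commute m g. Proof. exact: mone_central. Qed.
Let m2 : m * m = 1. Proof. exact: mone2. Qed.

(** The squared traces of elements of order 4, of order 3 or 6, of 1 and -1, and of elements of
    order 5 or 10. *)
Definition icosa_square (c : F) := (c = 0 \/ c = 1 \/ c = 4%:R \/ c ^+ 2 - 3%:R * c + 1 = 0)%R.

Lemma icosa_trace H g : pi.-Hall(S) H -> icosahedral <[m]> H -> g \in H ->
  icosa_square (trg g ^+ 2)%R.
Proof.
move=> hH [_ [ty _ _]] Hg; have [sHS _ _] := and3P hH; have Sg := subsetP sHS _ Hg.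
have [|ng] := boolP (g \in <[m]>).
  rewrite mem_cycle_mone // => /orP[]/eqP->; right; right; left.
    by rewrite /trg !ent1; ring.
  by rewrite /trg !(glE1 (det_mone F)); ring.
have sg : ~~ scalarg g by rewrite scalar_SL.
have Hg' : g \in H :\: <[m]> by rewrite in_setD ng.
have gC : g ^+ #|'C_H[g]| = 1.
  by apply/eqP; rewrite -order_dvdn order_dvdG // inE Hg cent1id.
have := ty _ Hg'; rewrite !inE => /or3P[]/eqP[e _]; rewrite e in gC.
- by left; rewrite (trace_exp4 nz2 Sg sg gC) expr0n.
- by right; left; apply: trace_exp6.
by right; right; right; rewrite -(trace_exp10 nz2 Sg sg gC); ring.
Qed.

(** Take u of order 3 in a centralizer C of order 6, and n in its normalizer but not in C. Both n
    and n u lie outside C, and [sq] shows that such elements have square -1. *)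
Lemma order6_inverted H : pi.-Hall(S) H -> icosahedral <[m]> H ->
  exists u n, [/\ u \in H, n \in H, (trg u ^+ 2 = 1)%R,
    n * n = m & (n * u) * (n * u) = m].
Proof.
move=> hH [_ [ty cj ex]]; have [sHS piH _] := and3P hH.
have hyp := dickH hH; have [sZH cHZ _ ab _] := hyp.
have := ex 6 12; rewrite !inE eqxx orbT => /(_ isT)[v [Hv oC oN]].
have sCN : 'C_H[v] \subset 'N_H('C_H[v]) by rewrite subsetI subsetIl normG.
have /subsetPn[n Nn nCn] : ~~ ('N_H('C_H[v]) \subset 'C_H[v]).
  by apply/negP=> /subset_leq_card; rewrite oC oN.
have d3 : 3 %| #|'C_H[v]| by rewrite oC.
have [u Cu ou] := Cauchy (isT : prime 3) d3.
have Hu : u \in H by case/setIP: Cu.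
have Su := subsetP sHS _ Hu.
have nu : u \notin <[m]> by apply: (notin_center_order hyp); rewrite ou.
have su : ~~ scalarg u by rewrite scalar_SL.
have eC : 'C_H[u] = 'C_H[v] by apply: (cent1_eq hyp) => //; rewrite in_setD nu.
(* k inverts u, so k^2 commutes with u. If k^2 were not 1 or -1, its centralizer would be C and
   would contain k; and k^2 = 1 would make k central. *)
have sq k : k \in 'N_H('C_H[v]) -> k \notin 'C_H[v] -> k * k = m.
  move=> Nk nCk; have [Hk Nk'] := setIP Nk.
  have Sk := subsetP sHS _ Hk.
  have Cuk : u ^ k \in 'C_H[v] by rewrite memJ_norm.
  have ek : u ^ k = u^-1.
    have [||e|//] := commute_same_trace nz2 Su (subsetP sHS _ (groupJ Hu Hk)) su _ _ (trgJ u k).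
    - apply: (pprime_trace nz2 cp) => //.
      apply: contra (pi_group_p' cp p_pi piH) => d.
      exact: dvdn_trans d (order_dvdG Hu).
    - by move: Cuk; rewrite -eC => /setIP[_ /cent1P].
    case/negP: nCk; rewrite -eC inE Hk; apply/cent1P; apply/commute_sym/commgP/conjg_fixP; exact: e.
  have Ckk : k * k \in 'C_H[v].
    rewrite -eC inE groupM //; apply/cent1P; apply/commute_sym/commgP/conjg_fixP.
    by rewrite conjgM ek conjVg ek invgK.
  have [Z|nZ] := boolP (k * k \in <[m]>); last first.
    case/negP: nCk; rewrite -(cent1_eq hyp Hv (_ : k * k \in _)) ?in_setD ?nZ //.
    by rewrite inE Hk; apply/cent1P; rewrite /commute mulgA.
  move: Z; rewrite mem_cycle_mone // => /orP[]/eqP e; last exact: e.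
  have Zk := involution_SL nz2 Sk e.
  case/negP: nCk; rewrite inE Hk; apply/cent1P; apply/commute_sym/(centsP cHZ) => //.
  by case/setDP: Hv.
exists u, n; split=> //; first by case/setIP: Nn.
- by apply: trace_exp6 => //; rewrite (expgM u 3 2) -ou expg_order expg1n.
- exact: sq.
apply: sq; first by rewrite groupM // (subsetP sCN).
by rewrite groupMr.
Qed.

(** The centralizers of order 4 are conjugate, so some conjugate of n commutes with i. It has trace
    0 like i, and is therefore i or its inverse -i. *)
Lemma order4_conj H n : pi.-Hall(S) H -> icosahedral <[m]> H -> Q0 \subset H ->
  n \in H -> n * n = m -> exists2 h, h \in H & n ^ h = i \/ n ^ h = m * i.
Proof.
move=> hH [_ [ty cj _]] sQ Hn nn; have [sHS _ _] := and3P hH; have hyp := dickH hH.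
have [Qi _ _] := Q0_mem a b; have Hi := subsetP sQ _ Qi.
have f k : k \in H -> k * k = m -> [/\ k \in H :\: <[m]>, trg k = 0%R & #|'C_H[k]| = 4].
  move=> Hk kk; have tk : trg k = 0%R by apply/eqP; rewrite trg0_sqr ?kk // (subsetP sHS).
  have ok : #[k] = 4 := order_Q8_gen om kk.
  have nk : k \notin <[m]> by apply: (notin_center_order hyp); rewrite ok.
  have Hk' : k \in H :\: <[m]> by rewrite in_setD nk.
  split=> //; have d : #[k] %| #|'C_H[k]| by rewrite order_dvdG // inE Hk cent1id.
  by rewrite ok in d; have := ty _ Hk'; rewrite !inE => /or3P[]/eqP[e _]; rewrite e in d *.
have [Hn' tn on] := f _ Hn nn; have [Hi' ti oi] := f _ Hi (qi2 F).
have [h Hh e] := cj _ _ Hn' Hi' (etrans on (esym oi)); exists h => //.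
have Ch : n ^ h \in 'C_H[i] by rewrite e memJ_conjg inE Hn cent1id.
have [_ /cent1P/commute_sym c] := setIP Ch.
have Si := subsetP sHS _ Hi.
have [|||->|->] := commute_same_trace nz2 Si (subsetP sHS _ (groupJ Hn Hh)) _ _ c.
- by rewrite scalar_SL //; case/setDP: Hi'.
- by rewrite ti expr0n /= eq_sym (natrM _ 2 2) mulf_neq0.
- by rewrite trgJ tn ti.
- by left.
by right; apply: i_inv.
Qed.

Lemma trg_mone g : trg (m * g) = (- trg g)%R.
Proof. by rewrite /trg !entNg opprD. Qed.

(** Conjugation by i or j changes two signs and multiplication by -1 changes all three, so each sign
    can be changed alone. *)
Lemma pv_signs X x y z : Q0 \subset X -> (x ^+ 2 + y ^+ 2 + z ^+ 2 = 4%:R)%R ->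
  pv x y z \in X -> [/\ pv (- x)%R y z \in X, pv x (- y)%R z \in X & pv x y (- z)%R \in X].
Proof.
move=> sQ e Xv; have [Qi Qj Qm] := Q0_mem a b.
have [[Xi Xj] Xm] := (subsetP sQ _ Qi, subsetP sQ _ Qj, subsetP sQ _ Qm).
have fx x' y' z' : (x' ^+ 2 + y' ^+ 2 + z' ^+ 2 = 4%:R)%R -> pv x' y' z' \in X ->
    pv (- x')%R y' z' \in X.
  move=> e' Xv'; have e2 : (x' ^+ 2 + (- y') ^+ 2 + (- z') ^+ 2 = 4%:R)%R by rewrite !sqrrN.
  rewrite -[y']opprK -[z']opprK -(pv_mone nz2 hab e2); apply: groupM => //.
  have -> : pv x' (- y')%R (- z')%R = pv x' y' z' ^ i.
    by rewrite conjgE (pv_qi nz2 hab e') mulKg.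
  exact: groupJ.
have fy x' y' z' : (x' ^+ 2 + y' ^+ 2 + z' ^+ 2 = 4%:R)%R -> pv x' y' z' \in X ->
    pv x' (- y')%R z' \in X.
  move=> e' Xv'; have e2 : ((- x') ^+ 2 + y' ^+ 2 + (- z') ^+ 2 = 4%:R)%R by rewrite !sqrrN.
  rewrite -[x']opprK -[z']opprK -(pv_mone nz2 hab e2); apply: groupM => //.
  have -> : pv (- x')%R y' (- z')%R = pv x' y' z' ^ j.
    by rewrite conjgE (pv_qj nz2 hab e') mulKg.
  exact: groupJ.
split; [exact: fx | exact: fy |].
have e1 : ((- x) ^+ 2 + y ^+ 2 + z ^+ 2 = 4%:R)%R by rewrite !sqrrN.
have e2 : ((- x) ^+ 2 + (- y) ^+ 2 + z ^+ 2 = 4%:R)%R by rewrite !sqrrN.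
have := groupM Xm (fy _ _ _ e1 (fx _ _ _ e Xv)).
by rewrite (pv_mone nz2 hab e2) !opprK.
Qed.

(** If c is 0, 1 or 4, each of the four conditions on d = 3 - c makes 1, 2, 3 or 5 vanish. So c is a
    root of c^2 - 3c + 1, whose roots t^2 and (1 - t)^2 have sum 3. *)
Lemma golden_squares t c d : (t ^+ 2 = t + 1 -> icosa_square c -> icosa_square d ->
  c + d = 3%:R -> c = t ^+ 2 /\ d = (1 - t) ^+ 2 \/ c = (1 - t) ^+ 2 /\ d = t ^+ 2)%R.
Proof.
move=> et sc sd e; have ed : (d = 3%:R - c)%R by rewrite -e addrC addKr.
have fl (k : F) (n : F) : (n != 0 -> k = 0 -> k - 0 = n - 0 -> False)%R.
  by move=> n0 k0; rewrite k0 !subr0 => /esym/eqP; rewrite (negPf n0).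
have nz1 : (1 != 0 :> F)%R by apply: oner_neq0.
have {}sc : (c ^+ 2 - 3%:R * c + 1 = 0)%R.
  case: sc ed sd => [->|[->|[->|//]]] -> [|[|[|]]] /eqP; rewrite -subr_eq0 => /eqP k0; exfalso.
  - by apply: (fl _ _ nz3 k0); ring.
  - by apply: (fl _ _ nz2 k0); ring.
  - by apply: (fl _ (-1)%R _ k0); [rewrite oppr_eq0 | ring].
  - by apply: (fl _ _ nz1 k0); ring.
  - by apply: (fl _ _ nz2 k0); ring.
  - by apply: (fl _ _ nz1 k0); ring.
  - by apply: (fl _ (-2%:R)%R _ k0); [rewrite oppr_eq0 | ring].
  - by apply: (fl _ (-1)%R _ k0); [rewrite oppr_eq0 | ring].
  - by apply: (fl _ (-1)%R _ k0); [rewrite oppr_eq0 | ring].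
  - by apply: (fl _ (-2%:R)%R _ k0); [rewrite oppr_eq0 | ring].
  - by apply: (fl _ (-5%:R)%R _ k0); [rewrite oppr_eq0 | ring].
  - by apply: (fl _ _ nz5 k0); ring.
have : ((c - t ^+ 2) * (c - (1 - t) ^+ 2) == 0)%R by rewrite -sc; apply/eqP; ring: et.
rewrite mulf_eq0 !subr_eq0 => /orP[]/eqP ec; [left|right]; split=> //; rewrite ed ec; ring: et.
Qed.

Lemma icosa_square_quarter : ~ icosa_square (4%:R^-1)%R.
Proof.
have nz4 : (4%:R != 0 :> F)%R by rewrite (natrM _ 2 2) mulf_neq0.
move=> [|[|[|]]].
- by move/eqP; rewrite invr_eq0 (negPf nz4).
- by move=> e; case/negP: nz3; apply/eqP; apply: (eq_of_sub (congr1 (fun x => - 4%:R * x)%R e)); field.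
- move=> e; case/negP: (mulf_neq0 nz3 nz5); apply/eqP.
  by apply: (eq_of_sub (congr1 (fun x => - 4%:R * x)%R e)); field.
move=> e; case/negP: nz5; apply/eqP.
by apply: (eq_of_sub (congr1 (fun x => 4%:R * 4%:R * x)%R e)); field.
Qed.

Lemma golden_qs t H x y z : (t ^+ 2 = t + 1)%R -> Q0 \subset H ->
  (x ^+ 2 + y ^+ 2 + z ^+ 2 = 4%:R)%R -> pv x y z \in H ->
  (x ^+ 2 = 1)%R -> (y ^+ 2 = t ^+ 2)%R -> (z ^+ 2 = (1 - t) ^+ 2)%R -> s t \in H.
Proof.
move=> et sQ e Hv /eqP; rewrite sqrf_eq1 => ex /eqP; rewrite eqf_sqr => ey /eqP; rewrite eqf_sqr => ez.
have {ex}[{}e {}Hv] : ((1 ^+ 2 + y ^+ 2 + z ^+ 2 = 4%:R)%R /\ pv 1%R y z \in H).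
  case/orP: ex e Hv => /eqP-> e Hv //; have [] := pv_signs sQ e Hv; rewrite opprK.
  by move: e; rewrite sqrrN.
have {ey}[{}e {}Hv] : ((1 ^+ 2 + t ^+ 2 + z ^+ 2 = 4%:R)%R /\ pv 1%R t z \in H).
  case/orP: ey e Hv => /eqP-> e Hv //; have [_] := pv_signs sQ e Hv; rewrite opprK.
  by move: e; rewrite sqrrN.
case/orP: ez e Hv => /eqP-> e Hv //; have [_ _] := pv_signs sQ e Hv.
by rewrite opprK.
Qed.

Lemma qs_or_conj t H : (t ^+ 2 = t + 1)%R -> pi.-Hall(S) H -> icosahedral <[m]> H ->
  Q0 \subset H -> s t \in H \/ s (1 - t)%R \in H.
Proof.
move=> et hH iH sQ; have [sHS _ _] := and3P hH.
have [u [n [Hu Hn tu nn nunu]]] := order6_inverted hH iH.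
have [Qi Qj Qm] := Q0_mem a b.
have [[Hi Hj] Hm] := (subsetP sQ _ Qi, subsetP sQ _ Qj, subsetP sQ _ Qm).
have [h Hh eh] := order4_conj hH iH sQ Hn nn.
(* As [n ^ h] is i or -i, the coordinate of g at i is up to sign the trace of u, of square 1. The
   squares of the other two are squared traces of elements of H with sum 4 - 1 = 3. *)
pose g := (n * u) ^ h.
have Hg : g \in H by rewrite groupJ // groupM.
have Sg := subsetP sHS _ Hg.
have tg0 : trg g = 0%R.
  by apply/eqP; rewrite trgJ trg0_sqr ?nunu //; rewrite (subsetP sHS) // groupM.
have tgi : (trg (g * i) ^+ 2 = 1)%R.
  rewrite -tu -(trgJ u h) /g conjMg; move: (u ^ h) eh => v [->|->].
    by rewrite (trgC (i * v) i) (mulgA i i) qi2 trg_mone sqrrN.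
  by rewrite (trgC (m * i * v) i) -(mulgA m i v) (mulgA i m) -cm -(mulgA m i) (mulgA i i) qi2 mulgA m2 mul1g.
have [] := traceless_pv nz2 hab Sg tg0.
have := icosa_trace hH iH (groupM Hg Hj); rewrite -sqrrN.
have := icosa_trace hH iH (groupM Hg (groupM Hi Hj)); rewrite -sqrrN.
have : ((- trg (g * i)) ^+ 2 = 1)%R by rewrite sqrrN.
move: (- trg (g * i))%R (- trg (g * j))%R (- trg (g * (i * j)))%R => x y z ex sz sy e eg.
have eyz : (y ^+ 2 + z ^+ 2 = 3%:R)%R by apply: (eq_of_sub e); rewrite ex; ring.
have [[ey ez]|[ey ez]] := golden_squares et sy sz eyz.
  by left; apply: (golden_qs et sQ e _ ex ey ez); rewrite -eg.
right; apply: (golden_qs (golden_conj et) sQ e _ ex ey); first by rewrite -eg.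
by rewrite ez; congr (_ ^+ 2)%R; ring.
Qed.

Lemma icosa_unique t H : (t ^+ 2 = t + 1)%R -> #|NQ| = 24 -> pi.-Hall(S) H ->
  icosahedral <[m]> H -> Q0 \subset H -> H :=: icosa t \/ H :=: icosa (1 - t)%R.
Proof.
move=> et oN hH iH sQ; have [sHS _ _] := and3P hH; have [oH _] := iH.
have sNH : NQ \subset H.
  have <- : 'N_H(Q0) = NQ; last exact: subsetIl.
  apply/eqP; rewrite eqEcard setSI //= (icosahedral_normalizer (dickH hH) iH) ?oN //.
  by rewrite cycle_subG; have [] := Q0_mem a b.
have sub r : (r ^+ 2 = r + 1)%R -> s r \in H -> H :=: icosa r.
  move=> er Hr; apply/esym/eqP; rewrite eqEcard oH (card_icosa nz2 nz3 nz5 hab er oN) leqnn andbT.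
  by rewrite gen_subG subUset sub1set Hr.
have [Hs|Hs] := qs_or_conj et hH iH sQ; [left|right]; apply: sub => //.
exact: golden_conj.
Qed.

Lemma pi120 : (#|S|`_pi = 120)%N -> [/\ #|NQ| = 24, 5 %| #|S| & (#|S|`_2 = 8)%N].
Proof.
move=> o; have o2 : (#|S|`_2 = 8)%N.
  have : ((#|S|`_pi)`_2 = #|S|`_2)%N.
    by rewrite partn_part // => r; rewrite inE => /eqP ->; exact: pi2.
  by rewrite o p_part => <-.
split=> //; first exact: NQ_24 cp nz2 nz3 _ _ hab o2.
by apply: dvdn_trans (dvdn_part pi _); rewrite o.
Qed.

Lemma icosa_Hall t : (t ^+ 2 = t + 1)%R -> (#|S|`_pi = 120)%N ->
  pi.-Hall(S) (icosa t) /\ icosahedral <[m]> (icosa t).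
Proof.
move=> et o; have [oN _ _] := pi120 o.
have oI := card_icosa nz2 nz3 nz5 hab et oN.
have hI : pi.-Hall(S) (icosa t).
  apply: Hall_of_card; last by rewrite oI o.
  by rewrite gen_subG subUset sub1set qs_SL // subsetIl.
split=> //; have [aa|] := Hall_cases cp nz2 nz3 hab pi2 pi3 p_pi hI.
  case: (almost_abelian_w nz2 nz3 hab aa); split; apply: (subsetP (NQ_icosa a b t)).
    exact: w_NQ nz2 _ _ hab.
  exact: wi_NQ nz2 _ _ hab.
by case=> // -[e _]; rewrite oI in e.
Qed.

Lemma icosahedral_conj_Q0 H : pi.-Hall(S) H -> icosahedral <[m]> H ->
  exists2 u, u \in S & Q0 \subset H :^ u.
Proof.
move=> hH [oH _]; apply: (sylow2_order8_conj nz2 hab pi2 hH).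
by rewrite oH p_part.
Qed.

Lemma icosahedral_type_d H : pi.-Hall(S) H -> icosahedral <[m]> H -> type_d pi S H.
Proof.
move=> hH iH; rewrite /type_d hH /= zS; have [u Su sQ] := icosahedral_conj_Q0 hH iH.
have sQH : Q0 :^ u^-1 \subset H by rewrite sub_conjgV.
apply: (icosahedral_quotient (dickH hH) (Q := (Q0 :^ u^-1)%G) iH sQH).
- by rewrite cardJg.
- by rewrite abelianJ.
have [_ _ Qm] := Q0_mem a b.
rewrite cycle_subG /= (_ : m = m ^ u^-1) ?memJ_conjg //.
by rewrite conjgE cm mulKg.
Qed.

Lemma type_d_conj H g : type_d pi S H -> type_d pi S (H :^ g)%G.
Proof.
case/andP=> hH iH; have Ng := SLg_norm g.
rewrite /type_d pHallJnorm // hH /=.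
have Nz : g \in 'N('Z(S)) by apply: (subsetP (char_norms (center_char S))).
by rewrite quotientJ //; apply: isog_trans iH; rewrite isog_sym conj_isog.
Qed.

Lemma type_d_icosahedral H : type_d pi S H -> icosahedral <[m]> H.
Proof.
case/andP=> hH iH; have oH : #|H| = 120.
  have lt5 : (1 < #|'I_5|)%N by rewrite card_ord.
  rewrite (card_quotient_center cp nz2 nz3 hab pi2 pi3 p_pi hH) (card_isog iH).
  by rewrite card_Alt // card_ord.
have o : (#|S|`_pi = 120)%N by case/pHallP: hH => _ <-.
have [oN d5 _] := pi120 o; have [t et] := golden_ratio nz2 d5 nz5.
have [hI tI] := icosa_Hall et o; have /andP[_ iI] := icosahedral_type_d hI tI.
have [aa|] := Hall_cases cp nz2 nz3 hab pi2 pi3 p_pi hH.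
  have sN := subsetP (NQ_icosa a b t).
  case: (Hall_not_almost_abelian cp nz2 nz3 hab pi2 pi3 p_pi hH _ _ iH iI aa); apply: sN.
    exact: w_NQ nz2 _ _ hab.
  exact: wi_NQ nz2 _ _ hab.
by case=> // -[e _]; move: oH; rewrite e.
Qed.

Lemma qc_norm : qc F \in 'N(Q0).
Proof.
have [Qi Qj Qm] := Q0_mem a b.
have ei : i ^ qc F = i by apply: conjg_eq; apply: qi_qc.
have ej : j ^ qc F = m * (i * j) by apply: conjg_eq; apply: qj_qc.
apply/normP/eqP; rewrite eqEcard cardJg leqnn andbT -genJ gen_subG.
apply/subsetP=> _ /imsetP[u + ->]; rewrite !inE => /orP[]/eqP->; rewrite ?ei ?ej //.
by apply: groupM => //; apply: groupM.
Qed.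

Lemma icosa_qc t : (t ^+ 2 = t + 1)%R -> #|NQ| = 24 -> icosa t :^ qc F = icosa (1 - t)%R.
Proof.
move=> et oN; have et' := golden_conj et; have es := golden_sum et'.
apply/eqP; rewrite eqEcard cardJg !(card_icosa nz2 nz3 nz5 hab _ oN) // leqnn andbT.
rewrite -genJ gen_subG conjUg subUset -{1}[[set s t]]/([set s t]) conjg_set1 sub1set; apply/andP; split.
  have -> : s t ^ qc F = pv 1%R (1 - t)%R (- t)%R.
    by rewrite conjgE (qs_qc nz2 hab et) mulKg.
  have sQ : Q0 \subset icosa (1 - t)%R := subset_trans (Q0_NQ hab) (NQ_icosa a b _).
  have [_ _] := pv_signs sQ es (qs_icosa a b (1 - t)%R).
  by have -> : (- (1 - (1 - t)) = - t)%R by ring.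
rewrite conjIg (normP (SLg_norm _)) -normJ (normP qc_norm); exact: NQ_icosa.
Qed.

(** By Sylow the conjugating element can be corrected to one that normalizes the quaternion group,
    hence lies in [NQ] and in [icosa t]. The two groups would be equal and contain a product of
    trace 1/2. *)
Lemma icosa_conj_neq t : (t ^+ 2 = t + 1)%R -> (#|S|`_pi = 120)%N ->
  forall g, g \in S -> icosa (1 - t)%R :!=: icosa t :^ g.
Proof.
move=> et o g Sg; apply/negP=> /eqP e; have [oN _ o2] := pi120 o.
have [hI tI] := icosa_Hall et o; have et' := golden_conj et.
have sI r : (r ^+ 2 = r + 1)%R -> icosa r \subset S.
  by move=> er; have [/and3P[]] := icosa_Hall er o.
have sQ r : Q0 \subset icosa r := subset_trans (Q0_NQ hab) (NQ_icosa a b r).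
have sylQ (Q : {group GLT F}) : #|Q| = 8 -> Q \subset icosa (1 - t)%R ->
    2.-Sylow(icosa (1 - t)%R) Q.
  by move=> oQ sQI; rewrite pHallE sQI oQ (card_icosa nz2 nz3 nz5 hab et' oN) p_part.
have s1 : Q0 :^ g \subset icosa (1 - t)%R by rewrite e conjSg.
have [x Ix ex] := Sylow_trans (sylQ (Q0 :^ g)%G (etrans (cardJg _ _) oQ0) s1) (sylQ Q0 oQ0 (sQ _)).
have Igx : g * x \in icosa t.
  apply: (subsetP (NQ_icosa a b t)).
  rewrite inE groupM ?(subsetP (sI _ et') _ Ix) //=; apply/normP.
  by rewrite conjsgM.
have eI : icosa (1 - t)%R :=: icosa t.
  by rewrite -(conjGid Igx) conjsgM -e conjGid.
apply: icosa_square_quarter.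
have It : s t * s (1 - t)%R \in icosa t.
  by apply: groupM; [exact: qs_icosa | rewrite -eI; exact: qs_icosa].
have := icosa_trace hI tI It; rewrite (trg_qs_conj nz2 hab et).
by rewrite exprVn -natrX.
Qed.

Lemma type_d_swapped : (#|S|`_pi = 120)%N -> swapped_classes S (type_d pi S).
Proof.
move=> o; have [oN d5 _] := pi120 o; have [t et] := golden_ratio nz2 d5 nz5.
have et' := golden_conj et.
have [h1 t1] := icosa_Hall et o; have [h2 t2] := icosa_Hall et' o.
apply: (@swapped_classesI _ _ _ (icosa t) (icosa (1 - t)%R) (qc F)).
- exact: icosahedral_type_d.
- exact: icosahedral_type_d.
- exact: SLg_norm.
- move=> H dH; have /andP[hH _] := dH.
  have [u Su sQ] := icosahedral_conj_Q0 hH (type_d_icosahedral dH).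
  have dHu := type_d_conj u dH; have /andP[hHu _] := dHu.
  exists u => //; have [e|e] := icosa_unique et oN hHu (type_d_icosahedral dHu) sQ.
    by left; rewrite -e.
  by right; rewrite -e.
- exact: icosa_conj_neq.
- by rewrite icosa_qc.
exists 1 => //; rewrite conjsg1 icosa_qc //.
by congr (gval (icosa _)); ring.
Qed.

End IcosahedralHall.

(** * Counting classes, dominance, and Hall subgroups modulo the center *)

Section Classes.

Variables (gT : finGroupType) (G : {group gT}).
Implicit Types (P : pred {group gT}) (H : {group gT}).

Lemma card_classes_all_conjugate P : all_conjugate G P -> (#|classes_of G P| <= 1)%N.
Proof.
move=> cj; have [->|[C /imsetP[H]]] := set_0Vmem (classes_of G P); first by rewrite cards0.
rewrite inE => PH _; rewrite -(cards1 (H :^: G)); apply: subset_leq_card.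
apply/subsetP=> C' /imsetP[X]; rewrite inE => PX ->; rewrite inE.
by have [x Gx e] := cj _ _ PX PH; apply/(conjugates_eqP G X H); exists x.
Qed.

Lemma card_swapped_classes P : swapped_classes G P -> (#|classes_of G P| <= 2)%N.
Proof. by case=> C1 [C2 [n ->] _]; rewrite cards2 n. Qed.

Lemma classes_of_pred0 P : (forall H, ~ P H) -> #|classes_of G P| = 0.
Proof.
move=> n; apply/eqP; rewrite cards_eq0; apply/eqP/setP=> C; rewrite inE.
by apply/imsetP=> -[H]; rewrite inE => /n.
Qed.

Lemma swapped_classes_other P H : swapped_classes G P -> P H ->
  exists2 L, P L & forall x, x \in G -> L :^ x != H.
Proof.
case=> C1 [C2 [n e _]] PH.
have {n} [C [CG n]] : exists C, C \in classes_of G P /\ C != H :^: G.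
  have : H :^: G \in classes_of G P by apply/imsetP; exists H; rewrite ?inE.
  rewrite e !inE => /orP[]/eqP->; [exists C2 | exists C1]; rewrite !inE eqxx ?orbT //.
  by rewrite eq_sym.
have /imsetP[L + eC] := CG; rewrite inE => PL; exists L => // x Gx.
by apply: contra n => /eqP eL; rewrite eC -eL class_conj.
Qed.

Lemma Hall_conj_class pi (H L : {group gT}) : pi.-Hall(G) H -> pi.-Hall(G) L -> k_pi pi G = 1%N ->
  exists2 x, x \in G & L :=: H :^ x.
Proof.
move=> hH hL /eqP/cards1P[C e].
have inC (X : {group gT}) : pi.-Hall(G) X -> X :^: G = C.
  by move=> hX; apply/set1P; rewrite -e; apply/imsetP; exists X; rewrite ?inE.
by apply/(conjugates_eqP G H L); rewrite (inC _ hH) (inC _ hL).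
Qed.

Lemma not_D_pi pi : (forall H, pi.-Hall(G) H -> exists L : {group gT},
    [/\ L \subset G, pi.-group L & forall x, x \in G -> ~~ (L :^ x \subset H)]) ->
  E_pi pi G -> ~ D_pi pi G.
Proof.
move=> nL [H hH] [k1 D]; have [L [sLG piL n]] := nL _ hH.
have [X hX sLX] := D _ sLG piL; have [x Gx e] := Hall_conj_class hX hH k1.
by have := n _ Gx; rewrite e conjSg sLX.
Qed.

Lemma Hall_quotient_center pi : pi.-group 'Z(G) ->
  (forall L : {group coset_of 'Z(G)}, pi.-Hall(G / 'Z(G)) L ->
     exists2 H : {group gT}, pi.-Hall(G) H & L :=: H / 'Z(G)) /\
  (forall (L : {group coset_of 'Z(G)}) H,
     pi.-Hall(G / 'Z(G)) L -> H :=: coset 'Z(G) @*^-1 L -> pi.-Hall(G) H).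
Proof.
move=> piZ; have nZ := normal_norm (center_normal G).
have pre (L : {group coset_of 'Z(G)}) H : pi.-Hall(G / 'Z(G)) L ->
    H :=: coset 'Z(G) @*^-1 L -> pi.-Hall(G) H.
  move=> hL eH; have eL : L :=: H / 'Z(G) by rewrite eH cosetpreK.
  have sZH : 'Z(G) \subset H by rewrite eH sub_cosetpre.
  have sHG : H \subset G.
    rewrite eH -[X in _ \subset pred_of_set X](quotientGK (center_normal G)) cosetpreSK.
    by case/and3P: hL.
  rewrite -(pquotient_pHall piZ (center_normal G)) -?eL //.
  by rewrite /normal sZH (subset_trans sHG nZ).
split=> // L hL; exists (coset 'Z(G) @*^-1 L)%G; first exact: pre hL _.
by rewrite cosetpreK.
Qed.

End Classes.

Lemma pi_of_24 : \pi(24) =i pi23.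
Proof. by move=> r; rewrite -[_ \in \pi(_)]/(r \in [:: 2; 3]) !inE. Qed.

Lemma pi_of_48 : \pi(48) =i pi23.
Proof. by move=> r; rewrite -[_ \in \pi(_)]/(r \in [:: 2; 3]) !inE. Qed.

Lemma pi_of_120 : \pi(120) =i pi235.
Proof. by move=> r; rewrite -[_ \in \pi(_)]/(r \in [:: 2; 3; 5]) !inE. Qed.

(** * The pi-part of the order of SL_2(q) *)

Section Arithmetic.

Variables (F : finFieldType) (p f : nat).
Hypotheses (p_prime : prime p) (oF : #|F| = (p ^ f)%N).
Variable pi : nat_pred.
Hypothesis p_pi : p \notin pi.

Notation S := (SLg F).
Notation q := #|F|.

Lemma partn_SL : (#|S|`_pi = (q ^ 2 - 1)`_pi)%N.
Proof.
have q1 : (1 < q)%N by apply: finNzRing_gt1.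
have q2 : (0 < q ^ 2 - 1)%N by rewrite subn_gt0 -(exp1n 2) ltn_exp2r.
rewrite card_SLg partnM ?(ltnW q1) // part_p'nat ?mul1n //.
by rewrite oF pnatX pnatE // inE /= p_pi.
Qed.

Lemma pi_inter_SL : [predI pi & \pi(S)] =i \pi((#|S|`_pi)%N).
Proof. by move=> r; rewrite pi_of_part ?cardG_gt0 // !inE andbC. Qed.

Lemma pi_sub_SL r : r \in \pi((q ^ 2 - 1)%N) -> r \in \pi(S).
Proof.
have d : (q ^ 2 - 1 %| #|S|)%N by rewrite card_SLg dvdn_mull.
exact: pi_of_dvd d (cardG_gt0 _) _.
Qed.

Lemma partn_SL_rho rho : [predI pi & \pi(S)] =i rho ->
  ((q ^ 2 - 1)`_rho = #|S|`_pi)%N.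
Proof.
move=> e; rewrite partn_SL; apply: eq_in_partn => r rq.
by rewrite -e inE /= pi_sub_SL // andbT.
Qed.

Lemma partn_SL_eq N rho : (#|S|`_pi = N)%N -> \pi(N) =i rho ->
  [predI pi & \pi(S)] =i rho /\ ((q ^ 2 - 1)`_rho = N)%N.
Proof.
move=> oN eN; have e : [predI pi & \pi(S)] =i rho by move=> r; rewrite pi_inter_SL oN eN.
by rewrite partn_SL_rho.
Qed.

End Arithmetic.

(** * The claims (A) to (D) for SL_2 over the field of q elements *)

Section HallSubgroups.

Variables (F : finFieldType) (p f : nat).
Hypotheses (p_prime : prime p) (p_odd : odd p) (oF : #|F| = (p ^ f)%N).
Variable pi : nat_pred.
Hypotheses (pi2 : 2 \in pi) (pi3 : 3 \in pi) (p_pi : p \notin pi).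
Variables a b : F.
Hypothesis hab : (a ^+ 2 = -1 - b ^+ 2)%R.
Implicit Types (H L : {group GLT F}).

Notation S := (SLg F).
Notation q := #|F|.
Notation m := (mone F).
Notation i := (qi F).
Notation w := (qw a b).
Notation T := ('C_S[i]%G).
Notation D0 := ('N_S(<[i]>)%G).
Notation NQ := ('N_S(Q8 i (qj a b))%G).

Let cp : p \in [pchar F]%R. Proof. exact: card_finPcharP oF p_prime. Qed.

Let nz r : prime r -> r \in pi -> (r%:R != 0 :> F)%R.
Proof.
move=> pr pir; rewrite -(dvdn_pcharf cp) dvdn_prime2 //.
by apply: contra p_pi => /eqP->.
Qed.
Let nz2 : (2%:R != 0 :> F)%R. Proof. exact: nz. Qed.
Let nz3 : (3%:R != 0 :> F)%R. Proof. exact: nz. Qed.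
Let oddq : odd q. Proof. by rewrite oF oddX p_odd orbT. Qed.
Let partS := partn_SL p_prime oF p_pi.

Lemma pi5_nz5 : 5 \in pi -> (5%:R != 0 :> F)%R. Proof. exact: nz. Qed.

Lemma pi120_nz5 : (#|S|`_pi = 120)%N -> (5%:R != 0 :> F)%R.
Proof.
move=> o; apply: pi5_nz5; have : 5 \in \pi((#|S|`_pi)%N) by rewrite o.
by rewrite pi_of_part ?cardG_gt0 // inE => /andP[].
Qed.

Lemma q_sub_epsP : #|T| = q_sub_eps q. Proof. exact: card_torus. Qed.

Lemma q_sub_eps_cases : #|T| = q.-1 \/ #|T| = q.+1.
Proof.
have q1 : (1 < q)%N by apply: finNzRing_gt1.
rewrite q_sub_epsP /q_sub_eps /eps -signr_odd.
by case: odd; [right | left]; rewrite ?expr1 ?expr0 ?opprK; lia.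
Qed.

Lemma almost_abelian_arith_a H : pi.-Hall(S) H -> almost_abelian H -> arith_a pi q S.
Proof.
move=> hH aa r; rewrite pi_inter_SL => rN; rewrite -q_sub_epsP.
have [sHS _ _] := and3P hH.
have [u Su sHD] := almost_abelian_sub_D0 nz2 sHS (Hall_card_24 cp nz2 nz3 hab pi2 pi3 hH) aa.
have : r \in \pi(H :^ u)%G by rewrite /= cardJg; case/pHallP: hH => _ ->.
move/(pi_of_dvd (cardSg sHD) (cardG_gt0 _)); rewrite /= (card_D0 nz2 hab).
have /dvdnP[k ok] := card_T4 nz2; have T0 := cardG_gt0 T.
rewrite pi_ofM // inE => /orP[|//]; rewrite pi_of_prime // inE => /eqP->.
by rewrite mem_primes T0 ok; apply: dvdn_mull.
Qed.

(** As 4 divides q - eps, the other factor q + eps of q^2 - 1 is 2k with k odd, and it differs from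
    q - eps by 2. A prime of pi dividing k would also divide q - eps, hence 2. *)
Lemma arith_a_part : arith_a pi q S -> (#|S|`_pi = #|D0|`_pi)%N.
Proof.
move=> ar; have T0 := cardG_gt0 T; have /dvdnP[c oc] := card_T4 nz2.
have q1 : (1 < q)%N by apply: finNzRing_gt1.
have [k [ek [ok e2]]] : exists k, (q ^ 2 - 1 = #|T| * (2 * k))%N /\ odd k /\
    (2 * k = #|T| + 2 \/ #|T| = 2 * k + 2)%N.
  case: q_sub_eps_cases oc => -> oc.
    by exists (2 * c + 1)%N; split; [nia | lia].
  by exists (2 * c - 1)%N; split; [nia | lia].
have k0 : (0 < k)%N by case: (k) ok.
rewrite (card_D0 nz2 hab) partS ek mulnA (mulnC _ 2) partnM ?muln_gt0 ?T0 //.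
rewrite [X in (_ * X)%N]part_p'nat ?muln1 //.
apply/pnatP=> // r pr rk; rewrite inE /=; apply/negP=> pir.
have : r \in [predI pi & \pi(S)].
  rewrite inE /= pir; apply: pi_sub_SL; rewrite ek mem_primes pr.
  by rewrite !muln_gt0 T0 k0 !dvdn_mull.
move/ar; rewrite -q_sub_epsP mem_primes => /and3P[_ _ rT].
have r2 : r != 2 by apply/eqP=> e; move: rk; rewrite e dvdn2 ok.
case/negP: r2; rewrite -dvdn_prime2 //.
have r2k : r %| (2 * k)%N by rewrite dvdn_mull.
case: e2 => e2; first by move: r2k; rewrite e2 dvdn_addr.
by move: rT; rewrite e2 dvdn_addr.
Qed.

Lemma arith_a_E : arith_a pi q S -> E_pi pi S.
Proof.
move=> ar; have [H hH] := Hall_exists pi (D0_solvable nz2 hab).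
exists H; have [sHD _ _] := and3P hH; apply/pHallP.
split; first exact: subset_trans sHD (subsetIl _ _).
by rewrite arith_a_part // (card_Hall hH).
Qed.

Lemma Hall_types H : pi.-Hall(S) H ->
  [\/ [/\ arith_a pi q S, type_a pi q S H & all_conjugate S (type_a pi q S)],
      [/\ arith_b pi q S, type_b pi S H & all_conjugate S (type_b pi S)],
      [/\ arith_c pi q S, type_c pi S H & swapped_classes S (type_c pi S)] |
      [/\ arith_d pi q S, type_d pi S H & swapped_classes S (type_d pi S)]].
Proof.
move=> hH; have oS : (#|S|`_pi = #|H|)%N by case/pHallP: hH.
have arith N rho : #|H| = N -> \pi(N) =i rho ->
    [predI pi & \pi(S)] =i rho /\ ((q ^ 2 - 1)`_rho = N)%N.
  by move=> oH; apply: (partn_SL_eq p_prime oF p_pi); rewrite oS.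
have [aa|] := Hall_cases cp nz2 nz3 hab pi2 pi3 p_pi hH.
  constructor 1; split; first exact: almost_abelian_arith_a aa.
    exact: (almost_abelian_type_a cp nz2 nz3 hab pi2 pi3 oddq hH aa).
  exact: (type_a_conjugate cp nz2 nz3 hab pi2 pi3 p_pi oddq).
case=> tH; have [oH _] := tH.
- constructor 2; split; first exact: arith oH pi_of_24.
    exact: (tetrahedral_type_b cp nz2 nz3 hab).
  exact: (type_b_conjugate cp nz2 nz3 hab).
- constructor 3; split; first exact: arith oH pi_of_48.
    exact: (octahedral_type_c cp nz2 nz3 hab).
  by apply: (type_c_swapped cp nz2 nz3 hab) => //; rewrite oS.
have nz5 : (5%:R != 0 :> F)%R by apply: pi120_nz5; rewrite oS.
constructor 4; split; first exact: arith oH pi_of_120.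
  exact: (icosahedral_type_d cp nz2 nz3 hab).
by apply: (type_d_swapped cp nz2 nz3 nz5 hab) => //; rewrite oS.
Qed.

Lemma arith_E_pi : [\/ arith_a pi q S, arith_b pi q S, arith_c pi q S | arith_d pi q S] ->
  E_pi pi S.
Proof.
have eqN rho N : [predI pi & \pi(S)] =i rho -> ((q ^ 2 - 1)`_rho = N)%N -> (#|S|`_pi = N)%N.
  by move=> e <-; rewrite (partn_SL_rho p_prime oF p_pi e).
case=> [|[e o]|[e o]|[e o]]; first exact: arith_a_E.
- by have [_ hN _] := NQ_Hall24 cp nz2 nz3 hab pi2 pi3 p_pi (eqN _ _ e o); exists NQ.
- by have [_ hN _] := NQ_Hall48 cp nz2 nz3 hab pi2 pi3 p_pi (eqN _ _ e o); exists NQ.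
have oS := eqN _ _ e o; have nz5 := pi120_nz5 oS.
have [_ d5 _] := pi120 cp nz2 nz3 hab pi2 oS.
have [t et] := golden_ratio nz2 d5 nz5.
by have [hI _] := icosa_Hall cp nz2 nz3 nz5 hab pi2 pi3 p_pi et oS; exists (icosa a b t).
Qed.

(** Type (a) contributes at most one class. The pi-part of the order equals at most one of 24, 48
    and 120, so the other types together contribute at most two. *)
Lemma k_pi_SL : E_pi pi S -> k_pi pi S \in [:: 1; 2; 3]%N.
Proof.
case=> H0 hH0; rewrite /k_pi.
have k0 : (0 < #|classes_of S (fun H => pi.-Hall(S) H)|)%N.
  rewrite card_gt0; apply/set0Pn; exists (H0 :^: S); apply/imsetP; exists H0 => //.
  by rewrite inE.
have ca := card_classes_all_conjugate (type_a_conjugate cp nz2 nz3 hab pi2 pi3 p_pi oddq).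
have cb : (#|classes_of S (type_b pi S)| <= (#|S|`_pi == 24))%N.
  have [e|n] := eqVneq (#|S|`_pi)%N 24.
    exact: card_classes_all_conjugate (type_b_conjugate cp nz2 nz3 hab pi2 pi3 p_pi).
  rewrite classes_of_pred0 // => H tH; case/eqP: n; case/andP: (tH) => /pHallP[_ <-] _.
  by have [] := type_b_tetra cp nz2 nz3 hab pi2 pi3 p_pi tH.
have cc : (#|classes_of S (type_c pi S)| <= 2 * (#|S|`_pi == 48))%N.
  have [e|n] := eqVneq (#|S|`_pi)%N 48.
    exact: card_swapped_classes (type_c_swapped cp nz2 nz3 hab pi2 pi3 p_pi e).
  rewrite classes_of_pred0 // => H tH; case/eqP: n; case/andP: (tH) => /pHallP[_ <-] _.
  by have [] := type_c_octahedral cp nz2 nz3 hab pi2 pi3 p_pi tH.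
have cd : (#|classes_of S (type_d pi S)| <= 2 * (#|S|`_pi == 120))%N.
  have [e|n] := eqVneq (#|S|`_pi)%N 120.
    exact: card_swapped_classes (type_d_swapped cp nz2 nz3 (pi120_nz5 e) hab pi2 pi3 p_pi e).
  rewrite classes_of_pred0 // => H tH; case/eqP: n.
  case/andP: (tH) => hH iH; case/pHallP: hH => _ <-.
  rewrite (card_quotient_center cp nz2 nz3 hab pi2 pi3 p_pi) ?(card_isog iH); last by case/andP: tH.
  by rewrite card_Alt card_ord.
have inC (P : pred {group GLT F}) H : P H -> H :^: S \in classes_of S P.
  by move=> PH; apply/imsetP; exists H; rewrite ?inE.
have sub : classes_of S (fun H => pi.-Hall(S) H) \subset classes_of S (type_a pi q S) :|:
    (classes_of S (type_b pi S) :|: (classes_of S (type_c pi S) :|: classes_of S (type_d pi S))).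
  apply/subsetP=> C /imsetP[H]; rewrite inE => hH ->; rewrite !in_setU; apply/or4P.
  have [[_ tH _]|[_ tH _]|[_ tH _]|[_ tH _]] := Hall_types hH;
    [constructor 1|constructor 2|constructor 3|constructor 4]; exact: inC.
have l : (#|classes_of S (fun H => pi.-Hall(S) H)|
    <= 1 + ((#|S|`_pi == 24) + (2 * (#|S|`_pi == 48) + 2 * (#|S|`_pi == 120))))%N.
  apply: leq_trans (subset_leq_card sub) _.
  do 3!(apply: leq_trans (leq_card_setU _ _) _; apply: leq_add => //).
have {l} : (#|classes_of S (fun H => pi.-Hall(S) H)| <= 3)%N.
  apply: leq_trans l _; case: eqP => [->|_] //; case: eqP => [->|_] //.
  by case: eqP.
by move: k0; case: #|_| => [|[|[|[|]]]].
Qed.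

Lemma conjg_odd_exp (gT : finGroupType) (x y : gT) k : x ^ y = x^-1 -> odd k ->
  x ^ (y ^+ k) = x^-1.
Proof.
move=> e; have e2 c : x ^ (y ^+ c.*2) = x.
  elim: c => [|c IH]; first by rewrite conjg1.
  by rewrite doubleS !expgS !conjgM e conjVg e invgK.
by move=> ok; rewrite -(odd_double_half k) ok expgS conjgM e conjVg e2.
Qed.

(** w and its inverse have the same trace, hence are conjugate by some u. Raising u to the odd part
    of its order leaves a 2-element that still inverts w, so only the primes 2 and 3 occur. *)
Lemma pi_group_inverting : exists n, [/\ n \in S, pi.-group (<[w]> <*> <[n]>) & w ^ n = w^-1].
Proof.
have Sw : w \in S by apply: qw_SL.
have ow : #[w] = 3 by rewrite (order_w nz2 nz3 hab).
have tw : trg w = (-1)%R by apply: trg_qw.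
have ewV : w^-1 = w * w.
  by apply: (mulgI w); rewrite mulgV; apply/esym/qw3.
have nw : ~~ scalarg w.
  rewrite scalar_SL // mem_cycle_mone //; apply/negP=> /orP[]/eqP e; move: ow; rewrite e ?order1 //.
  by rewrite order_mone.
have tV : trg w^-1 = trg w.
  have -> : trg w^-1 = (trg w ^+ 2 - 2%:R)%R.
    by rewrite ewV {1}/trg !sqrg_ent // !ent1 /trg; ring.
  by rewrite tw; ring.
have [u Su wu] : exists2 u, u \in S & w ^ u = w^-1.
  apply: same_trace_conj => //; first by rewrite groupV.
    apply: contra nw => sV; rewrite scalar_SL // in sV; last by rewrite groupV.
    by rewrite scalar_SL // -groupV.
  rewrite tw; apply: contra nz3 => /eqP e; apply/eqP; apply: (eq_of_sub (esym e)); ring.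
pose k := (#[u]`_2^')%N; exists (u ^+ k); split.
- exact: groupX.
- have wn : w ^ (u ^+ k) = w^-1.
    by apply: conjg_odd_exp; rewrite // odd_2'nat part_pnat.
  rewrite norm_joinEr; last first.
    by rewrite cycle_subG; apply/normP; rewrite -cycleJ wn cycleV.
  rewrite pgroupM; apply/andP; split.
    by rewrite /pgroup -orderE ow pnatE.
  have : 2.-elt (u ^+ k).
    rewrite /p_elt orderXdiv ?dvdn_part //.
    by rewrite -{1}(partnC 2 (order_gt0 u)) mulnK ?part_gt0 // part_pnat.
  by apply: sub_in_pnat => r _ /eqnP->.
by apply: conjg_odd_exp; rewrite // odd_2'nat part_pnat.
Qed.

(** In type (a) L is [NQ], where two elements of order 3 do not commute. In type (b) L inverts an
    element of order 3, while in a tetrahedral group centralizers of order 6 are their own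
    normalizers. In types (c) and (d) L is a Hall subgroup of the other class. *)
Lemma no_dominating_Hall H : pi.-Hall(S) H -> exists L : {group GLT F},
  [/\ L \subset S, pi.-group L & forall x, x \in S -> ~~ (L :^ x \subset H)].
Proof.
move=> hH; have [sHS piH _] := and3P hH.
have other (P : pred {group GLT F}) : swapped_classes S P -> P H ->
    (forall L, P L -> pi.-Hall(S) L) -> exists L : {group GLT F},
    [/\ L \subset S, pi.-group L & forall x, x \in S -> ~~ (L :^ x \subset H)].
  move=> sw PH Ph; have [L PL n] := swapped_classes_other sw PH.
  have [sLS piL _] := and3P (Ph _ PL); exists L; split=> // x Sx; apply: contra (n x Sx) => sLH.
  rewrite eqEcard sLH cardJg; case/pHallP: (Ph _ PL) => _ ->.
  by case/pHallP: hH => _ ->; rewrite leqnn.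
have [[_ tH _]|[_ tH _]|[_ tH sw]|[_ tH sw]] := Hall_types hH.
- have aa := type_a_almost_abelian cp nz2 nz3 hab pi2 pi3 p_pi oddq tH.
  exists NQ; split; first exact: subsetIl.
    exact: (pi_group_24_48 pi2 pi3 (card_NQ cp nz2 nz3 hab)).
  move=> x Sx; apply/negP=> sNH.
  have inH g : g \in NQ -> g ^ x \in H by move=> Ng; apply: (subsetP sNH); rewrite memJ_conjg.
  have := almost_abelian_commute aa (inH _ (w_NQ nz2 hab)) (inH _ (wi_NQ nz2 hab)).
  rewrite !orderJ (order_w nz2 nz3 hab) => /(_ isT isT)/(commuteJ x^-1); rewrite !conjgK.
  apply: (Q8_order3_noncommute (order_mone nz2) (qi2 F) (qj2 hab) (qji hab) (@mone_central F)
    (qi_qw nz2 hab) (qj_qw nz2 hab)).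
  by rewrite (order_w nz2 nz3 hab).
- have [n [Sn piL wn]] := pi_group_inverting.
  exists (<[w]> <*> <[n]>)%G; split=> //.
    by rewrite join_subG !cycle_subG qw_SL.
  move=> x Sx; apply/negP=> sLH.
  have tetH := type_b_tetra cp nz2 nz3 hab pi2 pi3 p_pi tH; have [_ [ty _ _]] := tetH.
  have hyp := Hall_dickson cp nz2 nz3 hab pi2 pi3 p_pi hH.
  have inH g : g \in <[w]> <*> <[n]> -> g ^ x \in H.
    by move=> Lg; apply: (subsetP sLH); rewrite memJ_conjg.
  have Hw : w ^ x \in H by apply: inH; rewrite (subsetP (joing_subl _ _)) ?cycle_id.
  have Hn : n ^ x \in H by apply: inH; rewrite (subsetP (joing_subr _ _)) ?cycle_id.
  have uk : (w ^ x) ^ (n ^ x) = (w ^ x)^-1 by rewrite -conjJg wn conjVg.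
  move: (w ^ x) (n ^ x) (orderJ w x) uk Hw Hn => u k.
  rewrite (order_w nz2 nz3 hab) => ou uk Hu Hk.
  have nu : u \notin <[m]> by apply: (notin_center_order hyp); rewrite ou.
  have Hu' : u \in H :\: <[m]> by rewrite in_setD nu.
  have Cu : u \in 'C_H[u] by rewrite inE Hu cent1id.
  have d3 := order_dvdG Cu; rewrite ou in d3.
  have oN : #|'N_H('C_H[u])| = #|'C_H[u]|.
    by have := ty _ Hu'; rewrite !inE => /orP[]/eqP[e1 e2]; rewrite e1 ?e2 in d3 *.
  have eN : 'C_H[u] = 'N_H('C_H[u]).
    by apply/eqP; rewrite eqEcard oN leqnn andbT subsetI subsetIl normG.
  have : k \in 'C_H[u].
    rewrite eN inE Hk; apply/normP; rewrite conjIg conjGid // -cent1J uk.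
    by rewrite -(cent_cycle u^-1) cycleV cent_cycle.
  rewrite inE => /andP[_ /cent1P c]; have : u = u^-1.
    by rewrite -uk; apply/esym/conjg_fixP/commgP/commute_sym.
  move=> eu; have : #[u] %| 2 by rewrite order_dvdn expgS expg1 {2}eu mulgV.
  by rewrite ou.
- by apply: (other _ sw tH) => L /andP[].
by apply: (other _ sw tH) => L /andP[].
Qed.

End HallSubgroups.

(** * Transfer along an isomorphism *)

Section Transfer.

Variables (gT rT : finGroupType) (G : {group gT}) (S : {group rT}).
Variable f : {morphism G >-> rT}.
Hypothesis iso : isom G S f.
Variable pi : nat_pred.
Implicit Types (H : {group gT}) (X : {group rT}).

Let injf : 'injm f. Proof. by case/isomP: iso. Qed.
Let eS : f @* G = S. Proof. by case/isomP: iso. Qed.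

Lemma card_isom_eq : #|G| = #|S|.
Proof. by rewrite -eS card_injm. Qed.

Lemma transfer_Hall H : H \subset G -> pi.-Hall(S) (f @* H) = pi.-Hall(G) H.
Proof. by move=> sHG; rewrite -eS injm_pHall. Qed.

Lemma transfer_quotient : exists g : {morphism (G / 'Z(G)) >-> coset_of 'Z(S)},
  [/\ 'injm g, g @* (G / 'Z(G)) = S / 'Z(S) &
      forall H, g @* (H / 'Z(G)) = (f @* H) / 'Z(S)].
Proof.
have -> : 'Z(S) = f @* 'Z(G) by rewrite injm_center ?eS.
rewrite -eS; exists [morphism of quotm f (center_normal G)]; split.
- exact: injm_quotm.
- by rewrite morphim_quotm.
by move=> H; rewrite morphim_quotm.
Qed.

Lemma transfer_isog (aT : finGroupType) (A : {group aT}) H : H \subset G ->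
  ((f @* H) / 'Z(S) \isog A) = (H / 'Z(G) \isog A).
Proof.
move=> sHG; have [g [injg _ eg]] := transfer_quotient.
rewrite -eg; apply/esym; apply: (@isog_transl _ _ _ (H / 'Z(G))%G).
by apply: sub_isog => //; apply: quotientS.
Qed.

Lemma transfer_type_a q H : H \subset G -> type_a pi q S (f @* H)%G = type_a pi q G H.
Proof.
move=> sHG; rewrite /type_a /= transfer_Hall //; congr (_ && _).
have [g [injg eg egH]] := transfer_quotient.
have sHZ : H / 'Z(G) \subset G / 'Z(G) by apply: quotientS.
apply/existsP/existsP=> -[D /and3P[sD iD hD]].
  have eD : g @* (g @*^-1 D) = D by rewrite morphpreK // eg.
  have sD' : g @*^-1 D \subset G / 'Z(G) by apply: subsetIl.
  exists (g @*^-1 D)%G; apply/and3P; split=> //=.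
    by rewrite (isog_transl _ (sub_isog sD' injg)) /= eD.
  by rewrite -(injm_pHall injg) //= eD egH.
exists (g @* D)%G; apply/and3P; split=> /=.
- by rewrite -eg morphimS.
- by rewrite -(isog_transl _ (sub_isog sD injg)).
by rewrite -egH injm_pHall.
Qed.

Lemma transfer_type_b H : H \subset G -> type_b pi S (f @* H)%G = type_b pi G H.
Proof. by move=> sHG; rewrite /type_b /= transfer_Hall // transfer_isog. Qed.

Lemma transfer_type_c H : H \subset G -> type_c pi S (f @* H)%G = type_c pi G H.
Proof. by move=> sHG; rewrite /type_c /= transfer_Hall // transfer_isog. Qed.

Lemma transfer_type_d H : H \subset G -> type_d pi S (f @* H)%G = type_d pi G H.
Proof. by move=> sHG; rewrite /type_d /= transfer_Hall // transfer_isog. Qed.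

Section Predicates.

Variables (P : pred {group gT}) (P' : pred {group rT}).
Hypothesis sP : forall H, P H -> H \subset G.
Hypothesis sP' : forall X, P' X -> X \subset S.
Hypothesis eP : forall H, H \subset G -> P' (f @* H)%G = P H.

Lemma transfer_all_conjugate : all_conjugate S P' -> all_conjugate G P.
Proof.
move=> cj H1 H2 P1 P2; have [s1 s2] := (sP P1, sP P2).
have [Q1 Q2] : P' (f @* H1)%G /\ P' (f @* H2)%G by rewrite !eP.
have [x + e] := cj _ _ Q1 Q2.
rewrite -eS => /morphimP[y Gy _ ex]; exists y => //.
apply: (injm_morphim_inj injf) => //; first by rewrite -(conjGid Gy) conjSg.
by rewrite morphimJ // -ex.
Qed.

Definition back (C : {set {set rT}}) : {set {set gT}} := [set f @*^-1 A | A in C : {set {set rT}}].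

Lemma back_class H : H \subset G -> back ((f @* H) :^: S) = H :^: G.
Proof.
move=> sHG; apply/setP=> A; apply/imsetP/imsetP.
  case=> _ /imsetP[x + ->] ->; rewrite -eS => /morphimP[y Gy _ ->].
  by exists y => //; rewrite -morphimJ // injmK // -(conjGid Gy) conjSg.
case=> y Gy ->; exists (f @* H :^ f y); last first.
  by rewrite -morphimJ // injmK // -(conjGid Gy) conjSg.
by apply/imsetP; exists (f y); rewrite // -eS mem_morphim.
Qed.

Lemma pre_sub X : X \subset S -> f @* (f @*^-1 X) = X.
Proof. by move=> sXS; rewrite morphpreK // eS. Qed.

Lemma back_classes : classes_of G P = back @: classes_of S P'.
Proof.
apply/setP=> C; apply/imsetP/imsetP.
  case=> H; rewrite inE => PH ->; have sHG := sP PH.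
  exists ((f @* H) :^: S); last by rewrite back_class.
  by apply/imsetP; exists (f @* H)%G; rewrite ?inE ?eP.
case=> _ /imsetP[X + ->] ->; rewrite inE => PX; have sXS := sP' PX.
have sH : f @*^-1 X \subset G by apply: subsetIl.
exists (f @*^-1 X)%G; last by rewrite -back_class /= ?pre_sub.
rewrite inE -eP //; suff -> : (f @* (f @*^-1 X))%G = X by [].
by apply: val_inj; rewrite /= pre_sub.
Qed.

Lemma card_back_classes : (#|classes_of G P| <= #|classes_of S P'|)%N.
Proof. by rewrite back_classes; apply: leq_imset_card. Qed.

Lemma sub_classes C A : C \in classes_of S P' -> A \in C -> A \subset S.
Proof.
case/imsetP=> X; rewrite inE => PX -> /imsetP[x Sx ->].
by rewrite -(conjGid Sx) conjSg; apply: sP'.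
Qed.

(** Keeps the two classes distinct when they are pulled back. It is restricted to actual classes
    because a preimage only sees the part of a set inside S. *)
Lemma back_inj : {in classes_of S P' &, injective back}.
Proof.
have im C : C \in classes_of S P' -> [set f @* A | A in back C] = C.
  move=> hC; apply/setP=> A; apply/imsetP/idP.
    by case=> _ /imsetP[B CB ->] ->; rewrite morphpreK // eS (sub_classes hC CB).
  move=> CA; exists (f @*^-1 A); first by apply/imsetP; exists A.
  by rewrite morphpreK // eS (sub_classes hC CA).
by move=> C1 C2 h1 h2 e; rewrite -(im _ h1) -(im _ h2) e.
Qed.

Lemma transfer_swapped eta q (K : finFieldType) (phi : {morphism G >-> {'GL_2[K]}}) :
  (forall b : rT, exists2 u, u \in PGL2 eta q K &
     forall A : {set gT}, A \subset G -> PGL2_conj phi u A = f @*^-1 ((f @* A) :^ b)) ->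
  swapped_classes S P' -> two_classes_swapped eta q phi P.
Proof.
move=> act [C1 [C2 [n12 e12 [b [s12 s21]]]]].
have [h1 h2] : C1 \in classes_of S P' /\ C2 \in classes_of S P'.
  by rewrite e12 !inE !eqxx orbT.
exists (back C1), (back C2); split.
- by apply: contra n12 => /eqP/back_inj->.
- by rewrite back_classes e12 imsetU1 imset_set1.
have [u Pu eu] := act b; exists u; split=> //.
  rewrite -s12 /back -!imset_comp; apply: eq_in_imset => A CA /=.
  by rewrite eu ?subsetIl // morphpreK // eS (sub_classes h1 CA).
rewrite -[in RHS]s21 /back -!imset_comp; apply: eq_in_imset => A CA /=.
by rewrite eu ?subsetIl // morphpreK // eS (sub_classes h2 CA).
Qed.

End Predicates.

Lemma transfer_no_dominating :
  (forall X, pi.-Hall(S) X -> exists L : {group rT},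
    [/\ L \subset S, pi.-group L & forall x, x \in S -> ~~ (L :^ x \subset X)]) ->
  forall H, pi.-Hall(G) H -> exists L : {group gT},
    [/\ L \subset G, pi.-group L & forall x, x \in G -> ~~ (L :^ x \subset H)].
Proof.
move=> nd H hH; have [sHG _ _] := and3P hH; rewrite -transfer_Hall // in hH.
have [L [sLS piL n]] := nd (f @* H)%G hH; have eL := pre_sub sLS.
have sL : f @*^-1 L \subset G by apply: subsetIl.
exists (f @*^-1 L)%G; split=> //.
  by rewrite /pgroup -(card_injm injf) //= eL.
move=> x Gx; have Sx : f x \in S by rewrite -eS mem_morphim.
apply: contra (n _ Sx) => s; rewrite -{1}eL -morphimJ //; exact: morphimS.
Qed.

End Transfer.

(** W is a mere set because [GL2] is one. The representative differs from v by a factor centralizing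
    U, which has no effect on conjugates of subsets of U. *)
Lemma coset_center_repr (gT : finGroupType) (W : {set gT}) (U : {group gT}) v :
  W = U -> v \in U -> coset 'Z(W) v \in W / 'Z(W) /\
  exists2 z, z \in 'C(U) & repr (coset 'Z(W) v) = z * v.
Proof.
move=> -> Uv; have Nv : v \in 'N('Z(U)) by apply: (subsetP (normal_norm (center_normal U))).
split; first exact: mem_quotient.
have := mem_repr_coset (coset 'Z(U) v); rewrite val_coset // => /rcosetP[z Zz ->].
by exists z => //; case/setIP: Zz.
Qed.

Lemma conjsg_eq_in (gT : finGroupType) (A : {set gT}) x y :
  {in A, forall g, g ^ x = g ^ y} -> A :^ x = A :^ y.
Proof. by move=> e; apply: eq_in_imset. Qed.

(** * Replacing SL_2^eta(q) by SL_2 over the field of q elements *)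

Section Model.

Variables (eta : sign) (q : nat) (K F : finFieldType).
Variables (gT : finGroupType) (G : {group gT}) (phi : {morphism G >-> {'GL_2[K]}}).
Hypothesis phi_iso : isom G (SL2 eta q K) phi.
Variables (theta : GLT F -> {'GL_2[K]}) (U : {group {'GL_2[K]}}).
Hypothesis thetaM : {morph theta : g h / g * h}.
Hypothesis theta_inj : injective theta.
Hypothesis theta_im : theta @: SLg F = SL2 eta q K.
Hypothesis eU : GL2 eta q K = U.
(** In the unitary case [theta b] is unitary only after multiplication by a scalar, so only its
    action by conjugation is compared with U. *)
Hypothesis theta_conj : forall b, exists2 v, v \in U &
  {in SL2 eta q K, forall g, g ^ v = g ^ theta b}.

Let phi_image : 'injm phi /\ phi @* G = SL2 eta q K.
Proof.
(* [SL2] is only a set; as the image of a group under a morphism it becomes a group, to which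
   [isomP] applies. *)
pose th := Morphism (in2W thetaM : {in [set: GLT F] &, {morph theta : g h / g * h}}).
have eV : SL2 eta q K = th @* SLg F by rewrite morphimEsub ?subsetT.
by move: phi_iso; rewrite eV => /isomP.
Qed.

Let phiSL x : x \in G -> phi x \in SL2 eta q K.
Proof. by case: phi_image => _ <- Gx; apply: mem_morphim. Qed.

Let sSL : SL2 eta q K \subset U.
Proof. by rewrite -eU; apply/subsetP=> g; rewrite inE => /andP[]. Qed.

Definition model_map x : GLT F := odflt 1 [pick b in SLg F | theta b == phi x].

Lemma model_mapP x : x \in G -> model_map x \in SLg F /\ theta (model_map x) = phi x.
Proof.
move=> Gx; rewrite /model_map; case: pickP => [b /andP[Sb /eqP e]|n] //.
have := phiSL Gx; rewrite -theta_im => /imsetP[b Sb e].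
by have := n b; rewrite Sb e eqxx.
Qed.

Lemma model_mapM : {in G &, {morph model_map : x y / x * y}}.
Proof.
move=> x y Gx Gy; apply: theta_inj; rewrite thetaM.
by rewrite !(model_mapP _).2 ?groupM // morphM.
Qed.

Definition model_morphism := Morphism model_mapM.

Lemma model_isom : isom G (SLg F) model_morphism.
Proof.
have [injphi ephi] := phi_image.
apply/isomP; split.
  apply/injmP=> x y Gx Gy /(congr1 theta).
  by rewrite !(model_mapP _).2 //; apply: (injmP injphi).
apply/setP=> b; apply/morphimP/idP => [[x _ Gx ->]|Sb]; first by case: (model_mapP Gx).
have : theta b \in SL2 eta q K by rewrite -theta_im imset_f.
rewrite -ephi => /morphimP[x Gx _ e]; exists x => //.
by apply: theta_inj; rewrite /= (model_mapP Gx).2.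
Qed.

Let thetaJ g h : theta (g ^ h) = theta g ^ theta h.
Proof.
rewrite conjgE thetaM thetaM conjgE; congr (_ * _).
by apply: (mulgI (theta h)); rewrite mulgV -thetaM mulgV; apply: (mulgI (theta 1)); rewrite -thetaM !mulg1.
Qed.

Lemma model_act b : exists2 u, u \in PGL2 eta q K &
  forall A : {set gT}, A \subset G ->
    PGL2_conj phi u A = model_morphism @*^-1 ((model_morphism @* A) :^ b).
Proof.
have [v Uv ev] := theta_conj b; exists (coset 'Z(GL2 eta q K) v).
  by have [] := coset_center_repr eU Uv.
have [_ [z cz er]] := coset_center_repr eU Uv.
move=> A sAG; rewrite /PGL2_conj.
have -> : (phi @* A) :^ repr (coset 'Z(GL2 eta q K) v) = (phi @* A) :^ theta b.
  apply: conjsg_eq_in => g /morphimP[x Gx _ ->]; have Sx := phiSL Gx.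
  rewrite er conjgM -ev //; congr (_ ^ _).
  by apply/conjg_fixP/commgP/commute_sym; apply: (centP cz); apply: (subsetP sSL).
apply/setP=> x; rewrite !inE; case Gx: (x \in G) => //=.
apply/imsetP/imsetP=> -[_ /morphimP[y Gy Ay ->] e].
  exists (model_map y); first by apply/morphimP; exists y.
  by apply: theta_inj; rewrite thetaJ !(model_mapP _).2.
exists (phi y); first by apply/morphimP; exists y.
by move/(congr1 theta): e; rewrite /= thetaJ !(model_mapP _).2.
Qed.

End Model.

(** * The unitary model *)

Section FixedField.

Variables (K : finFieldType) (q : nat).
Hypothesis hq : [pchar K]%R.-nat q.
Local Open Scope ring_scope.

(* Additivity of x |-> x ^ q is a parameter so that the field structure of
   [fixed_field] can be inferred. *)
Definition frob_fixed of [pchar K]%R.-nat q : {pred K} := fun x => x ^+ q == x.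

Lemma frob_fixedE x : (x \in frob_fixed hq) = (x ^+ q == x).
Proof. by []. Qed.

Fact frob_fixed_divring : divring_closed (frob_fixed hq).
Proof.
split=> [|x y|x y]; rewrite !frob_fixedE.
- by rewrite expr1n.
- by move=> /eqP ex /eqP ey; rewrite exprDn_pchar // exprNn_pchar // ex ey.
by move=> /eqP ex /eqP ey; rewrite exprMn exprVn ex ey.
Qed.

HB.instance Definition _ := GRing.isDivringClosed.Build K (frob_fixed hq) frob_fixed_divring.

Record fixed_field := FixedField { fixed_val :> K; _ : fixed_val \in frob_fixed hq }.

HB.instance Definition _ := [isSub of fixed_field for fixed_val].
HB.instance Definition _ := [Finite of fixed_field by <:].
HB.instance Definition _ := [SubChoice_isSubIntegralDomain of fixed_field by <:].
HB.instance Definition _ := [SubIntegralDomain_isSubField of fixed_field by <:].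

End FixedField.

Section Quadratic.

Variables (K : finFieldType) (q : nat).
Hypothesis hq : [pchar K]%R.-nat q.
Hypothesis oddq : odd q.
Hypothesis cardK : #|K| = (q ^ 2)%N.
Local Open Scope ring_scope.

Let q1 : (1 < q)%N.
Proof.
have := finNzRing_gt1 K; rewrite cardK; case: (q) => [|[|n]] //.
Qed.

Lemma cyclic_generator : exists2 z : K, forall x, x != 0 -> exists k, x = z ^+ k &
  forall k, (z ^+ k == 1) = (q ^ 2 - 1 %| k)%N.
Proof.
have /cyclicP[u eu] := field_unit_group_cyclic [set: {unit K}]%G.
exists (\val u) => [x x0|k].
  have Ux : x \is a GRing.unit by rewrite unitfE.
  have : FinRing.Unit Ux \in <[u]>%g by rewrite -eu inE.
  by case/cycleP=> k e; exists k; rewrite -FinRing.val_unitX -e.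
rewrite -FinRing.val_unitX -FinRing.val_unit1 (inj_eq val_inj) -order_dvdn orderE -eu.
by rewrite card_finField_unit cardK subn1.
Qed.

Let oq : exists r, q = (2 * r + 1)%N /\ (0 < r)%N.
Proof. by exists q./2; move: q1 (odd_double_half q); rewrite oddq; move: q./2 => r; lia. Qed.

Let sqrt_m1 (z : K) k : (forall k, (z ^+ k == 1) = (q ^ 2 - 1 %| k)%N) ->
  (2 * k = q ^ 2 - 1)%N -> z ^+ k = -1.
Proof.
move=> ez e2; have : z ^+ k ^+ 2 == 1 by rewrite -exprM mulnC e2 ez.
rewrite sqrf_eq1 => /orP[|/eqP//]; rewrite ez => /dvdn_leq.
by have [r [eq r0]] := oq; move: e2; rewrite eq; nia.
Qed.

Let generator_neq0 (z : K) : (forall k, (z ^+ k == 1) = (q ^ 2 - 1 %| k)%N) -> z != 0.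
Proof.
move=> ez; have [r [eq r0]] := oq; apply/eqP=> z0; have := ez (q ^ 2 - 1)%N.
rewrite dvdnn z0 (_ : (q ^ 2 - 1 = (q ^ 2 - 2).+1)%N); last by rewrite eq; nia.
by rewrite expr0n /= eq_sym oner_eq0.
Qed.

Lemma antifixed_exists : exists de : K, de != 0 /\ de ^+ q = - de.
Proof.
have [z gz ez] := cyclic_generator; have [r [eq r0]] := oq.
have z0 := generator_neq0 ez.
(* With q = 2r + 1, the power q - 1 of this element is z^((q^2 - 1) / 2) = -1. *)
exists (z ^+ r.+1); split; first exact: expf_neq0.
rewrite -exprM (_ : r.+1 * q = r.+1 * (2 * r) + r.+1)%N; last by rewrite eq; nia.
by rewrite exprD (sqrt_m1 ez) ?mulN1r //; rewrite eq; nia.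
Qed.

Lemma norm_m1 : exists c : K, c * c ^+ q = -1.
Proof.
have [z gz ez] := cyclic_generator; have [r [eq r0]] := oq.
(* Here the exponent is r (q + 1) = (q^2 - 1) / 2. *)
exists (z ^+ r); rewrite -exprM -exprD; apply: (sqrt_m1 ez).
by rewrite eq; nia.
Qed.

Lemma fixed_power (z : K) k : (forall k, (z ^+ k == 1) = (q ^ 2 - 1 %| k)%N) -> z != 0 ->
  (z ^+ k) ^+ q = z ^+ k -> (q.+1 %| k)%N.
Proof.
move=> ez z0 e; have : z ^+ (k * q.-1) == 1.
  rewrite -(inj_eq (mulfI (expf_neq0 k z0))) mulr1 -exprD -mulnS prednK ?(ltnW q1) //.
  by rewrite exprM e.
rewrite ez (_ : (q ^ 2 - 1 = q.+1 * q.-1)%N); last by case: (q) q1 => // n _; rewrite /=; nia.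
by rewrite dvdn_pmul2r //; case: (q) q1 => [|[|]].
Qed.

(** A nonzero fixed element is a power of z^(q + 1), the norm of the generator z. *)
Lemma norm_onto (d : K) : d != 0 -> d ^+ q = d -> exists l, l * l ^+ q = d.
Proof.
have [z gz ez] := cyclic_generator; have z0 := generator_neq0 ez.
move=> /gz[k ->] /(fixed_power ez z0)/dvdnP[j ->].
by exists (z ^+ j); rewrite -exprM -exprD -mulnS.
Qed.

Lemma card_fixed : #|{: fixed_field hq}| = q.
Proof.
have [z gz ez] := cyclic_generator; have z0 := generator_neq0 ez.
rewrite card_sub.
pose A := [set z ^+ (k * q.+1) | k : 'I_q.-1].
have eA : [pred x | x \in frob_fixed hq] =i 0 |: A.
  move=> x; rewrite !inE frob_fixedE; apply/eqP/orP => [e|[/eqP->|/imsetP[k _ ->]]].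
  - have [->|x0] := eqVneq x 0; [by left | right].
    have [k ek] := gz x x0; rewrite ek in e; have /dvdnP[j ej] := fixed_power ez z0 e.
    have q0 : (0 < q.-1)%N by case: (q) q1 => [|[|]].
    apply/imsetP; exists (Ordinal (ltn_pmod j q0)); rewrite // ek ej /=.
    rewrite {1}(divn_eq j q.-1) mulnDl exprD (_ : z ^+ _ = 1) ?mul1r //.
    apply/eqP; rewrite ez -mulnA dvdn_mull // (_ : (q ^ 2 - 1 = q.-1 * q.+1)%N) //.
    by case: (q) q1 => // n _; rewrite /=; nia.
  - by rewrite expr0n; case: (q) q1.
  rewrite -exprM (_ : k * q.+1 * q = (q ^ 2 - 1) * k + k * q.+1)%N.
    by rewrite exprD exprM (eqP (_ : z ^+ (q ^ 2 - 1) == 1)) ?ez // expr1n mul1r.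
  by move: (nat_of_ord k) => c; have [r [-> _]] := oq; nia.
rewrite (eq_card eA) cardsU1 card_imset ?card_ord.
  rewrite (_ : 0 \notin A) ?add1n ?prednK ?(ltnW q1) //.
  by apply/imsetP=> -[k _ /eqP]; rewrite eq_sym expf_eq0 (negPf z0) andbF.
have inj (k l : nat) : (k <= l < q.-1)%N -> z ^+ (k * q.+1) = z ^+ (l * q.+1) -> k = l.
  case/andP=> lkl ll e; have : z ^+ ((l - k) * q.+1) == 1.
    rewrite -(inj_eq (mulfI (expf_neq0 (k * q.+1) z0))) mulr1 -exprD -mulnDl subnKC //.
    by rewrite e.
  rewrite ez (_ : (q ^ 2 - 1 = q.-1 * q.+1)%N); last by case: (q) q1 => // n _; rewrite /=; nia.
  rewrite dvdn_pmul2r // => /dvdn_leq l1; have := subn_gt0 k l; move: l1 ll lkl.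
  by move: q.-1 => n; lia.
move=> k l e; apply: val_inj; have [lkl|llk] := leqP k l.
  by apply: inj e; rewrite lkl ltn_ord.
by apply/esym; apply: inj (esym e); rewrite (ltnW llk) ltn_ord.
Qed.

End Quadratic.

Lemma mulg_eq1C (gT : finGroupType) (x y : gT) : x * y = 1 -> y * x = 1.
Proof. by move=> e; rewrite -[y](mulKg x) e mulg1 mulVg. Qed.

Lemma mulg_twist (gT : finGroupType) (s t u x y z : gT) :
  s * t * u * (x * (y * z)) = s * (t * (u * x * y)) * z.
Proof. by rewrite !mulgA. Qed.

Section Unitary.

Variables (K : finFieldType) (q : nat).
Hypothesis hq : [pchar K]%R.-nat q.
Hypothesis nz2 : (2%:R != 0 :> K)%R.
Implicit Types (g h k : GLT K).
Local Open Scope ring_scope.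

Let sD (x y : K) : (x + y) ^+ q = x ^+ q + y ^+ q. Proof. exact: exprDn_pchar. Qed.
Let sN (x : K) : (- x) ^+ q = - x ^+ q. Proof. exact: exprNn_pchar. Qed.
Let sM (x y : K) : (x * y) ^+ q = x ^+ q * y ^+ q. Proof. exact: exprMn. Qed.

Definition star g : GLT K :=
  gl (ent g 0 0 ^+ q) (ent g 1 0 ^+ q) (ent g 0 1 ^+ q) (ent g 1 1 ^+ q).

Lemma starE g : (ent (star g) 0 0 = ent g 0 0 ^+ q) * (ent (star g) 0 1 = ent g 1 0 ^+ q)
  * (ent (star g) 1 0 = ent g 0 1 ^+ q) * (ent (star g) 1 1 = ent g 1 1 ^+ q).
Proof.
apply: glE; rewrite -!sM -sN -sD expf_neq0 // (mulrC (ent g 1 0)); exact: detg_neq0.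
Qed.

Lemma starM g h : star (g * h)%g = (star h * star g)%g.
Proof. by apply: glP; rewrite !starE !entM !starE sD !sM; ring. Qed.

Lemma star1 : star 1%g = 1%g.
Proof. by apply: (mulgI (star 1%g)); rewrite mulg1 -starM mulg1. Qed.

Lemma starV g : star g^-1%g = (star g)^-1%g.
Proof. by apply: (mulIg (star g)); rewrite -starM mulgV star1 mulVg. Qed.

Lemma GU2P g : ((g : {'GL_2[K]}) \in GL2 Minus q K) = (g * star g == 1)%g.
Proof.
have e : GLval (g * star g)%g = GLval g *m conj_trmx q (GLval g).
  rewrite GL_MxE; congr (_ *m _); have s := starE g.
  by apply: mx2P; rewrite -/(ent (star g) _ _) ?s !mxE.
rewrite inE; apply/eqP/eqP=> h; last by rewrite -e h GL_1E.
by apply: val_inj; apply: (etrans e); rewrite h; apply/esym/GL_1E.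
Qed.

Lemma GU2_group : group_set (GL2 Minus q K).
Proof.
apply/group_setP; split=> [|g h]; first by rewrite (GU2P 1%g) star1 mulg1.
rewrite (GU2P g) (GU2P h) (GU2P (g * h)%g) starM => /eqP eg /eqP eh.
by rewrite !mulgA -(mulgA g h) eh mulg1 eg.
Qed.

Definition GU2 : {group GLT K} := Group GU2_group.

Lemma mem_GU2 g : (g \in GU2) = (star g * g == 1)%g.
Proof.
rewrite [LHS]GU2P; apply/eqP/eqP=> e.
  exact: mulg_eq1C e.
exact: mulg_eq1C e.
Qed.

Definition scal (x : K) : GLT K := gl x 0 0 x.

Lemma scalE (x : K) : x != 0 -> (ent (scal x) 0 0 = x) * (ent (scal x) 0 1 = 0)
  * (ent (scal x) 1 0 = 0) * (ent (scal x) 1 1 = x).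
Proof. by move=> x0; apply: glE; rewrite mul0r subr0 mulf_neq0. Qed.

Lemma scalM (x y : K) : x != 0 -> y != 0 -> (scal x * scal y)%g = scal (x * y).
Proof.
by move=> x0 y0; apply: glP; rewrite !entM !scalE ?mulf_neq0 //; ring.
Qed.

Lemma scal1 : scal 1 = 1%g.
Proof. by apply: glP; rewrite !scalE ?oner_neq0 // !ent1. Qed.

Lemma scal_scalarg (x : K) : x != 0 -> scalarg (scal x).
Proof. by move=> x0; rewrite /scalarg !scalE // !eqxx. Qed.

Lemma star_scal (x : K) : x != 0 -> star (scal x) = scal (x ^+ q).
Proof.
move=> x0; have q0 : (0 < q)%N by case/andP: hq.
move: (starE (scal x)) (scalE (expf_neq0 q x0)); rewrite !(scalE x0) expr0n -leqn0 leqNgt q0.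
move: (star _) (scal (x ^+ q)) => s y [[[s0 s1] s2] s3] [[[y0 y1] y2] y3].
by apply: glP; rewrite ?(s0, s1, s2, s3) ?(y0, y1, y2, y3).
Qed.

Definition transp g : GLT K := gl (ent g 0 0) (ent g 1 0) (ent g 0 1) (ent g 1 1).

Lemma transpE g : (ent (transp g) 0 0 = ent g 0 0) * (ent (transp g) 0 1 = ent g 1 0)
  * (ent (transp g) 1 0 = ent g 0 1) * (ent (transp g) 1 1 = ent g 1 1).
Proof. by apply: glE; rewrite (mulrC (ent g 1 0)); apply: detg_neq0. Qed.

Variables de c : K.
Hypotheses (de0 : de != 0) (hde : de ^+ q = - de) (hc : c * c ^+ q = -1).

(** Chosen so that [star base_change * base_change] is the alternating matrix [skew]. A matrix g
    over the fixed field has [star g] equal to its transpose and multiplies the alternating form by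
    det g, so its conjugate by this matrix multiplies the Hermitian form by det g. *)
Definition base_change : GLT K := gl 1 de c (- (c * de)).
Definition skew : GLT K := gl 0 (2%:R * de) (- (2%:R * de)) 0.

Let skewE : (ent skew 0 0 = 0) * (ent skew 0 1 = 2%:R * de)
  * (ent skew 1 0 = - (2%:R * de)) * (ent skew 1 1 = 0).
Proof. by apply: glE; rewrite mul0r sub0r oppr_eq0 mulf_neq0 ?oppr_eq0 ?mulf_neq0. Qed.

Let baseE : (ent base_change 0 0 = 1) * (ent base_change 0 1 = de)
  * (ent base_change 1 0 = c) * (ent base_change 1 1 = - (c * de)).
Proof.
have c0 : c != 0 by apply: contra_eq_neq hc => ->; rewrite mul0r eq_sym oppr_eq0 oner_eq0.
apply: glE; rewrite (_ : _ - _ = - (2%:R * (c * de))); last by ring.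
by rewrite oppr_eq0 !mulf_neq0.
Qed.

Lemma star_base_change : (star base_change * base_change)%g = skew.
Proof.
have := starE base_change; rewrite !baseE sN sM hde expr1n; move: baseE skewE.
move: (star base_change) base_change skew => s x y.
move=> [[[x0 x1] x2] x3] [[[y0 y1] y2] y3] [[[s0 s1] s2] s3].
apply: glP; rewrite !entM !(x0, x1, x2, x3, y0, y1, y2, y3, s0, s1, s2, s3);
  move: (c ^+ q) hc => d hd; ring: hd.
Qed.

Lemma transp_skew g : (transp g * (skew * g) = scal (detg g) * skew)%g.
Proof.
have d0 := detg_neq0 g.
rewrite /detg; move: d0 (transpE g) skewE => /scalE; rewrite /detg.
move: (scal _) (transp g) skew => s x y.
move=> [[[s0 s1] s2] s3] [[[x0 x1] x2] x3] [[[y0 y1] y2] y3].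
by apply: glP; rewrite !entM !(x0, x1, x2, x3, y0, y1, y2, y3, s0, s1, s2, s3); ring.
Qed.

Lemma starJV g h : (star (g ^ h^-1) = (star h)^-1 * star g * star h)%g.
Proof. by rewrite conjgE invgK starM starM starV. Qed.

Lemma star_unitary g : (star (g ^ base_change^-1) * g ^ base_change^-1
  = (star base_change)^-1 * (star g * (skew * g)) * base_change^-1)%g.
Proof. by rewrite starJV -star_base_change conjgE invgK mulg_twist. Qed.

Lemma unitary_of_real g : star g = transp g ->
  (star (g ^ base_change^-1) * g ^ base_change^-1 = scal (detg g))%g.
Proof.
move=> e; rewrite star_unitary e transp_skew -star_base_change !mulgA mulgK.
have := scalarg_commute (star base_change)^-1%g (scal_scalarg (detg_neq0 g)).
by move<-; rewrite mulgKV.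
Qed.

Lemma real_of_unitary g : detg g = 1 -> (g ^ base_change^-1)%g \in GU2 -> star g = transp g.
Proof.
rewrite mem_GU2 star_unitary => d1 /eqP e.
have e2 : (star g * (skew * g) = skew)%g.
  apply: (mulgI (star base_change)^-1%g); apply: (mulIg base_change^-1%g); rewrite e.
  by rewrite -star_base_change mulKg mulgV.
apply: (mulIg (skew * g)%g); rewrite e2 transp_skew d1 scal1 mul1g //.
Qed.

End Unitary.

Section MinusModel.

Variables (K : finFieldType) (q : nat).
Hypothesis hq : [pchar K]%R.-nat q.
Hypothesis nz2 : (2%:R != 0 :> K)%R.
Hypothesis oddq : odd q.
Hypothesis cardK : #|K| = (q ^ 2)%N.
Local Open Scope ring_scope.

Notation F := (fixed_field hq : finFieldType).
Notation iota := (\val : F -> K).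
Implicit Types (b : GLT F) (g : GLT K).

Lemma fixed_valE (u : F) : iota u ^+ q = iota u.
Proof. by apply/eqP; rewrite -(frob_fixedE hq); apply: valP. Qed.

Lemma iotaM : {morph iota : u v / u * v}. Proof. exact: rmorphM. Qed.
Lemma iotaD : {morph iota : u v / u + v}. Proof. exact: rmorphD. Qed.
Lemma iotaN : {morph iota : u / - u}. Proof. exact: rmorphN. Qed.

Definition lift_gl b : GLT K :=
  gl (iota (ent b 0 0)) (iota (ent b 0 1)) (iota (ent b 1 0)) (iota (ent b 1 1)).

Let iota_det b : iota (ent b 0 0) * iota (ent b 1 1) - iota (ent b 0 1) * iota (ent b 1 0)
  = iota (detg b).
Proof. by rewrite /detg iotaD iotaN !iotaM. Qed.

Lemma lift_det0 b : iota (detg b) != 0.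
Proof. by rewrite fmorph_eq0; apply: detg_neq0. Qed.

Lemma liftE b : (ent (lift_gl b) 0 0 = iota (ent b 0 0))
  * (ent (lift_gl b) 0 1 = iota (ent b 0 1))
  * (ent (lift_gl b) 1 0 = iota (ent b 1 0))
  * (ent (lift_gl b) 1 1 = iota (ent b 1 1)).
Proof. by apply: glE; rewrite iota_det lift_det0. Qed.

Lemma detg_lift b : detg (lift_gl b) = iota (detg b).
Proof. by rewrite /detg !liftE -iota_det. Qed.

Lemma liftM : {morph lift_gl : b c / (b * c)%g}.
Proof. by move=> b c; apply: glP; rewrite !entM !liftE entM iotaD !iotaM. Qed.

Lemma lift_inj : injective lift_gl.
Proof.
move=> b c e; have f i j : ent (lift_gl b) i j = ent (lift_gl c) i j by rewrite e.
by apply: glP; apply: val_inj; [have := f 0 0 | have := f 0 1 | have := f 1 0 | have := f 1 1];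
  rewrite !liftE.
Qed.

Lemma star_lift b : star q (lift_gl b) = transp (lift_gl b).
Proof.
move: (starE hq (lift_gl b)) (transpE (lift_gl b)); rewrite !liftE !fixed_valE.
move: (star _ _) (transp _) => s y [[[s0 s1] s2] s3] [[[y0 y1] y2] y3].
by apply: glP; rewrite ?(s0, s1, s2, s3) ?(y0, y1, y2, y3).
Qed.

Lemma lift_real g : star q g = transp g -> exists b, lift_gl b = g.
Proof.
move=> e; have f i j : ent (star q g) i j = ent (transp g) i j by rewrite e.
have r x : x ^+ q = x -> exists u : F, iota u = x.
  by move=> /eqP ex; exists (FixedField (ex : x \in frob_fixed hq)).
have := (f 0 0, f 0 1, f 1 0, f 1 1); rewrite !(starE hq) !transpE.
case=> [[[/r[u00 e00] /r[u10 e10]] /r[u01 e01]] /r[u11 e11]].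
have D : u00 * u11 - u01 * u10 != 0.
  rewrite -(fmorph_eq0 iota) rmorphB !rmorphM /= e00 e01 e10 e11; exact: detg_neq0.
by exists (gl u00 u01 u10 u11); apply: glP; rewrite !liftE !(glE D).
Qed.

Lemma minus_model : #|F| = q /\ exists theta : GLT F -> {'GL_2[K]},
  [/\ {morph theta : g h / (g * h)%g}, injective theta, theta @: SLg F = SL2 Minus q K &
      forall b, exists2 v, v \in GU2 hq & {in SL2 Minus q K, forall g, (g ^ v = g ^ theta b)%g}].
Proof.
split; first exact: card_fixed.
have [de [de0 hde]] := antifixed_exists hq oddq cardK.
have [c hc] := norm_m1 hq oddq cardK.
pose B := base_change de c.
pose theta b : GLT K := (lift_gl b ^ B^-1)%g.
have detB g : detg (g ^ B^-1)%g = detg g by apply: detgJ.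
have real b : (star q (theta b) * theta b = scal (iota (detg b)))%g.
  by rewrite (unitary_of_real hq nz2 de0 hde hc) ?detg_lift ?star_lift.
have SU g : (g \in SL2 Minus q K) = (g \in GU2 hq) && (detg g == 1).
  by rewrite inE detgE.
exists theta; split.
- by move=> b1 b2; rewrite /theta liftM conjMg.
- by move=> b1 b2 e; apply: lift_inj; apply: (@conjg_inj _ B^-1%g); exact: e.
- apply/setP=> g; rewrite SU; apply/imsetP/andP => [[b /SLgP db ->]|[Ug /eqP dg]].
    by rewrite (mem_GU2 hq) real detB detg_lift db rmorph1 scal1 !eqxx.
  have [b eb] : exists b, lift_gl b = (g ^ B)%g.
    apply: lift_real; apply: (real_of_unitary (hq := hq) nz2 de0 hde hc); first by rewrite detgJ.
    by rewrite conjgK.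
  exists b; last by rewrite /theta eb conjgK.
  apply/SLgP; apply: val_inj; apply: (etrans (esym (detg_lift b))).
  by rewrite eb detgJ dg rmorph1.
move=> b; have d0 := lift_det0 b.
(* [theta b] multiplies the Hermitian form by det b; a scalar of norm 1 / det b makes it unitary and
   does not change the conjugation. *)
have [l hl] : exists l : K, l * l ^+ q = (iota (detg b))^-1.
  by apply: norm_onto => //; [exact: invr_neq0 | rewrite exprVn fixed_valE].
have l0 : l != 0 by apply: contra_eq_neq hl => ->; rewrite mul0r eq_sym invr_eq0.
have lq0 : l ^+ q != 0 by apply: expf_neq0.
have cl (g : GLT K) : commute (scal l) g by apply: scalarg_commute; apply: scal_scalarg.
exists (scal l * theta b)%g.
  rewrite (mem_GU2 hq) (starM hq) (star_scal hq) // mulgA -(mulgA (star q (theta b))) scalM //.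
  rewrite (mulrC _ l) hl.
  have <- := scalarg_commute (star q (theta b)) (scal_scalarg (invr_neq0 d0)).
  by rewrite -mulgA real scalM ?invr_neq0 // mulVf // scal1.
move=> g _; rewrite conjgM; congr (_ ^ _)%g.
by apply/conjg_fixP/commgP/commute_sym.
Qed.

End MinusModel.

Lemma exists_model (p f q : nat) (eta : sign) (K : finFieldType)
    (gT : finGroupType) (G : {group gT}) (phi : {morphism G >-> {'GL_2[K]}}) :
  prime p -> odd p -> q = (p ^ f)%N -> #|K| = (q ^ field_degree eta)%N ->
  isom G (SL2 eta q K) phi ->
  exists F : finFieldType, #|F| = q /\ exists psi : {morphism G >-> GLT F},
    isom G (SLg F) psi /\ forall b, exists2 u, u \in PGL2 eta q K &
      forall A : {set gT}, A \subset G ->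
        PGL2_conj phi u A = psi @*^-1 ((psi @* A) :^ b).
Proof.
move=> p_prime p_odd q_def cardK iso.
have oddq : odd q by rewrite q_def oddX p_odd orbT.
case: eta cardK iso => /= cardK iso.
  rewrite expn1 in cardK; exists K; split=> //.
  pose theta (b : GLT K) : {'GL_2[K]} := b.
  have thetaM : {morph theta : g h / g * h} by [].
  have theta_inj : injective theta by move=> g h.
  have theta_im : theta @: SLg K = SL2 Plus q K by rewrite SL2E; apply: imset_id.
  have eU : GL2 Plus q K = [set: {'GL_2[K]}]%G by [].
  have cj b : exists2 v, v \in [set: {'GL_2[K]}]%G & {in SL2 Plus q K, forall g, g ^ v = g ^ theta b}.
    by exists (theta b); rewrite ?inE.
  exists (model_morphism iso thetaM theta_inj theta_im); split.
    exact: model_isom.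
  exact: (model_act iso thetaM theta_inj theta_im eU cj).
have cp : p \in [pchar K]%R by apply: (@card_finPcharP _ _ (f * 2)); rewrite // cardK q_def expnM.
have hq : [pchar K]%R.-nat q by rewrite q_def pnatX pnatE ?cp.
have nz2 : (2%:R != 0 :> K)%R.
  rewrite -(dvdn_pcharf cp) dvdn_prime2 //; by apply: contraTneq p_odd => ->.
have [oF [theta [thetaM theta_inj theta_im cj]]] := minus_model hq nz2 oddq cardK.
exists (fixed_field hq : finFieldType); split=> //.
exists (model_morphism iso thetaM theta_inj theta_im); split.
  exact: model_isom.
exact: (model_act (U := GU2 hq) iso thetaM theta_inj theta_im erefl cj).
Qed.

Theorem lemma3p1 (pi : nat_pred) (p f q : nat) (eta : sign) (K : finFieldType)
    (gT : finGroupType) (G : {group gT}) (phi : {morphism G >-> {'GL_2[K]}})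
    (pi_primes : forall r, r \in pi -> prime r)
    (pi2 : 2 \in pi) (pi3 : 3 \in pi)
    (p_prime : prime p) (p_odd : odd p) (p_notin_pi : p \notin pi)
    (f_gt0 : 0 < f) (q_def : q = (p ^ f)%N)
    (cardK : #|K| = (q ^ field_degree eta)%N)
    (phi_iso : isom G (SL2 eta q K) phi) :
  [/\
      forall H : {group gT}, pi.-Hall(G) H ->
        [\/ [/\ arith_a pi q G, type_a pi q G H &
                all_conjugate G (type_a pi q G)],
            [/\ arith_b pi q G, type_b pi G H &
                all_conjugate G (type_b pi G)],
            [/\ arith_c pi q G, type_c pi G H &
                two_classes_swapped eta q phi (type_c pi G)] |
            [/\ arith_d pi q G, type_d pi G H &
                two_classes_swapped eta q phi (type_d pi G)]],
      [\/ arith_a pi q G, arith_b pi q G, arith_c pi q G | arith_d pi q G] ->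
        E_pi pi G,
      E_pi pi G -> k_pi pi G \in [:: 1; 2; 3]%N,
      (forall H : {group gT}, pi.-Hall(G) H ->
        exists L : {group gT},
          [/\ L \subset G, pi.-group L &
              forall x, x \in G -> ~~ (L :^ x \subset H)]) /\
      (E_pi pi G -> ~ D_pi pi G) &
      (forall L : {group coset_of 'Z(G)}, pi.-Hall(G / 'Z(G)) L ->
        exists2 H : {group gT}, pi.-Hall(G) H & L :=: H / 'Z(G)) /\
      (forall (L : {group coset_of 'Z(G)}) (H : {group gT}),
        pi.-Hall(G / 'Z(G)) L -> H :=: coset 'Z(G) @*^-1 L ->
        pi.-Hall(G) H)].
Proof.
have [F [oF [psi [iso act]]]] := exists_model p_prime p_odd q_def cardK phi_iso.
have oFp : #|F| = (p ^ f)%N by rewrite oF.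
have [a [b ab]] := binary_form_onto (-1)%R (oner_neq0 F).
have hab : (a ^+ 2 = -1 - b ^+ 2)%R by rewrite -ab; ring.
have eG := card_isom_eq iso.
have epi : [predI pi & \pi(G)] =i [predI pi & \pi(SLg F)] by move=> r; rewrite !inE /= eG.
have HallG H : pi.-Hall(G) H -> H \subset G by case/and3P.
have HallS (X : {group GLT F}) : pi.-Hall(SLg F) X -> X \subset SLg F by case/and3P.
have nd := transfer_no_dominating iso
  (no_dominating_Hall p_prime p_odd oFp pi2 pi3 p_notin_pi hab).
split.
- move=> H hH; have sHG := HallG _ hH.
  have hX : pi.-Hall(SLg F) (psi @* H)%G by rewrite (transfer_Hall iso).
  have := Hall_types p_prime p_odd oFp pi2 pi3 p_notin_pi hab hX.
  rewrite oF (transfer_type_a iso) // (transfer_type_b iso) // (transfer_type_c iso) //.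
  rewrite (transfer_type_d iso) //.
  have arith rho N : [predI pi & \pi(SLg F)] =i rho /\ N -> [predI pi & \pi(G)] =i rho /\ N.
    by case=> e n; split=> // r; rewrite epi e.
  case=> -[ar ty cj]; [constructor 1|constructor 2|constructor 3|constructor 4]; split=> //.
  + by move=> r; rewrite epi; apply: ar.
  + apply: (transfer_all_conjugate iso _ _ cj) => [X /andP[/HallG]|X sX] //.
    exact: transfer_type_a.
  + exact: arith.
  + apply: (transfer_all_conjugate iso _ _ cj) => [X /andP[/HallG]|X sX] //.
    exact: transfer_type_b.
  + exact: arith.
  + apply: (transfer_swapped iso _ _ _ act cj) => [X /andP[/HallG]|X /andP[/HallS]|X sX] //.
    exact: transfer_type_c.
  + exact: arith.
  + apply: (transfer_swapped iso _ _ _ act cj) => [X /andP[/HallG]|X /andP[/HallS]|X sX] //.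
    exact: transfer_type_d.
- have arith rho N : [predI pi & \pi(G)] =i rho /\ N -> [predI pi & \pi(SLg F)] =i rho /\ N.
    by case=> e n; split=> // r; rewrite -epi e.
  move=> ar; have : E_pi pi (SLg F).
    apply: (arith_E_pi p_prime p_odd oFp pi2 pi3 p_notin_pi hab); rewrite oF.
    case: ar => ar; [constructor 1|constructor 2|constructor 3|constructor 4].
    + by move=> r; rewrite -epi; apply: ar.
    + exact: arith.
    + exact: arith.
    exact: arith.
  case=> X hX; exists (psi @*^-1 X)%G; rewrite -(transfer_Hall iso) ?subsetIl //=.
  by rewrite (pre_sub iso) ?HallS.
- case=> H hH; have EpiS : E_pi pi (SLg F).
    by exists (psi @* H)%G; rewrite (transfer_Hall iso) // HallG.
  have kS := k_pi_SL p_prime p_odd oFp pi2 pi3 p_notin_pi hab EpiS.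
  have : (k_pi pi G <= k_pi pi (SLg F))%N.
    apply: (card_back_classes iso) => X; [exact: HallG | exact: HallS |].
    exact: (transfer_Hall iso).
  have : (0 < k_pi pi G)%N.
    by rewrite card_gt0; apply/set0Pn; exists (H :^: G); apply/imsetP; exists H; rewrite ?inE.
  by move: kS; rewrite !inE => /or3P[]/eqP->; case: (k_pi pi G) => [|[|[|[|]]]].
- by split=> //; apply: not_D_pi.
apply: Hall_quotient_center; have [injpsi epsi] := isomP iso.
have nz2 : (2%:R != 0 :> F)%R.
  rewrite -(dvdn_pcharf (card_finPcharP oFp p_prime)) dvdn_prime2 //.
  by apply: contraTneq p_odd => ->.
rewrite /pgroup -(card_injm injpsi (center_sub G)) injm_center // epsi (center_SL nz2 hab).
by rewrite -orderE (order_mone nz2) pnatE.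
Qed.
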